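(* Let $m\ge1$ be an integer and let $N^g_n$ be the quasi-polynomials associated to the plane curve $x=z+1/z$, $y=z^m/m$. Let $g\ge 0$, $n\geq1$ with $2g-2+n>0$, and let $b_1,\dots,b_n$ be positive integers. Then the following hold: $$N^g_{n+1}(m,b_1,\dots,b_n)=\sum_{j=1}^n\ \sum_{\substack{1\le k\le b_j\\ k\not\equiv b_j\ (\mathrm{mod}\ 2)}}k\,N^g_n(b_1,\dots,b_n)\big|_{b_j=k},$$ $$(m+1)N^g_{n+1}(m+1,b_1,\dots,b_n)+(m-1)N^g_{n+1}(m-1,b_1,\dots,b_n)$$ $$=2m\sum_{j=1}^n\ \sum_{\substack{1\le k\le b_j\\ k\equiv b_j\ (\mathrm{mod}\ 2)}}k\,N^g_n(b_1,\dots,b_n)\big|_{b_j=k}-m\sum_{j=1}^n b_j\,N^g_n(b_1,\dots,b_n),$$ $$(m-2)N^g_{n+1}(m-2,b_1,\dots,b_n)-2m\,N^g_{n+1}(m,b_1,\dots,b_n)+(m+2)N^g_{n+1}(m+2,b_1,\dots,b_n)$$ $$=m\sum_{j=1}^n\ \sum_{k=1\pm b_j}k\,N^g_n(b_1,\dots,b_n)\big|_{b_j=k},$$ $$N^g_{n+1}(m+1,b_1,\dots,b_n)-N^g_{n+1}(m-1,b_1,\dots,b_n)=m(2g-2+n)\,N^g_n(b_1,\dots,b_n).$$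
   Context: Notation: $N^g_n(b_1,\dots,b_n)|_{b_j=k}$ means the $j$-th argument is replaced by $k$, and $\sum_{k=1\pm b_j}$ is the sum of the two terms $k=1+b_j$ and $k=1-b_j$. Eynard-Orantin invariants of a curve $x=z+1/z$, $y=y(z)$ on $\mathbb{P}^1$ with coordinate $z$, where $y$ is analytic near $z=\pm1$ and $y'(\pm1)\ne0$: the zeros of $dx$ are $z=\pm1$, and near each of them the point $\hat z\neq z$ with $x(\hat z)=x(z)$ is $\hat z=1/z$. Put $\omega^0_1=y\,dx$ and $\omega^0_2=B(w,z)=\frac{dw\,dz}{(w-z)^2}$. For $2g-2+(n+1)>0$, with $S=\{1,\dots,n\}$ and $z_I=(z_i)_{i\in I}$, define recursively $$\omega^g_{n+1}(z_0,z_S)=\sum_{\alpha=\pm1}\operatorname*{Res}_{z=\alpha}K(z_0,z)\Big[\omega^{g-1}_{n+2}(z,\hat z,z_S)+\sum_{\substack{g_1+g_2=g\\ I\sqcup J=S}}\omega^{g_1}_{|I|+1}(z,z_I)\,\omega^{g_2}_{|J|+1}(\hat z,z_J)\Big],$$ where terms containing a factor $\omega^0_1$ are omitted from the inner sum, $\omega^{-1}_{m}=0$, and $$K(z_0,z)=\frac{-\int_{\hat z}^{z}B(z_0,z')}{2\,(y(z)-y(\hat z))\,dx(z)}.$$ For $2g-2+n>0$ define $N^g_n(b_1,\dots,b_n)$ for positive integers $b_i$ by the expansion around $z_i=0$ $$\omega_n^g=\sum_{b_1,\dots,b_n>0}b_1\cdots b_n\,N^g_n(b_1,\dots,b_n)\,z_1^{b_1-1}\cdots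 z_n^{b_n-1}\,dz_1\cdots dz_n .$$ $N^g_n$ is symmetric and is a quasi-polynomial in the $b_i^2$ depending on the parity of the $b_i$: for each choice of parities of $b_1,\dots,b_n$ it is given by a polynomial in $b_1^2,\dots,b_n^2$. $N^g_n$ is evaluated at arbitrary integers (including $0$ and negative ones) by evaluating the polynomial for the corresponding parities. *)

(* Defs.v *)
From mathcomp Require Import all_boot all_order all_algebra.
From mathcomp Require Import boolp classical_sets reals.
From mathcomp Require Import mpoly.
From mathcomp Require Import complex.
Set Implicit Arguments.
Unset Strict Implicit.
Unset Printing Implicit Defensive.
Import GRing.Theory.
Local Open Scope ring_scope.

(* All the differentials involved are rational.  Those in one variable with
   parameters in a field [K] are elements of the function field
   [K(z) = {fraction {poly K}}] times [dz]. *)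
Definition ratfun_const (K : fieldType) (a : K) : {fraction {poly K}} :=
  tofrac a%:P.

Definition ratfun_var (K : fieldType) : {fraction {poly K}} := tofrac 'X.

(* Laurent decomposition at [a]: a principal part
   [sum_i c_i / (z - a)^(i + 1)] plus a function regular at [a]; the residue of
   [f dz] is [c_0] (and [c`_0 = 0] when [c] is empty). *)
Definition is_residue (K : fieldType) (a : K) (f : {fraction {poly K}})
    (r : K) : Prop :=
  exists (c : seq K) (p q : {poly K}),
    [/\ q.[a] != 0,
        f = \sum_(i < size c)
              ratfun_const c`_i / tofrac ('X - a%:P) ^+ i.+1
            + tofrac p / tofrac q
      & r = c`_0].

Definition residue (K : fieldType) (a : K) (f : {fraction {poly K}}) : K :=
  xget 0 [set r | is_residue a f r]%classic.

(* [dx = curve_dx z dz] for [x = z + 1/z]. *)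
Definition curve_dx (K : fieldType) (z : K) : K := 1 - z ^- 2.

Definition curve_y (m : nat) (K : fieldType) (z : K) : K := z ^+ m / m%:R.

Definition bergman (K : fieldType) (w z : K) : K := (w - z) ^- 2.

(* Up to the factors [dz0] and [1 / dz].  Since [1 / (z0 - z')] is a primitive
   of [1 / (z0 - z')^2] in [z'], the integral of [B(z0, z')] from [1/z] to [z]
   is [(1 / (z0 - z) - 1 / (z0 - 1/z)) dz0]. *)
Definition recursion_kernel (m : nat) (K : fieldType) (z0 z : K) : K :=
  - ((z0 - z)^-1 - (z0 - z^-1)^-1)
    / (2 * (curve_y m z - curve_y m z^-1) * curve_dx z).

(* [EO_rec N m g [:: z1; ...; zn]] is the coefficient of [dz1 ... dzn] in
   [omega^g_n] at points [zi] of an arbitrary field [K].  In the recursion the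
   points are those of [K(z)]: the variable [z], its image [1/z] and the old
   points seen as constants.  Each term of the bracket has exactly one
   argument [1/z], whence the overall factor [- z^-2] given by
   [d(1/z) = - z^-2 dz].  [N] is fuel: [2g + n] strictly decreases, so any
   [N >= 2g + n] gives the same value.  The value is meaningful at points for
   which the recursion is generic, e.g. independent indeterminates. *)
Fixpoint EO_rec (N m : nat) (K : fieldType) (g : nat) (zs : seq K) : K :=
  if N is N'.+1 then
    if zs is z0 :: zS then
      if (g == 0%N) && (size zS == 0%N) then curve_y m z0 * curve_dx z0
      else if (g == 0%N) && (size zS == 1%N) then bergman z0 zS`_0
      else
        let n := size zS in
        let z := ratfun_var K in
        let pts (I : {set 'I_n}) :=
          [seq ratfun_const zS`_(i : 'I_n) | i <- enum I] in
        let W := @EO_rec N' m {fraction {poly K}} in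
        let bracket :=
          (if g is g'.+1 then W g' [:: z, z^-1 & map (@ratfun_const K) zS]
           else 0)
          + \sum_(g1 < g.+1)
              \sum_(I : {set 'I_n} |
                    ((0 < g1) || (0 < #|I|))%N
                    && ((0 < g - g1) || (0 < #|~: I|))%N)
                W g1 (z :: pts I) * W (g - g1)%N (z^-1 :: pts (~: I)) in
        \sum_(a <- [:: 1; -1])
          residue a
            (recursion_kernel m (ratfun_const z0) z * (bracket * (- z ^- 2)))
    else 0
  else 0.

Definition EO_invariant (m : nat) (K : fieldType) (g : nat) (zs : seq K) : K :=
  EO_rec (2 * g + size zs) m g zs.

(* Power series expansion at the origin of a rational function in [n]
   variables: [f = P / Q] with [Q(0) <> 0], and [c] satisfies
   [Q * (sum_k c_k X^k) = P] coefficientwise. *)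
Definition expansion_at0 (F : fieldType) (n : nat)
    (f : {fraction {mpoly F[n]}}) (c : 'X_{1..n} -> F) : Prop :=
  exists P Q : {mpoly F[n]},
    [/\ Q@_0%MM != 0,
        f = tofrac P / tofrac Q
      & forall k : 'X_{1..n},
          \sum_(u : 'X_{1..n < (mdeg k).+1, (mdeg k).+1} | k == (u.1 + u.2)%MM)
            Q@_u.1 * c u.2 = P@_k].

Definition quasi_polynomial_sq (F : fieldType) (n : nat)
    (N : n.-tuple int -> F) : Prop :=
  forall e : n.-tuple bool, exists p : {mpoly F[n]},
    forall b : n.-tuple int,
      (forall i, odd `|tnth b i|%N = tnth e i) ->
      N b = p.@[fun i => (tnth b i)%:~R ^+ 2].

Definition symmetric_tuple (F : fieldType) (n : nat)
    (N : n.-tuple int -> F) : Prop :=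
  forall b b' : n.-tuple int, perm_eq b b' -> N b = N b'.

(* [N g n] is the family [N^g_n] attached to [x = z + 1/z], [y = z^m / m].
   The expansion determines [N g n] at positive arguments ([b_i = k i + 1] for
   the exponent [k i] of the [i]-th variable); quasi-polynomiality then
   determines it at all integers, [0] and negative ones included. *)
Definition EO_quasi_polynomials (F : fieldType) (m : nat)
    (N : forall g n : nat, n.-tuple int -> F) : Prop :=
  forall g n : nat, (0 < n)%N -> (2 < 2 * g + n)%N ->
    [/\ expansion_at0
          (EO_invariant m g
             [seq tofrac ('X_i : {mpoly F[n]}) | i <- enum 'I_n])
          (fun k => (\prod_(i < n) (k i).+1%:R)
                    * N g n [tuple (k i).+1%:Z | i < n]),
        quasi_polynomial_sq (N g n)
      & symmetric_tuple (N g n)].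

Definition replace_arg (n : nat) (b : n.-tuple int) (j : 'I_n) (k : int) :
    n.-tuple int :=
  [tuple if i == j then k else tnth b i | i < n].

(* Main.v *)
(** Put [s = z + 1/z], [t = z_0 + 1/z_0] and write
    [U_b = (z^b - z^-b) / (z - 1/z)], [C_b = z^b + z^-b], polynomials in [s].
    Multiplied by [d(1/z) / dz], the kernel is [m / (2 z_0 (z^2 - 1) (t - s) U_m)];
    up to terms without residues, the rest is a function of [s] with poles only
    at [s = 2] and [s = -2].  On the coefficients
    [c_g(b_1, ..., b_n) = b_1 ... b_n N^g_n(b_1, ..., b_n)] the recursion reads:
    [c_g(b_0, b_1, ...)] is [m] times the sum of the residues at [s = 2, -2] of
    [U_(b_0) / U_m] times a function independent of [b_0].

    If [sum_b lam_b U_b = w U_m], the combination with weights [lam_b] over [b_0]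
    loses the denominator [U_m].  For [w = 1, s, s^2 - 4] the terms without an
    [omega^0_2] factor then have no residue at infinity and vanish, while each
    [omega^0_2] factor contributes [b_j C_(b_j)]; this gives the first three
    relations.

    For the last one, let [sum_b lam_b C_b = (s^2 - 4) U_m] modulo a large power
    of [s^2 - 4], as for [C_(m+1) - C_(m-1)].  By symmetry the recursion may be
    run on another argument than the one summed over with weights [lam_b / b].
    By induction on [2g + n] the terms where this argument sits in a stable
    factor give a multiple of the previous invariant, and in the [omega^0_2]
    factor it produces [(s^2 - 4) U_m], which cancels the kernel. *)

From HB Require Import structures.
From mathcomp Require Import all_boot all_order all_algebra.
From mathcomp Require Import boolp classical_sets reals.
From mathcomp Require Import mpoly complex.
From mathcomp Require Import ring zify.
Require Import Defs.
Set Implicit Arguments.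
Unset Strict Implicit.
Unset Printing Implicit Defensive.
Import GRing.Theory.
Local Open Scope ring_scope.

(** * Chebyshev polynomials *)

(** The recursion evaluates earlier invariants at the points [z] and [1/z] of a new function field,
    so power series at the origin do not carry the induction. The inductive statement [represents]
    concerns values at generic points of every field over [F]: each value is a finite combination of
    products of explicit functions [phi], with the numbers [c] as coefficients. The functions [phi]
    come from a truncation of [1 / (t - s)]: the quotient of [discr t ^ e - discr s ^ e] by [t - s]
    is a sum of terms [Psi e b] in [t] times [chebU] in [s], so [1 / (t - s)] is a finite sum up to
    a multiple of [discr s ^ e], which has no residue once [e] is at least the order of the pole.
    The factors in [t] give [phi], those in [s] the [U_(b_0)] of the coefficient recursion. The
    level [e] is free above a bound [k] depending on [2g + n]: the recursion variable is taken at
    level [k], which fixes the denominator, the outer points at levels high enough to reach any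
    prescribed coefficient. Division by [U_m] becomes multiplication by a polynomial [sigma], its
    inverse modulo a power of [discr], so that all residues are linear forms [res k] on
    polynomials. *)

(* At [x = z + 1/z] one has [chebU x n = (z^n - z^-n) / (z - 1/z)],
   [chebC x n = z^n + z^-n] and [discr x = (z - 1/z)^2]. *)
Fixpoint chebU (A : comNzRingType) (x : A) (n : nat) : A :=
  match n with
  | 0 => 0
  | 1 => 1
  | (n'.+1 as n1).+1 => x * chebU x n1 - chebU x n'
  end.

Fixpoint chebC (A : comNzRingType) (x : A) (n : nat) : A :=
  match n with
  | 0 => 2
  | 1 => x
  | (n'.+1 as n1).+1 => x * chebC x n1 - chebC x n'
  end.

Arguments chebU : simpl nomatch.
Arguments chebC : simpl nomatch.

Definition discr (A : comNzRingType) (x : A) : A := x ^+ 2 - 4.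

Lemma nat_ind2 (P : nat -> Prop) :
  P 0%N -> P 1%N -> (forall n, P n -> P n.+1 -> P n.+2) -> forall n, P n.
Proof.
move=> P0 P1 PS n; suff: P n /\ P n.+1 by case.
by elim: n => // n [Pn PSn]; split=> //; apply: PS.
Qed.

Section Cheb.
Variables (A : comNzRingType) (x : A).

Lemma chebUSS n : chebU x n.+2 = x * chebU x n.+1 - chebU x n.
Proof. by []. Qed.

Lemma chebCSS n : chebC x n.+2 = x * chebC x n.+1 - chebC x n.
Proof. by []. Qed.

Lemma chebC_U n : chebC x n.+1 = chebU x n.+2 - chebU x n.
Proof.
elim/nat_ind2: n => [||n IH1 IH2]; [by rewrite /=; ring..|].
by rewrite chebCSS IH2 IH1 !chebUSS; ring.
Qed.

Lemma chebC_sub n : chebC x n.+2 - chebC x n = discr x * chebU x n.+1.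
Proof.
rewrite /discr; elim/nat_ind2: n => [||n IH1 IH2]; [by rewrite /=; ring..|].
rewrite chebUSS mulrBr mulrCA -IH1 -IH2 !chebCSS; ring.
Qed.

Lemma chebU_sub n :
  chebU x n.+4 - 2 * chebU x n.+2 + chebU x n = discr x * chebU x n.+2.
Proof. by rewrite /discr !chebUSS; ring. Qed.

Lemma rmorph_chebU (B : comNzRingType) (f : {rmorphism A -> B}) n :
  f (chebU x n) = chebU (f x) n.
Proof.
elim/nat_ind2: n => [||n IH1 IH2]; [exact: rmorph0|exact: rmorph1|].
by rewrite !chebUSS rmorphB rmorphM IH1 IH2.
Qed.

Lemma rmorph_chebC (B : comNzRingType) (f : {rmorphism A -> B}) n :
  f (chebC x n) = chebC (f x) n.
Proof.
elim/nat_ind2: n => [||n IH1 IH2] //; first exact: rmorph_nat.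
by rewrite !chebCSS rmorphB rmorphM IH1 IH2.
Qed.

Lemma rmorph_discr (B : comNzRingType) (f : {rmorphism A -> B}) :
  f (discr x) = discr (f x).
Proof. by rewrite /discr rmorphB rmorphXn rmorph_nat. Qed.

(** Discrete variation of constants: [chebU] is the fundamental solution of
    [x * r b.+1 - r b.+2 - r b = 0], so a sequence starting at [0] is recovered from [r 1] and its
    defect in this equation. *)
Lemma chebU_conv (r : nat -> A) n : r 0 = 0 ->
  \sum_(b < n) chebU x (n - b) * (x * r b.+1 - r b.+2 - r b)
  = chebU x n.+1 * r 1 - r n.+1.
Proof.
move=> r0; elim/nat_ind2: n => [||n IH1 IH2].
- by rewrite big_ord0 /=; ring.
- by rewrite big_ord_recl big_ord0 /= r0; ring.
rewrite big_ord_recr /= subSnn.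
have -> : \sum_(i < n.+1) chebU x (n.+2 - i) * (x * r i.+1 - r i.+2 - r i)
   = x * (\sum_(i < n.+1) chebU x (n.+1 - i) * (x * r i.+1 - r i.+2 - r i))
   - \sum_(i < n) chebU x (n - i) * (x * r i.+1 - r i.+2 - r i).
  have -> : \sum_(i < n) chebU x (n - i) * (x * r i.+1 - r i.+2 - r i)
    = \sum_(i < n.+1) chebU x (n - i) * (x * r i.+1 - r i.+2 - r i).
    by rewrite big_ord_recr /= subnn mul0r addr0.
  rewrite mulr_sumr -sumrB; apply: eq_bigr => i _.
  have le_in : (i <= n)%N by rewrite -ltnS.
  by rewrite !subSn ?(leq_trans le_in) // chebUSS; ring.
rewrite IH1 IH2 /=; ring.
Qed.

End Cheb.

(** This is [z d/dz] applied to [z^n - z^-n = (z - 1/z) U_n]. It passes from the expansion of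
    [1 / (t - s)] to that of the [omega^0_2] factors. *)
Lemma chebC_deriv (A : comNzRingType) n :
  n%:R * chebC 'X n
  = 'X * chebU 'X n + discr 'X * (chebU 'X n)^`() :> {poly A}.
Proof.
elim/nat_ind2: n => [||n IH1 IH2].
- by rewrite /= deriv0; ring.
- by rewrite /= -[1]/(1%:P) derivC; ring.
have E := chebC_sub ('X : {poly A}) n.
rewrite chebUSS derivB derivM derivX mul1r.
have -> : 'X * ('X * chebU 'X n.+1 - chebU 'X n) +
  discr 'X * (chebU 'X n.+1 + 'X * (chebU 'X n.+1)^`() - (chebU 'X n)^`())
  = 'X * ('X * chebU 'X n.+1 + discr 'X * (chebU 'X n.+1)^`())
   - ('X * chebU 'X n + discr 'X * (chebU 'X n)^`())
   + discr 'X * chebU 'X n.+1 :> {poly A} by ring.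
rewrite -IH1 -IH2 -E chebCSS !mulrS; ring.
Qed.

Lemma chebU2 (A : comNzRingType) n : chebU (2 : A) n = n%:R.
Proof.
elim/nat_ind2: n => // n IH1 IH2; rewrite chebUSS IH1 IH2 -[n.+2]addn2 -[n.+1]addn1.
by rewrite !natrD; ring.
Qed.

Lemma chebUN (A : comNzRingType) (x : A) n :
  chebU (- x) n = (-1) ^+ n.+1 * chebU x n.
Proof.
elim/nat_ind2: n => [||n IH1 IH2]; [by rewrite /=; ring..|].
by rewrite !chebUSS IH1 IH2 !exprS; ring.
Qed.

Lemma chebU_joukowski (K : fieldType) (z : K) n : z != 0 ->
  (z - z^-1) * chebU (z + z^-1) n = z ^+ n - z ^- n.
Proof.
move=> z0; elim/nat_ind2: n => [||n IH1 IH2].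
- by rewrite /= invr1; ring.
- by rewrite /= mulr1.
rewrite chebUSS mulrBr mulrCA IH1 IH2 !exprS !invfM.
have := expf_neq0 n z0; move: (z ^+ n) => y y0; field; by rewrite y0 z0.
Qed.

(** * Residues of quotients by powers of [discr], and the basis dual to [chebU] *)

Section ChebPoly.
Variable F : fieldType.
Implicit Types p : {poly F}.

Lemma chebU_monic_size n :
  (chebU ('X : {poly F}) n.+1 \is monic) && (size (chebU ('X : {poly F}) n.+1) == n.+1).
Proof.
elim/nat_ind2: n => [||n /andP[m1 /eqP s1] /andP[m2 /eqP s2]].
- by rewrite /= monic1 size_poly1.
- by rewrite /= mulr1 subr0 monicX size_polyX.
rewrite chebUSS.
have sx : size ('X * chebU ('X : {poly F}) n.+2) = n.+3.
  by rewrite mulrC size_mulX ?s2 // monic_neq0.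
have lt : (size (- chebU ('X : {poly F}) n.+1)%R < size ('X * chebU ('X : {poly F}) n.+2)%R)%N.
  by rewrite sx size_polyN s1.
rewrite size_polyDl // sx eqxx andbT monicE lead_coefDl // lead_coefM lead_coefX.
by rewrite mul1r -monicE.
Qed.

Lemma chebU_monic n : chebU ('X : {poly F}) n.+1 \is monic.
Proof. by case/andP: (chebU_monic_size n). Qed.

Lemma size_chebU n : size (chebU ('X : {poly F}) n) = n.
Proof.
by case: n => [|n]; [rewrite size_poly0 | case/andP: (chebU_monic_size n) => _ /eqP].
Qed.

Lemma discrE : discr ('X : {poly F}) = 'X^2 - 4%:P.
Proof. by rewrite /discr -polyC_natr. Qed.

Lemma size_discr : size (discr ('X : {poly F})) = 3.
Proof. by rewrite discrE size_XnsubC. Qed.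

Lemma discr_monic : discr ('X : {poly F}) \is monic.
Proof. by rewrite discrE monicXnsubC. Qed.

Lemma discrX_monic k : discr ('X : {poly F}) ^+ k \is monic.
Proof. exact/monic_exp/discr_monic. Qed.

Lemma size_discrX k : size (discr ('X : {poly F}) ^+ k) = k.*2.+1.
Proof.
rewrite polySpred ?monic_neq0 ?discrX_monic // size_exp size_discr /= mulnC.
by rewrite muln2.
Qed.

Lemma chebU_span d p : (size p <= d)%N ->
  exists q : seq F, size q = d /\ p = \sum_(k < d) q`_k *: chebU 'X k.+1.
Proof.
elim: d p => [|d IH] p szp.
  exists [::]; split=> //; rewrite big_ord0; apply/eqP.
  by rewrite -size_poly_eq0 -leqn0.
have [|q [szq eq]] := IH (p - p`_d *: chebU 'X d.+1).
  apply/leq_sizeP => j; rewrite leq_eqVlt => /orP[/eqP <-|ltdj].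
    have := chebU_monic d; rewrite monicE lead_coefE size_chebU /= => /eqP E.
    by rewrite coefB coefZ E mulr1 subrr.
  rewrite coefB coefZ [p`_j]nth_default ?(leq_trans szp) // sub0r.
  by rewrite [_`_j]nth_default ?mulr0 ?oppr0 ?size_chebU.
exists (rcons q p`_d); split; first by rewrite size_rcons szq.
rewrite big_ord_recr /= nth_rcons szq ltnn eqxx.
rewrite -{1}[p](subrK (p`_d *: chebU 'X d.+1)) {1}eq; congr (_ + _).
by apply: eq_bigr => i _; rewrite nth_rcons szq ltn_ord.
Qed.

(* [res k p] is the sum of the residues of [p / discr ^ k] at [2] and [-2]. *)
Definition res k p : F := (p %% discr 'X ^+ k)`_(k.*2.-1).

Lemma res_is_scalar k : scalar (res k).
Proof. by move=> a p q; rewrite /res modpD modpZl coefD coefZ. Qed.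

HB.instance Definition _ k :=
  GRing.isLinear.Build F {poly F} F *%R (res k) (res_is_scalar k).

(** The quotient by [discr ^ k] is then [O(s^-2)] at infinity, and the finite residues add up to
    zero. *)
Lemma res_small k p : (size p < k.*2)%N -> res k p = 0.
Proof.
case: k => // k; rewrite doubleS ltnS => szp; rewrite /res modp_small.
  by rewrite nth_default.
by rewrite size_discrX doubleS ltnS (leq_trans szp) // ltnW.
Qed.

Lemma res_dvd k p : discr 'X ^+ k %| p -> res k p = 0.
Proof. by rewrite /res => /modp_eq0 ->; rewrite coef0. Qed.

(** Both sides concern the same fraction, [p / discr ^ k]. *)
Lemma res_discr k p : res k.+1 (p * discr 'X) = res k p.
Proof.
rewrite /res; set r : {poly F} := p %% discr 'X ^+ k.
have szr : (size r <= k.*2)%N.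
  by rewrite -ltnS -[X in (_ < X)%N]size_discrX ltn_modpN0 // monic_neq0 ?discrX_monic.
have E : r * discr 'X = (p * discr 'X) %% discr 'X ^+ k.+1.
  apply: (@modpP _ _ (p %/ discr 'X ^+ k)).
    by rewrite exprSr mulrA -mulrDl -divp_eq.
  rewrite size_discrX (leq_ltn_trans (size_polyMleq _ _)) // size_discr addn3 /=.
  by rewrite doubleS !ltnS.
rewrite -E {E}; clearbody r; rewrite discrE mulrBr coefB coefMXn coefMC doubleS /= subSS.
case: k r szr => [|k] r szr; last first.
  by rewrite doubleS subn1 /= [X in _ - X * _]nth_default ?mul0r ?subr0 // (leq_trans szr) // doubleS.
by move: szr; rewrite leqn0 size_poly_eq0 => /eqP->; rewrite !coef0 mul0r subr0.
Qed.

Lemma res_discrX k j p : res (k + j) (p * discr 'X ^+ j) = res k p.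
Proof.
elim: j p => [|j IH] p; first by rewrite addn0 mulr1.
by rewrite addnS exprSr mulrA res_discr IH.
Qed.

Lemma res_mod k p q : discr 'X ^+ k %| p - q -> res k p = res k q.
Proof. by move=> /res_dvd; rewrite linearB => /eqP; rewrite subr_eq0 => /eqP. Qed.

Lemma qcoef_ex e : exists q : seq F,
  (size q == e.*2.+1) && (discr 'X ^+ e == \sum_(k < e.*2.+1) q`_k *: chebU 'X k.+1).
Proof.
have [q [szq E]] := @chebU_span e.*2.+1 (discr 'X ^+ e) (eq_leq (size_discrX e)).
by exists q; rewrite szq -E !eqxx.
Qed.

Definition qcoef e := xchoose (qcoef_ex e).

Lemma qcoefE e : discr 'X ^+ e = \sum_(k < e.*2.+1) (qcoef e)`_k *: chebU 'X k.+1.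
Proof. by have /andP[_ /eqP] := xchooseP (qcoef_ex e). Qed.

Lemma qcoef_lead e : (qcoef e)`_(e.*2) = 1.
Proof.
have E := congr1 (fun p : {poly F} => p`_(e.*2)) (qcoefE e).
have := discrX_monic e; rewrite monicE lead_coefE size_discrX /= => /eqP E1.
rewrite E1 big_ord_recr /= coefD coef_sum big1 ?add0r in E => [|i _]; last first.
  by rewrite coefZ [X in _ * X]nth_default ?mulr0 // size_chebU.
have := chebU_monic e.*2; rewrite monicE lead_coefE size_chebU /= => /eqP E2.
by rewrite E coefZ E2 mulr1.
Qed.

(** With [Q = discr ^ e], these are the coefficients of [(Q(t) - Q(s)) / (t - s)], a Bezoutian, in
    the basis [chebU s b.+1]. The index [k] of [qcoef] belongs to [chebU k.+1]. *)
Definition Psi e b : {poly F} :=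
  \sum_(k < e.*2.+1) (if (b < k)%N then (qcoef e)`_k *: chebU 'X (k - b) else 0).

Lemma size_Psi e b : (size (Psi e b) <= e.*2)%N.
Proof.
apply: (leq_trans (size_sum _ _ _)); apply/bigmax_leqP => k _.
case: ifP => _; last by rewrite size_poly0.
rewrite (leq_trans (size_scale_leq _ _)) // size_chebU (leq_trans (leq_subr _ _)) //.
by rewrite -ltnS.
Qed.

(* Duality of [Psi] and [chebU], as summation by parts. *)
Lemma Psi_conv (B : comNzRingType) (f : {rmorphism {poly F} -> B}) e (r : nat -> B) :
  r 0 = 0 ->
  \sum_(b < e.*2) f (Psi e b) * (f 'X * r b.+1 - r b.+2 - r b)
  = f (discr 'X ^+ e) * r 1
    - \sum_(k < e.*2.+1) f ((qcoef e)`_k)%:P * r k.+1.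
Proof.
move=> r0; rewrite qcoefE rmorph_sum mulr_suml -sumrB.
transitivity (\sum_(k < e.*2.+1) f ((qcoef e)`_k)%:P *
    (\sum_(b < k) chebU (f 'X) (k - b) * (f 'X * r b.+1 - r b.+2 - r b))); last first.
  apply: eq_bigr => k _; rewrite chebU_conv // mulrBr -mul_polyC rmorphM.
  by rewrite rmorph_chebU mulrA.
rewrite /Psi.
under eq_bigr do rewrite rmorph_sum mulr_suml.
rewrite exchange_big /=; apply: eq_bigr => k _.
rewrite mulr_sumr.
pose d b := f 'X * r b.+1 - r b.+2 - r b.
rewrite -(big_mkord xpredT (fun b =>
  f (if (b < k)%N then (qcoef e)`_k *: chebU 'X (k - b) else 0) * d b)).
rewrite -(big_mkord xpredT (fun b => f ((qcoef e)`_k)%:P * (chebU (f 'X) (k - b) * d b))).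
have lek : (k <= e.*2)%N by rewrite -ltnS.
rewrite (big_cat_nat _ lek) //= [X in _ + X]big_nat [X in _ + X]big1 ?addr0 => [|b /andP[lekb _]].
  apply: eq_big_nat => b /andP[_ ->]; rewrite -mul_polyC rmorphM rmorph_chebU.
  by rewrite mulrA.
by rewrite ltnNge lekb /= rmorph0 mul0r.
Qed.

(** The morphisms [f] and [g] play the roles of evaluation at [t] and at [s]. In [Psi_conv] with
    [r b = g (chebU 'X b)] the defect is [(f 'X - g 'X) * r b.+1]. *)
Lemma Psi_kernel (B : comNzRingType) (f g : {rmorphism {poly F} -> B}) e :
  (forall a, f a%:P = g a%:P) ->
  (f 'X - g 'X) * (\sum_(b < e.*2) f (Psi e b) * g (chebU 'X b.+1))
  = f (discr 'X ^+ e) - g (discr 'X ^+ e).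
Proof.
move=> fg; have := @Psi_conv B f e (fun b => g (chebU 'X b)) (rmorph0 g).
rewrite /= rmorph1 mulr1.
have -> : \sum_(k < e.*2.+1) f ((qcoef e)`_k)%:P * g (chebU 'X k.+1) = g (discr 'X ^+ e).
  rewrite qcoefE rmorph_sum; apply: eq_bigr => k _.
  by rewrite fg -mul_polyC [RHS]rmorphM.
move=> <-; rewrite mulr_sumr; apply: eq_bigr => b _.
by rewrite ?chebUSS rmorphB rmorphM; ring.
Qed.

(** [Psi e] and [chebU] are dual for the pairing [res e]: the operator on the left is linear,
    commutes with ['X] below the top degree and fixes [1]. *)
Lemma Psi_repro e p : (size p <= e.*2)%N ->
  \sum_(b < e.*2) res e (chebU 'X b.+1 * p) *: Psi e b = p.
Proof.
pose L (p : {poly F}) : {poly F} := \sum_(b < e.*2) res e (chebU 'X b.+1 * p) *: Psi e b.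
have L_lin a (q r : {poly F}) : L (a *: q + r) = a *: L q + L r.
  rewrite /L scaler_sumr -big_split; apply: eq_bigr => b _ /=.
  by rewrite mulrDr -scalerAr linearP scalerDl scalerA.
(* [Psi_conv] with [r b = res e (chebU 'X b * q)]: the boundary term [r 1] vanishes by degree, and
   the sum over [qcoef] is the residue of a multiple of [discr ^ e]. *)
have LX (q : {poly F}) : (size q < e.*2)%N -> L ('X * q) = 'X * L q.
  move=> szq.
  have := @Psi_conv {poly F} idfun e (fun b => (res e (chebU 'X b * q))%:P).
  rewrite mul0r linear0 => /(_ erefl) /=; rewrite mul1r (res_small szq) mulr0 sub0r.
  have -> : \sum_(k < e.*2.+1) ((qcoef e)`_k)%:P * (res e (chebU 'X k.+1 * q))%:P = 0.
    transitivity ((res e (discr 'X ^+ e * q))%:P); last by rewrite res_dvd // dvdp_mulr.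
    rewrite qcoefE mulr_suml linear_sum rmorph_sum; apply: eq_bigr => k _.
    by rewrite -polyCM -scalerAl linearZ.
  rewrite oppr0 => E; apply/eqP; rewrite eq_sym -subr_eq0 -E; apply/eqP.
  rewrite /L mulr_sumr -sumrB; apply: eq_bigr => b _.
  rewrite -!mul_polyC ?chebUSS mulrBl linearB /= polyCB [chebU _ _ * (_ * q)]mulrCA mulrA.
  by rewrite !mulrA; ring.
(* By degree only the top index [b = 2e - 1] contributes; there the residue is [1] and
   [Psi e b = 1]. *)
have L1 : (0 < e)%N -> L 1 = 1.
  case: e @L L_lin LX => // e L L_lin LX _; rewrite /L.
  rewrite (bigD1 (Ordinal (ltnSn e.*2.+1))) // big1 => [|b neb].
    rewrite mulr1 /res modp_small ?size_chebU ?size_discrX ?doubleS //.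
    have := chebU_monic e.*2.+1; rewrite monicE lead_coefE size_chebU => /eqP/= ->.
    rewrite scale1r addr0 /Psi big_ord_recr /= big1 => [|k _].
      by rewrite doubleS ltnSn subSnn add0r (qcoef_lead e.+1) scale1r.
    by rewrite ltnNge -ltnS -doubleS ltn_ord.
  rewrite res_small ?scale0r // mulr1 size_chebU.
  have lt_b : (b < e.*2.+2)%N := ltn_ord b.
  rewrite ltn_neqAle lt_b andbT.
  by apply: contraNneq neb => - [E]; apply/eqP/val_inj.
elim/poly_ind: p => [|p c IH] szp; first by rewrite big1 // => b _; rewrite mulr0 linear0 scale0r.
have e0 : (0 < e)%N \/ p * 'X + c%:P = 0.
  by case: (e) szp => [|//]; [rewrite double0 leqn0 size_poly_eq0 => /eqP->; right|left].
case: e0 => [e0|->]; last by rewrite big1 // => b _; rewrite mulr0 linear0 scale0r.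
rewrite -/(L _); have E : p * 'X + c%:P = c *: 1 + 'X * p by rewrite addrC alg_polyC [_ * 'X]mulrC.
rewrite E L_lin L1 //.
have [->|p0] := eqVneq p 0.
  rewrite mulr0; congr (_ + _).
  by rewrite /L big1 // => b _; rewrite mulr0 linear0 scale0r.
have szp1 : (size p < e.*2)%N by move: szp; rewrite size_MXaddC (negPf p0).
by rewrite LX // /L IH // ltnW.
Qed.

End ChebPoly.

(** * Residues in the coordinate [z + 1/z] *)

HB.instance Definition _ (K : fieldType) :=
  GRing.RMorphism.copy (@ratfun_const K) (@FracField.tofrac {poly K} \o @polyC K).

Lemma expr_quotD (L : fieldType) (t : L) i j : t != 0 ->
  t ^+ i / t ^+ (i + j) = (t ^+ j)^-1.
Proof. by move=> t0; rewrite exprD invfM mulrA divff ?mul1r ?expf_neq0. Qed.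

Lemma frac_diff (L : fieldType) (a b x y p q p' q' : L) :
  x != 0 -> y != 0 -> q != 0 -> q' != 0 -> a / x + p / q = b / y + p' / q' ->
  (a * y - b * x) * (q * q') = x * y * (p' * q - p * q').
Proof.
move=> x0 y0 q0 q'0 E.
have E' : a / x - b / y = p' / q' - p / q.
  by apply/eqP; rewrite subr_eq addrAC eq_sym subr_eq eq_sym E addrC.
transitivity ((a / x - b / y) * (x * y * q * q')).
  by field; rewrite x0 y0.
by rewrite E'; field; rewrite q'0 q0.
Qed.

Lemma frac_sum (L : fieldType) (a b x y p q p' q' : L) :
  x != 0 -> y != 0 -> q != 0 -> q' != 0 ->
  a / x + p / q + (b / y + p' / q')
  = (a * y + b * x) / (x * y) + (p * q' + p' * q) / (q * q').
Proof. by move=> x0 y0 q0 q'0; field; rewrite x0 y0 q0 q'0. Qed.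

Section Residue.
Variable K : fieldType.
Implicit Types (a : K) (f g : {fraction {poly K}}) (p q A : {poly K}).
Local Notation "p %:F" := (tofrac p).

Lemma tofrac_XsubC_neq0 a : ('X - a%:P)%:F != 0 :> {fraction {poly K}}.
Proof. by rewrite tofrac_eq0 polyXsubC_eq0. Qed.

Lemma horner_neq0 p a : p.[a] != 0 -> p%:F != 0 :> {fraction {poly K}}.
Proof. by rewrite tofrac_eq0; apply: contraNneq => ->; rewrite horner0. Qed.

Lemma coef_mul_XsubCexp a n k (C : {poly K}) : (size C <= k.+1)%N ->
  (C * ('X - a%:P) ^+ n)`_(k + n) = C`_k.
Proof.
move=> szC; rewrite mulrC coefM.
have ltn : (n < (k + n).+1)%N by rewrite ltnS leq_addl.
rewrite (bigD1 (Ordinal ltn)) //= addnK big1 ?addr0 => [|i /eqP nei].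
  have := monic_exp n (monicXsubC a).
  by rewrite monicE lead_coefE size_exp_XsubC /= => /eqP->; rewrite mul1r.
have [lt|le] := ltnP i n.
  rewrite [C`_(_)]nth_default ?mulr0 // (leq_trans szC) //.
  by rewrite ltn_subRL addnC ltn_add2l.
rewrite nth_default ?mul0r // size_exp_XsubC ltn_neqAle le andbT.
by apply/eqP => E2; apply: nei; apply: val_inj; apply: esym.
Qed.

(** For [A] of degree at most [M], the Taylor coefficient of order [M] at [a] is the top coefficient
    of [A]. Over a common denominator the residue can thus be read off without expanding at [a],
    which suits sums and comparisons. *)
Lemma is_residueP a f (r : K) :
  is_residue a f r <-> exists M A p q,
    [/\ (size A <= M.+1)%N, q.[a] != 0,
        f = A%:F / ('X - a%:P)%:F ^+ M.+1 + p%:F / q%:F & r = A`_M].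
Proof.
have t0 := tofrac_XsubC_neq0 a; set t := ('X - a%:P)%:F in t0 *.
split=> [[c [p [q [q0 -> ->]]]]|[M [A [p [q [szA q0 -> ->]]]]]].
  exists (size c), (\sum_(i < size c) (c`_i)%:P * ('X - a%:P) ^+ (size c - i)), p, q.
  split=> //.
  - apply: (leq_trans (size_sum _ _ _)); apply/bigmax_leqP => i _.
    rewrite mul_polyC (leq_trans (size_scale_leq _ _)) // size_exp_XsubC ltnS.
    exact: leq_subr.
  - congr (_ + _); rewrite rmorph_sum mulr_suml; apply: eq_bigr => i _.
    rewrite rmorphM rmorphXn /ratfun_const -mulrA; congr (_ * _).
    rewrite -/t (_ : (size c).+1 = (size c - i) + i.+1)%N; last first.
      by rewrite addnS subnK // ltnW.
    by rewrite expr_quotD.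
  - rewrite [RHS]coef_sum; case: c => [|x c]; first by rewrite big_ord0.
    rewrite big_ord_recl big1 ?addr0 => [|i _]; last first.
      by rewrite mul_polyC coefZ [X in _ * X]nth_default ?mulr0 // size_exp_XsubC lift0 subSS ltnS leq_subr.
    have := monic_exp (size c).+1 (monicXsubC a).
    rewrite mul_polyC coefZ monicE lead_coefE size_exp_XsubC /= subn0.
    by move=> /eqP->; rewrite mulr1.
pose B := A \Po ('X + a%:P).
have szB : size B = size A by rewrite size_comp_poly2 // size_XaddC.
have AB : A = \sum_(i < M.+1) B`_i *: ('X - a%:P) ^+ i.
  have -> : A = B \Po ('X - a%:P).
    by rewrite /B -comp_polyA comp_polyD comp_polyX comp_polyC subrK comp_polyXr.
  rewrite comp_polyE szB (big_ord_widen _ (fun i => B`_i *: ('X - a%:P) ^+ i) szA).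
  rewrite big_mkcond /=; apply: eq_bigr => i _; case: ltnP => // le.
  by rewrite nth_default ?szB // scale0r.
exists (mkseq (fun i => B`_(M - i)) M.+1), p, q; split=> //; last first.
  rewrite nth_mkseq // subn0 [in LHS]AB big_ord_recr /= coefD coefZ.
  have := monic_exp M (monicXsubC a).
  rewrite monicE lead_coefE size_exp_XsubC /= => /eqP->; rewrite mulr1 coef_sum.
  by rewrite big1 ?add0r // => i _; rewrite coefZ [X in _ * X]nth_default ?mulr0 // size_exp_XsubC.
congr (_ + _); rewrite size_mkseq {1}AB rmorph_sum mulr_suml.
rewrite (reindex_inj rev_ord_inj); apply: eq_bigr => i _ /=.
rewrite nth_mkseq // subSS -mul_polyC rmorphM rmorphXn -/t /ratfun_const -mulrA.
congr (_ * _).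
have {2}-> : M.+1 = ((M - i) + i.+1)%N by rewrite addnS subnK // -ltnS.
by rewrite expr_quotD.
Qed.

(** Clearing denominators makes the difference [D] of the numerators divisible by the power
    [M + N + 2] of ['X - a], because [q * q'] does not vanish at [a]; its degree is at most
    [M + N + 1]. *)
Lemma is_residue_uniq a f r s : is_residue a f r -> is_residue a f s -> r = s.
Proof.
move=> /is_residueP[M [A [p [q [szA q0 -> ->]]]]].
move=> /is_residueP[N [B [p' [q' [szB q'0 E ->]]]]].
have t0 := tofrac_XsubC_neq0 a; set t := ('X - a%:P)%:F in t0 E.
have qF := horner_neq0 q0; have q'F := horner_neq0 q'0.
pose D := A * ('X - a%:P) ^+ N.+1 - B * ('X - a%:P) ^+ M.+1.
have E1 : D * (q * q') = ('X - a%:P) ^+ (M.+1 + N.+1) * (p' * q - p * q').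
  apply/eqP; rewrite -tofrac_eq /D; apply/eqP.
  rewrite [LHS]tofracM [RHS]tofracM [X in X * _]tofracB [X in _ = _ * X]tofracB.
  rewrite !(tofracM, tofracXn) -/t exprD.
  exact: (frac_diff (expf_neq0 _ t0) (expf_neq0 _ t0) qF q'F E).
have D0 : D = 0.
  have dv : ('X - a%:P) ^+ (M.+1 + N.+1) %| D.
    rewrite -(@Gauss_dvdpl _ _ (q * q')) ?E1 ?dvdp_mulr //.
    rewrite coprimep_expl // coprimep_sym coprimep_XsubC rootM negb_or.
    by rewrite !rootE q0 q'0.
  apply: contraTeq dv => D0; apply/negP => /(dvdp_leq D0).
  rewrite size_exp_XsubC leqNgt ltnS => /negP; apply.
  apply: (leq_trans (size_polyD _ _)); rewrite size_polyN geq_max.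
  rewrite !(leq_trans (size_polyMleq _ _)) // size_exp_XsubC addnS /=.
    by rewrite addnC leq_add2l.
  by rewrite leq_add2r.
have top n k C := @coef_mul_XsubCexp a n k C.
have := congr1 (fun p : {poly K} => p`_(M + N).+1) D0.
rewrite coefB coef0 -{1}addnS top // -addSn addnC top // => /eqP.
by rewrite subr_eq0 => /eqP.
Qed.

Lemma residueE a f r : is_residue a f r -> residue a f = r.
Proof.
move=> fr; apply: (@is_residue_uniq a f) => //.
by rewrite /residue; apply: (@xgetPex _ 0 [set r | is_residue a f r]%classic); exists r.
Qed.

Lemma is_residueD a f g r s :
  is_residue a f r -> is_residue a g s -> is_residue a (f + g) (r + s).
Proof.
move=> /is_residueP[M [A [p [q [szA q0 -> ->]]]]].
move=> /is_residueP[N [B [p' [q' [szB q'0 -> ->]]]]].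
apply/is_residueP.
have t0 := tofrac_XsubC_neq0 a; set t := ('X - a%:P)%:F in t0 *.
exists (M + N.+1)%N, (A * ('X - a%:P) ^+ N.+1 + B * ('X - a%:P) ^+ M.+1).
exists (p * q' + p' * q), (q * q').
have top n k C := @coef_mul_XsubCexp a n k C.
split.
- apply: (leq_trans (size_polyD _ _)); rewrite geq_max.
  rewrite !(leq_trans (size_polyMleq _ _)) // size_exp_XsubC addnS /=.
    by rewrite -addnS -addSnnS addnC leq_add2l.
  by rewrite -addSn leq_add2r.
- by rewrite hornerM mulf_neq0.
  rewrite [X in _ = X / _ + _]tofracD [X in _ = _ + X / _]tofracD.
  rewrite !(tofracM, tofracXn) -/t -addSn exprD.
  exact: (frac_sum _ _ _ _ (expf_neq0 _ t0) (expf_neq0 _ t0) (horner_neq0 q0) (horner_neq0 q'0)).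
- by rewrite coefD top // addnC addSnnS top.
Qed.

Lemma is_residueZ a f r c : is_residue a f r -> is_residue a (ratfun_const c * f) (c * r).
Proof.
move=> /is_residueP[M [A [p [q [szA q0 -> ->]]]]]; apply/is_residueP.
exists M, (c *: A), (c *: p), q; split=> //.
- exact: leq_trans (size_scale_leq _ _) szA.
- by rewrite -!mul_polyC !tofracM mulrDr !mulrA.
- by rewrite coefZ.
Qed.

Definition regular_value a f v :=
  exists p q, [/\ q.[a] != 0, f = p%:F / q%:F & v = p.[a] / q.[a]].

Lemma regular_residue a f v : regular_value a f v -> is_residue a f 0.
Proof.
case=> p [q [q0 -> _]]; exists [::], p, q.
by split=> //; rewrite big_ord0 add0r.
Qed.

Lemma regular_poly a p : regular_value a p%:F p.[a].
Proof.
exists p, 1; rewrite hornerE oner_neq0 tofrac1 !divr1.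
by split.
Qed.

Lemma regular_const a c : regular_value a (ratfun_const c) c.
Proof. by have := regular_poly a c%:P; rewrite hornerC. Qed.

Lemma regular_var a : regular_value a (ratfun_var K) a.
Proof. by have := regular_poly a 'X; rewrite hornerX. Qed.

Lemma regularD a f g u v :
  regular_value a f u -> regular_value a g v -> regular_value a (f + g) (u + v).
Proof.
move=> [p [q [q0 -> ->]]] [p' [q' [q'0 -> ->]]].
exists (p * q' + p' * q), (q * q'); rewrite !(hornerM, hornerD) mulf_neq0 //.
split=> //; last by rewrite addf_div.
by rewrite tofracD !tofracM; apply: addf_div; [exact: horner_neq0 q0 | exact: horner_neq0 q'0].
Qed.

Lemma regularM a f g u v :
  regular_value a f u -> regular_value a g v -> regular_value a (f * g) (u * v).
Proof.
move=> [p [q [q0 -> ->]]] [p' [q' [q'0 -> ->]]].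
exists (p * p'), (q * q'); rewrite !hornerM mulf_neq0 //.
split=> //; last by rewrite mulf_div.
by rewrite mulf_div !tofracM.
Qed.

Lemma regularN a f u : regular_value a f u -> regular_value a (- f) (- u).
Proof.
move=> /(regularM (regular_const a (-1))).
by rewrite /ratfun_const polyCN tofracN tofrac1 !mulN1r.
Qed.

Lemma regularB a f g u v :
  regular_value a f u -> regular_value a g v -> regular_value a (f - g) (u - v).
Proof. by move=> fu /regularN; apply: regularD. Qed.

Lemma regularV a f u : u != 0 -> regular_value a f u -> regular_value a f^-1 u^-1.
Proof.
move=> u0 [p [q [q0 -> E]]]; exists q, p; rewrite !invf_div E invf_div.
by split=> //; move: u0; rewrite E; apply: contraNneq => ->; rewrite mul0r.
Qed.

Lemma regularX a f u n : regular_value a f u -> regular_value a (f ^+ n) (u ^+ n).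
Proof.
move=> fu; elim: n => [|n IH]; last by rewrite !exprS; apply: regularM.
by have := regular_const a 1; rewrite /ratfun_const tofrac1.
Qed.

Lemma regular_horner (F : nzRingType) (h : {rmorphism F -> K}) a f u (p : {poly F}) :
  regular_value a f u ->
  regular_value a (map_poly (@ratfun_const K \o h) p).[f] (map_poly h p).[u].
Proof.
move=> fu; elim/poly_ind: p => [|p c IH].
  rewrite !rmorph0 !horner0; have := regular_const a 0.
  by rewrite /ratfun_const polyC0 tofrac0.
rewrite !(rmorphD, rmorphM) /= !map_polyX !map_polyC !hornerE.
by apply: regularD (regular_const _ _); apply: regularM.
Qed.

Definition is_residue2 f (r : K) := exists r1 r2,
  [/\ is_residue 1 f r1, is_residue (-1) f r2 & r = r1 + r2].

Lemma is_residue2E f r : is_residue2 f r -> residue 1 f + residue (-1) f = r.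
Proof. by move=> [r1 [r2 [/residueE-> /residueE-> ->]]]. Qed.

Lemma is_residue2D f g r s :
  is_residue2 f r -> is_residue2 g s -> is_residue2 (f + g) (r + s).
Proof.
move=> [r1 [r2 [f1 f2 ->]]] [s1 [s2 [g1 g2 ->]]].
exists (r1 + s1), (r2 + s2); split; try exact: is_residueD.
by rewrite addrACA.
Qed.

Lemma is_residue2Z f r c : is_residue2 f r -> is_residue2 (ratfun_const c * f) (c * r).
Proof.
move=> [r1 [r2 [f1 f2 ->]]]; exists (c * r1), (c * r2); rewrite mulrDr.
by split=> //; apply: is_residueZ.
Qed.

Lemma is_residue2_reg f u v :
  regular_value 1 f u -> regular_value (-1) f v -> is_residue2 f 0.
Proof.
move=> /regular_residue f1 /regular_residue f2.
by exists 0, 0; rewrite addr0.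
Qed.

Lemma is_residue2_0 : is_residue2 0 0.
Proof.
have := regular_const 1 0; have := regular_const (-1) 0.
by rewrite /ratfun_const polyC0 tofrac0 => /[swap]; apply: is_residue2_reg.
Qed.

Lemma is_residue2_sum (I : Type) (r : seq I) (P : pred I) (u_ : I -> {fraction {poly K}}) (v_ : I -> K) :
  (forall i, P i -> is_residue2 (u_ i) (v_ i)) ->
  is_residue2 (\sum_(i <- r | P i) u_ i) (\sum_(i <- r | P i) v_ i).
Proof.
move=> H; elim: r => [|i r IH]; first by rewrite !big_nil; apply: is_residue2_0.
by rewrite !big_cons; case: ifP => // /H Hi; apply: is_residue2D.
Qed.

Lemma is_residue2_quot M p : (2 : K) != 0 -> (size p <= M.*2)%N ->
  is_residue2 (p%:F / (ratfun_var K ^+ 2 - 1) ^+ M) p`_(M.*2.-1).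
Proof.
move=> two0 szp.
case: M szp => [|M] szp.
  have -> : p = 0 by apply/eqP; rewrite -size_poly_eq0 -leqn0.
  by rewrite coef0 tofrac0 mul0r; apply: is_residue2_0.
have sizeX a : size (('X - a%:P) ^+ M.+1) = M.+2 by rewrite size_exp_XsubC.
have cop : coprimep (('X - 1%:P) ^+ M.+1) (('X - (-1)%:P) ^+ M.+1 : {poly K}).
  rewrite coprimep_expl // coprimep_expr // coprimep_XsubC2 //.
  by rewrite -opprD oppr_eq0 -[1 + 1]/(2 : K).
have /(Bezout_eq1_coprimepP) [[u v] /= uv] := cop.
set x := ('X - 1%:P : {poly K}) in uv cop; set y := ('X - (-1)%:P) in uv cop.
pose A := (p * v) %% x ^+ M.+1.
have szA : (size A <= M.+1)%N.
  by rewrite -ltnS -(sizeX 1) ltn_modpN0 // expf_neq0 // polyXsubC_eq0.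
have dv : x ^+ M.+1 %| p - A * y ^+ M.+1.
  have -> : p - A * y ^+ M.+1 = p * u * x ^+ M.+1 + (p * v - A) * y ^+ M.+1.
    by rewrite -[X in X - _]mulr1 -uv; ring.
  apply: dvdp_add; first exact: dvdp_mulIr.
  rewrite dvdp_mulr // /A {1}(divp_eq (p * v) (x ^+ M.+1)) addrK.
  exact: dvdp_mulIr.
have [B defB] := dvdpP _ _ dv.
have szB : (size B <= M.+1)%N.
  have [->|B0] := eqVneq B 0; first by rewrite size_poly0.
  have := congr1 (fun p : {poly K} => size p) defB.
  rewrite size_mul ?expf_neq0 ?polyXsubC_eq0 // sizeX addnS /= => E.
  rewrite -(leq_add2r M.+1) -E (leq_trans (size_polyD _ _)) // geq_max.
  rewrite size_polyN addnn szp (leq_trans (size_polyMleq _ _)) //.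
  by rewrite sizeX addnS /= -addnn leq_add2r.
have defp : p = A * y ^+ M.+1 + B * x ^+ M.+1 by rewrite -defB addrC subrK.
have top (C : {poly K}) a : (size C <= M.+1)%N ->
    (C * ('X - a%:P) ^+ M.+1)`_(M.*2.+1) = C`_M.
  by move=> szC; rewrite -addnn -addnS coef_mul_XsubCexp.
have [x0 y0] := (tofrac_XsubC_neq0 1, tofrac_XsubC_neq0 (-1)).
have fE : p%:F / (ratfun_var K ^+ 2 - 1) ^+ M.+1 =
   A%:F / x%:F ^+ M.+1 + B%:F / y%:F ^+ M.+1.
  have -> : ratfun_var K ^+ 2 - 1 = x%:F * y%:F.
    rewrite -tofracM /x /y polyCN opprK /ratfun_var -tofrac1 -tofracXn -tofracB.
    by congr (_%:F); rewrite polyC1; ring.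
  rewrite {1}defp tofracD !tofracM !tofracXn exprMn.
  exact: (esym (addf_div _ _ (expf_neq0 _ x0) (expf_neq0 _ y0))).
exists A`_M, B`_M; split.
- apply/is_residueP; exists M, A, B, (y ^+ M.+1); split=> //.
    rewrite horner_exp expf_neq0 // /y hornerXsubC opprK.
    exact: two0.
  by rewrite fE tofracXn.
- apply/is_residueP; exists M, B, A, (x ^+ M.+1); split=> //.
    rewrite horner_exp expf_neq0 // /x hornerXsubC.
    by rewrite -opprD oppr_eq0.
  by rewrite fE tofracXn addrC.
by rewrite [in LHS]defp ?doubleS /= coefD !top.
Qed.

End Residue.

(** * Change of variable from [z] to [s = z + 1/z] in residues *)

Definition pev (F B : comNzRingType) (h : F -> B) (x : B) (p : {poly F}) : B :=
  (map_poly h p).[x].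

Section Pev.
Variables (F B : comNzRingType) (h : {rmorphism F -> B}) (x : B).

Lemma pev_is_zmod : zmod_morphism (pev h x).
Proof. by move=> p q; rewrite /pev rmorphB hornerD hornerN. Qed.

Lemma pev_is_monoid : monoid_morphism (pev h x).
Proof.
by split=> [|p q]; rewrite /pev; [rewrite rmorph1 hornerC | rewrite rmorphM hornerM].
Qed.

HB.instance Definition _ := GRing.isZmodMorphism.Build _ _ (pev h x) pev_is_zmod.
HB.instance Definition _ := GRing.isMonoidMorphism.Build _ _ (pev h x) pev_is_monoid.

Lemma pevX : pev h x 'X = x. Proof. by rewrite /pev map_polyX hornerX. Qed.

Lemma pevC c : pev h x c%:P = h c. Proof. by rewrite /pev map_polyC hornerC. Qed.

Lemma pevZ c p : pev h x (c *: p) = h c * pev h x p.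
Proof. by rewrite -mul_polyC rmorphM /= pevC. Qed.

Lemma pev_discr : pev h x (discr 'X) = discr x.
Proof. by rewrite (rmorph_discr _ (pev h x)) /= pevX. Qed.

Lemma pev_chebU n : pev h x (chebU 'X n) = chebU x n.
Proof. by rewrite (rmorph_chebU _ (pev h x)) /= pevX. Qed.

Lemma pev_chebC n : pev h x (chebC 'X n) = chebC x n.
Proof. by rewrite (rmorph_chebC _ (pev h x)) /= pevX. Qed.
End Pev.

Lemma discr_joukowski (L : fieldType) (z : L) : z != 0 ->
  discr (z + z^-1) = (z ^+ 2 - 1) ^+ 2 / z ^+ 2.
Proof. by move=> z0; rewrite /discr; field. Qed.

Lemma discr_joukowski_neq0 (L : fieldType) (z : L) : z != 0 -> z ^+ 2 - 1 != 0 ->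
  discr (z + z^-1) != 0.
Proof.
by move=> z0 z1; rewrite discr_joukowski // mulf_neq0 ?invr_eq0 ?expf_neq0.
Qed.

Section JoukowskiIdentities.
Variables (L : fieldType) (z : L).
Hypotheses (z0 : z != 0) (z1 : z ^+ 2 - 1 != 0).
Let D := discr (z + z^-1).

Lemma joukowski_split k (S c w : L) :
  S * z ^+ k.*2.+1 + c * (z ^+ 2 - 1) ^+ k.*2.+1 = w * z ->
  (z ^+ 2 - 1)^-1 * (S / D ^+ k) = w / (z ^+ 2 - 1) ^+ k.*2.+1 + - c * z^-1.
Proof.
move=> E; have -> : w = (S * z ^+ k.*2.+1 + c * (z ^+ 2 - 1) ^+ k.*2.+1) / z.
  by rewrite E mulfK.
rewrite /D discr_joukowski // expr_div_n -!exprM -muln2 ![(2 * k)%N]mulnC !(exprS _ (k * 2)).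
have := expf_neq0 (k * 2) z0; have := expf_neq0 (k * 2) z1.
move: (z ^+ (k * 2)) ((z ^+ 2 - 1) ^+ (k * 2)) => x y y0 x0.
by field; rewrite ?x0 ?y0 ?z0 ?z1.
Qed.

Lemma joukowski_frac k (P U r v : L) : U != 0 -> P = U * r + v * D ^+ k.+1 ->
  (z ^+ 2 - 1)^-1 * (P / (D ^+ k * U))
  = (z ^+ 2 - 1)^-1 * (r / D ^+ k) + (z ^+ 2 - 1) * z^-1 ^+ 2 * v / U.
Proof.
move=> U0 ->; have D0 : D ^+ k != 0 by rewrite expf_neq0 // discr_joukowski_neq0.
have -> : D ^+ k.+1 = (z ^+ 2 - 1) ^+ 2 / z ^+ 2 * D ^+ k by rewrite exprS /D discr_joukowski.
move: (D ^+ k) D0 => x x0.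
by field; rewrite ?x0 ?U0 ?z0 ?z1.
Qed.

Lemma joukowski_rest e k (rho U : L) : (k < e)%N -> U != 0 ->
  (z ^+ 2 - 1)^-1 * (D ^+ e * rho / (D ^+ k * U))
  = (z ^+ 2 - 1) * z^-1 ^+ 2 * D ^+ (e - k.+1) * rho * U^-1.
Proof.
move=> lt_ke U0; have D0 : D ^+ k != 0 by rewrite expf_neq0 // discr_joukowski_neq0.
rewrite -{1}(subnK lt_ke) exprD.
have -> : D ^+ k.+1 = (z ^+ 2 - 1) ^+ 2 / z ^+ 2 * D ^+ k by rewrite exprS /D discr_joukowski.
move: (D ^+ k) D0 (D ^+ _) => x x0 y.
by field; rewrite ?x0 ?U0 ?z0 ?z1.
Qed.

Lemma joukowski_exp i n : (i <= n)%N ->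
  (z + z^-1) ^+ i * z ^+ n = (z ^+ 2 + 1) ^+ i * z ^+ (n - i).
Proof.
move=> le; rewrite -{1}(subnK le) exprD mulrCA -exprMn [RHS]mulrC; congr (_ * _ ^+ _).
by rewrite mulrDl mulVf // -expr2.
Qed.

End JoukowskiIdentities.

Lemma kernel0_identity (L : fieldType) (T x S qt qx : L) :
  T - x != 0 -> qt != 0 -> (T - x) * S = qt - qx ->
  (T - x)^-1 = S / qt + qx * (qt^-1 * (T - x)^-1).
Proof.
move=> Tx0 q0 E; have -> : S = (qt - qx) / (T - x) by rewrite -E mulrC mulKf.
by field; rewrite ?Tx0 ?q0.
Qed.

(** The operator [s + (s^2 - 4) d/ds] maps [U_b] to [b C_b] by [chebC_deriv] and [1 / (t - s)] to
    [(t s - 4) / (t - s)^2]. Applied to the truncated expansion of [1 / (t - s)], it gives this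
    identity; the term with [e] comes from differentiating [discr ^ e]. *)
Lemma kernel1_identity (L : fieldType) (T x q : L) (a : nat -> L) d e :
  (T%:P - 'X) * (\sum_(b < d) (a b)%:P * chebU 'X b.+1) = q%:P - discr 'X ^+ e ->
  (T - x) ^+ 2 * (\sum_(b < d) a b * (b.+1%:R * chebC x b.+1))
  = q * (T * x - 4) - discr x ^+ e * (T * x - 4 + 2 * e%:R * x * (T - x)).
Proof.
set P := \sum_(b < d) _ => E1.
pose P1 : {poly L} := \sum_(b < d) (a b)%:P * (b.+1%:R * chebC 'X b.+1).
have P1E : P1 = 'X * P + discr 'X * P^`().
  rewrite /P raddf_sum !mulr_sumr -big_split; apply: eq_bigr => b _ /=.
  by rewrite chebC_deriv derivM derivC mul0r add0r; ring.
pose D1 : {poly L} := (discr 'X ^+ e)^`().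
have D1E : discr 'X * D1 = 2 * e%:R * 'X * discr 'X ^+ e.
  rewrite /D1 deriv_exp discrE derivB derivXn derivC subr0 -discrE.
  case: (e) => [|n]; first by rewrite mulr0n !mulr0 !mul0r.
  by rewrite -mulr_natr exprS /=; ring.
have E2 : - P + (T%:P - 'X) * P^`() = - D1.
  have := congr1 (fun p : {poly L} => p^`()) E1.
  rewrite derivM !derivB !derivC derivX !sub0r => <-; ring.
have E3 : (T%:P - 'X) ^+ 2 * P1
  = q%:P * (T%:P * 'X - 4) - discr 'X ^+ e * (T%:P * 'X - 4 + 2 * e%:R * 'X * (T%:P - 'X)).
  transitivity ('X * (T%:P - 'X) * ((T%:P - 'X) * P)
    + discr 'X * (T%:P - 'X) * (P + (- P + (T%:P - 'X) * P^`()))).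
    by rewrite P1E; ring.
  rewrite E2 E1.
  transitivity ('X * (T%:P - 'X) * (q%:P - discr 'X ^+ e)
    + discr 'X * ((T%:P - 'X) * P) - (discr 'X * D1) * (T%:P - 'X)); first by ring.
  by rewrite E1 D1E; set Q := _ ^+ e; rewrite /discr; ring.
have := congr1 (pev idfun x) E3.
rewrite !(pev_discr, rmorphM, rmorphB, rmorphD, rmorphXn, rmorph_nat) /=.
rewrite !pevX !pevC /= => <-.
congr (_ * _); rewrite /P1 rmorph_sum; apply: eq_bigr => b _ /=.
by rewrite !rmorphM /= pevC rmorph_nat pev_chebC.
Qed.

Lemma kernel1_quot (L : fieldType) (T x S qt qx A : L) :
  T - x != 0 -> qt != 0 -> (T - x) ^+ 2 * S = qt * (T * x - 4) - qx * A ->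
  (T * x - 4) / (T - x) ^+ 2 = S / qt + qx * (qt^-1 * (A * (T - x)^-1 ^+ 2)).
Proof.
move=> Tx0 q0 E.
have -> : T * x - 4 = ((T - x) ^+ 2 * S + qx * A) / qt.
  by rewrite E subrK mulrAC mulfV ?mul1r.
by field; rewrite ?Tx0 ?q0.
Qed.

Lemma pev_comp (F B C : comNzRingType) (h : {rmorphism F -> B}) (f : {rmorphism B -> C})
    (x : B) (p : {poly F}) : pev (f \o h) (f x) p = f (pev h x p).
Proof. by rewrite /pev map_poly_comp horner_map. Qed.

Section ResidueKernel.
Variable K : fieldType.
Hypothesis two_neq0 : (2 : K) != 0.
Local Notation Kz := {fraction {poly K}}.
Local Notation cst := (@ratfun_const K).
Local Notation z := (ratfun_var K).
Local Notation s := (ratfun_var K + (ratfun_var K)^-1).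
Local Notation sv := (pev cst s).
Implicit Types (u w : {fraction {poly K}}) (p q : {poly K}).

Definition regular2 u :=
  (exists v, regular_value 1 u v) /\ (exists v, regular_value (-1) u v).

Lemma regular2D u w : regular2 u -> regular2 w -> regular2 (u + w).
Proof.
move=> [[a ua] [b ub]] [[c wc] [d wd]].
by split; [exists (a + c) | exists (b + d)]; apply: regularD.
Qed.

Lemma regular2M u w : regular2 u -> regular2 w -> regular2 (u * w).
Proof.
move=> [[a ua] [b ub]] [[c wc] [d wd]].
by split; [exists (a * c) | exists (b * d)]; apply: regularM.
Qed.

Lemma regular2N u : regular2 u -> regular2 (- u).
Proof.
by move=> [[a ua] [b ub]]; split; [exists (- a) | exists (- b)]; apply: regularN.
Qed.

Lemma regular2X u n : regular2 u -> regular2 (u ^+ n).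
Proof.
move=> [[a ua] [b ub]].
by split; [exists (a ^+ n) | exists (b ^+ n)]; apply: regularX.
Qed.

Lemma regular2_const c : regular2 (cst c).
Proof. by split; exists c; apply: regular_const. Qed.

Lemma regular2_var : regular2 z.
Proof. by split; [exists 1 | exists (-1)]; apply: regular_var. Qed.

Lemma one_neq0 : (1 : K) != 0. Proof. exact: oner_neq0. Qed.

Lemma mone_neq0 : (-1 : K) != 0. Proof. by rewrite oppr_eq0 oner_neq0. Qed.

Lemma regular2_varV : regular2 z^-1.
Proof.
split; [exists 1^-1|exists (-1)^-1]; apply: regularV (regular_var _);
  [exact: one_neq0|exact: mone_neq0].
Qed.

Lemma regular_s : regular_value 1 s 2 /\ regular_value (-1) s (- 2).
Proof.
have -> : - 2 = -1 + (-1)^-1 :> K by rewrite invrN invr1 -opprD.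
have -> : 2 = 1 + 1^-1 :> K by rewrite invr1.
by split; apply: regularD (regular_var _) _; apply: regularV (regular_var _);
  [exact: one_neq0|exact: mone_neq0].
Qed.

Lemma regular_sv p : regular_value 1 (sv p) p.[2] /\ regular_value (-1) (sv p) p.[-2].
Proof.
have [s1 s2] := regular_s.
have := regular_horner idfun p s1; have := regular_horner idfun p s2.
by rewrite !(@map_poly_id _ idfun) // => r2 r1; split.
Qed.

Lemma regular2_sv p : regular2 (sv p).
Proof. by have [h1 h2] := regular_sv p; split; [exists p.[2]|exists p.[-2]]. Qed.

Lemma regular2_svV p : p.[2] != 0 -> p.[-2] != 0 -> regular2 (sv p)^-1.
Proof.
have [h1 h2] := regular_sv p => p1 p2.
by split; [exists p.[2]^-1|exists p.[-2]^-1]; apply: regularV.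
Qed.

Lemma regular2_residue u : regular2 u -> is_residue2 u 0.
Proof. by move=> [[a ua] [b ub]]; apply: is_residue2_reg ua ub. Qed.

Lemma z_neq0 : z != 0. Proof. by rewrite tofrac_eq0 polyX_eq0. Qed.

Lemma zz1_neq0 : z ^+ 2 - 1 != 0.
Proof.
rewrite /ratfun_var -tofracXn -tofrac1 -tofracB tofrac_eq0 -polyC1.
by rewrite -size_poly_eq0 size_XnsubC.
Qed.

(* [(z^2 - 1)^-1 dz] is [ds / (s^2 - 4)], and [s] is two-to-one near [1, -1]. *)
Lemma residue2_poly k p : (size p <= k.+1.*2)%N ->
  is_residue2 ((z ^+ 2 - 1)^-1 * (sv p / discr s ^+ k)) (2 * p`_(k.*2.+1)).
Proof.
move=> szp; set M := k.*2.+1.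
(* [R] is [z^M p(z + 1/z)], a polynomial in [z] since [p] has degree at most [M]. *)
pose R : {poly K} := \sum_(i < M.+1) p`_i *: (('X^2 + 1) ^+ i * 'X^(M - i)).
have m2 : ('X^2 + 1 : {poly K}) \is monic by rewrite -(opprK 1) -polyCN monicXnsubC.
have s2 : size ('X^2 + 1 : {poly K}) = 3 by rewrite -(opprK 1) -polyCN size_XnsubC.
have szi i : size (('X^2 + 1 : {poly K}) ^+ i) = i.*2.+1.
  rewrite polySpred ?monic_neq0 ?monic_exp // size_exp s2 /= mulnC.
  by rewrite muln2.
have szR i : (i <= M)%N -> size (('X^2 + 1 : {poly K}) ^+ i * 'X^(M - i)) = (M + i).+1.
  move=> leiM; rewrite size_mulXn ?monic_neq0 ?monic_exp // szi addnS -addnn.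
  by rewrite addnA subnK.
have m0 : ('X^2 + 1 : {poly K}).[0] = 1.
  by rewrite -polyC1 hornerD hornerXn hornerC expr0n add0r.
have R0 : R`_0 = p`_M.
  rewrite -horner_coef0 /R horner_sum big_ord_recr /= big1 => [|i _].
    by rewrite add0r subnn mulr1 hornerZ horner_exp m0 expr1n mulr1.
  by rewrite hornerZ hornerM hornerXn expr0n subn_eq0 leqNgt ltn_ord /= !mulr0.
have RM : R`_(M.*2) = p`_M.
  rewrite /R coef_sum big_ord_recr /= big1 => [|i _].
    rewrite add0r subnn mulr1 coefZ.
    have := monic_exp M m2; rewrite monicE lead_coefE szi /= => /eqP->.
    by rewrite mulr1.
  rewrite coefZ [X in _ * X]nth_default ?mulr0 // szR; last by rewrite ltnW.
  by rewrite -addnn ltn_add2l.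
have szRM : (size R <= M.*2.+1)%N.
  apply: (leq_trans (size_sum _ _ _)); apply/bigmax_leqP => i _.
  have leiM : (i <= M)%N by rewrite -ltnS.
  by rewrite (leq_trans (size_scale_leq _ _)) // szR // ltnS -addnn leq_add2l.
have M1 : 'X^2 - 1 \is @monic K by rewrite -polyC1 monicXnsubC.
have sM : size ('X^2 - 1 : {poly K}) = 3 by rewrite -polyC1 size_XnsubC.
have sME : size (('X^2 - 1 : {poly K}) ^+ M) = M.*2.+1.
  rewrite polySpred ?monic_neq0 ?monic_exp // size_exp sM /= mulnC.
  by rewrite muln2.
(* The fraction [R / (z (z^2 - 1)^M)] also has a simple pole at [0]. As [M] is odd, adding this
   multiple of [(z^2 - 1)^M] cancels the constant term of [R]; it also doubles the top coefficient,
   whence the factor [2]. *)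
have [W defW] : exists W, R + p`_M *: ('X^2 - 1) ^+ M = W * 'X.
  suff /factor_theorem[W ->] : root (R + p`_M *: ('X^2 - 1) ^+ M) 0.
    by exists W; rewrite polyC0 subr0.
  rewrite rootE hornerD hornerZ.
  have -> : (('X^2 - 1 : {poly K}) ^+ M).[0] = (-1) ^+ M.
    by rewrite horner_exp -polyC1 hornerD hornerN hornerXn hornerC expr0n sub0r.
  rewrite horner_coef0 R0.
  by rewrite -signr_odd /M /= odd_double /= expr1 mulrN1 subrr.
have szW : (size W <= M.*2)%N.
  have [->|W0] := eqVneq W 0; first by rewrite size_poly0.
  rewrite -ltnS -(size_mulX W0) -defW (leq_trans (size_polyD _ _)) // geq_max szRM.
  by rewrite (leq_trans (size_scale_leq _ _)) // sME.
have WM : W`_(M.*2.-1) = 2 * p`_M.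
  have := congr1 (fun p : {poly K} => p`_(M.*2)) defW.
  rewrite coefD coefZ RM coefMX.
  have := monic_exp M M1; rewrite monicE lead_coefE sME /= => /eqP->.
  by rewrite /M ?doubleS /= => <-; ring.
have E : (z ^+ 2 - 1)^-1 * (sv p / discr s ^+ k)
    = tofrac W / (z ^+ 2 - 1) ^+ M + cst (- p`_M) * z^-1.
  rewrite rmorphN; apply: (joukowski_split z_neq0 zz1_neq0).
  have pevz q : tofrac q = pev cst z q.
    elim/poly_ind: q => [|q c IH]; first by rewrite !rmorph0.
    by rewrite !(rmorphD, rmorphM) /= IH pevX pevC.
  have := congr1 (pev cst z) defW.
  rewrite rmorphD rmorphM /= pevX pevZ rmorphXn rmorphB rmorphXn rmorph1 /= pevX pevz => <-.
  congr (_ + _); rewrite /R rmorph_sum.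
  have -> : sv p = \sum_(i < M.+1) cst p`_i * s ^+ i.
    rewrite /pev (@horner_coef_wide _ M.+1) ?size_map_poly //.
    by apply: eq_bigr => i _; rewrite coef_map.
  rewrite mulr_suml; apply: eq_bigr => i _ /=; rewrite pevZ -mulrA; congr (_ * _).
  rewrite rmorphM !rmorphXn rmorphD rmorphXn rmorph1 /= !pevX.
  have leiM : (i <= M)%N by rewrite -ltnS.
  exact: (joukowski_exp z_neq0 leiM).
rewrite E -/M -WM -[W`__]addr0; apply: is_residue2D; first exact: is_residue2_quot.
apply: regular2_residue; apply: regular2M; [exact: regular2_const|exact: regular2_varV].
Qed.

Lemma regular_neq0 (a : K) u v : v != 0 -> regular_value a u v -> u != 0.
Proof.
move=> v0 [p [q [q0 -> E]]].
apply: mulf_neq0; last by rewrite invr_eq0; exact: (horner_neq0 q0).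
apply: (@horner_neq0 _ _ a); move: v0; rewrite E.
by apply: contraNneq => ->; rewrite mul0r.
Qed.

Lemma sv_neq0 p : p.[2] != 0 -> sv p != 0.
Proof. by move=> p2; have [h1 _] := regular_sv p; apply: regular_neq0 h1. Qed.

Lemma regular2_zz1 : regular2 ((z ^+ 2 - 1) * z^-1 ^+ 2).
Proof.
apply: regular2M; last by apply: regular2X; apply: regular2_varV.
rewrite -[1](rmorph1 cst) -rmorphN /=; apply: regular2D (regular2_const _).
exact: regular2X regular2_var.
Qed.

(** Modulo [discr ^ k.+1], dividing by [q] is multiplying by [sigma]. The leftover multiple of
    [discr ^ k.+1] is regular because [(z^2 - 1)^-1 * discr s = (z^2 - 1) / z^2]; this is also why
    the level is [k.+1]. *)
Lemma residue2_frac k p q sigma : q.[2] != 0 -> q.[-2] != 0 ->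
  discr 'X ^+ k.+1 %| q * sigma - 1 ->
  is_residue2 ((z ^+ 2 - 1)^-1 * (sv p / (discr s ^+ k * sv q)))
    (2 * res k.+1 (p * sigma)).
Proof.
move=> q1 q2 dv.
set r := (p * sigma) %% discr 'X ^+ k.+1.
have [v defv] : exists v, p = q * r + v * discr 'X ^+ k.+1.
  have [v1 E1] := dvdpP _ _ dv.
  exists (q * ((p * sigma) %/ discr 'X ^+ k.+1) - p * v1).
  have E2 := divp_eq (p * sigma) (discr 'X ^+ k.+1); rewrite -/r in E2.
  have -> : r = p * sigma - (p * sigma) %/ discr 'X ^+ k.+1 * discr 'X ^+ k.+1.
    by rewrite {1}E2 addrC addKr.
  transitivity (p + p * (q * sigma - 1 - v1 * discr 'X ^+ k.+1)); last by ring.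
  by rewrite E1 subrr mulr0 addr0.
have szr : (size r <= k.+1.*2)%N.
  by rewrite -ltnS -(size_discrX K k.+1) ltn_modpN0 // monic_neq0 ?discrX_monic.
have -> : 2 * res k.+1 (p * sigma) = 2 * r`_(k.*2.+1) + 0 by rewrite addr0.
have q0 := sv_neq0 q1.
have d0 : discr s != 0.
  exact: (discr_joukowski_neq0 z_neq0 zz1_neq0).
have -> : (z ^+ 2 - 1)^-1 * (sv p / (discr s ^+ k * sv q)) =
  (z ^+ 2 - 1)^-1 * (sv r / discr s ^+ k)
  + (z ^+ 2 - 1) * z^-1 ^+ 2 * sv v / sv q.
  apply: (joukowski_frac z_neq0 zz1_neq0 q0).
  by rewrite {1}defv rmorphD !rmorphM rmorphXn /= pev_discr.
apply: is_residue2D; first exact: residue2_poly.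
apply: regular2_residue; apply: regular2M; last exact: regular2_svV.
apply: regular2M; last exact: regular2_sv.
exact: regular2_zz1.
Qed.

(* [u] may be replaced by the polynomial [p] in [s] in front of a pole of order
   at most [e] in [s]. *)
Definition approx e u p := exists rho, regular2 rho /\ u = sv p + discr s ^+ e * rho.

Lemma approx_sv e p : approx e (sv p) p.
Proof. by exists 0; rewrite mulr0 addr0 -[0](rmorph0 cst); split=> //; apply: regular2_const. Qed.

Lemma discr_s : discr s = sv (discr 'X). Proof. by rewrite pev_discr. Qed.

Lemma approxM e u w p q : approx e u p -> approx e w q -> approx e (u * w) (p * q).
Proof.
move=> [a [ra ->]] [b [rb ->]].
exists (sv p * b + a * sv q + a * (discr s ^+ e * b)); split.
  do ?apply: regular2D; apply: regular2M => //; try exact: regular2_sv.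
  by apply: regular2M => //; apply: regular2X; rewrite discr_s; apply: regular2_sv.
by rewrite rmorphM /=; ring.
Qed.

Lemma approxZ e u p c : approx e u p -> approx e (cst c * u) (c *: p).
Proof.
move=> [a [ra ->]]; exists (cst c * a); split.
  by apply: regular2M => //; apply: regular2_const.
by rewrite pevZ; ring.
Qed.

(** [(z^2 - 1)^-1 * discr s] is regular at both points, so the error term is regular as soon as [e]
    exceeds [k]. *)
Lemma approx_residue e k u p q sigma : (k < e)%N -> q.[2] != 0 -> q.[-2] != 0 ->
  discr 'X ^+ k.+1 %| q * sigma - 1 -> approx e u p ->
  is_residue2 ((z ^+ 2 - 1)^-1 * (u / (discr s ^+ k * sv q)))
    (2 * res k.+1 (p * sigma)).
Proof.
move=> lt_ke q1 q2 dv [rho [rr ->]]; rewrite -[2 * _]addr0 mulrDl mulrDr.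
apply: is_residue2D; first exact: residue2_frac.
apply: regular2_residue.
have -> : (z ^+ 2 - 1)^-1 * (discr s ^+ e * rho / (discr s ^+ k * sv q))
  = (z ^+ 2 - 1) * z^-1 ^+ 2 * discr s ^+ (e - k.+1) * rho * (sv q)^-1.
  exact: (joukowski_rest z_neq0 zz1_neq0 _ lt_ke (sv_neq0 q1)).
apply: regular2M; last exact: regular2_svV.
apply: regular2M => //; apply: regular2M; last first.
  by apply: regular2X; rewrite discr_s; apply: regular2_sv.
exact: regular2_zz1.
Qed.

(** * Polynomial truncations of the kernel and of the [omega^0_2] factors *)

Section Kernels.
Variables (F : fieldType) (h : {rmorphism F -> K}) (e : nat) (z0 : K).
Hypotheses (z0_neq0 : z0 != 0) (z0_gen : z0 ^+ 2 != 1).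
Let t := z0 + z0^-1.
Local Notation psi b := (pev h t (Psi F e b)).

(** The polynomial in [s] congruent to [1 / (t - s)] modulo [discr s ^ e]. Divided by [z0], its
    coefficients on [chebU] are the functions [phi] below. *)
Definition kernel0 : {poly K} := \sum_(b < e.*2) (psi b / discr t ^+ e) *: chebU 'X b.+1.

(** The analogue for [(t s - 4) / (t - s)^2], to which the two [omega^0_2] terms at [z] and [1/z]
    add up in [bergman_pair]. *)
Definition kernel1 : {poly K} :=
  \sum_(b < e.*2) (psi b / discr t ^+ e) *: (b.+1%:R *: chebC 'X b.+1).

Lemma t_neq2 : t - 2 != 0 /\ t + 2 != 0.
Proof.
have -> : t - 2 = (z0 - 1) ^+ 2 / z0 by rewrite /t; field.
have -> : t + 2 = (z0 + 1) ^+ 2 / z0 by rewrite /t; field.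
have : (z0 - 1) * (z0 + 1) != 0 by rewrite -subr_sqr expr1n subr_eq0.
rewrite mulf_eq0 negb_or => /andP[h1 h2].
by rewrite !mulf_neq0 ?invr_eq0 ?expf_neq0.
Qed.

Lemma discr_t_neq0 : discr t != 0.
Proof.
have [h1 h2] := t_neq2.
have -> : discr t = (t - 2) * (t + 2) by rewrite /discr; ring.
exact: mulf_neq0.
Qed.

Lemma t_sub_s_neq0 : cst t - s != 0.
Proof.
have [h1 _] := t_neq2; apply: (@regular_neq0 1 _ _ h1).
by apply: regularB (regular_const _ _) _; have [] := regular_s.
Qed.

Lemma regular2_tsV : regular2 (cst t - s)^-1.
Proof.
have [h1 h2] := t_neq2; have [s1 s2] := regular_s.
split; [exists (t - 2)^-1|exists (t - -2)^-1]; apply: regularV.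
- exact: h1.
- exact: regularB (regular_const _ _) s1.
- by rewrite opprK; exact: h2.
- exact: regularB (regular_const _ _) s2.
Qed.

Lemma discr_cst_neq0 : discr (cst t) ^+ e != 0.
Proof.
apply: expf_neq0; rewrite -rmorph_discr fmorph_eq0; exact: discr_t_neq0.
Qed.

Lemma cst_discrV : cst (discr t ^- e) = (discr (cst t) ^+ e)^-1.
Proof. by rewrite fmorphV rmorphXn /= rmorph_discr. Qed.

Lemma approx_kernel0 : approx e (cst t - s)^-1 kernel0.
Proof.
exists (cst (discr t ^- e) * (cst t - s)^-1); split.
  by apply: regular2M; [exact: regular2_const|exact: regular2_tsV].
have H := @Psi_kernel F _ (pev (cst \o h) (cst t)) (pev (cst \o h) s) e.
have {H} := H _; rewrite !rmorphXn /= !pevX !pev_discr => /(_ _)H.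
have {}H := H (fun a => etrans (pevC _ _ _) (esym (pevC _ _ _))).
rewrite [LHS](kernel0_identity t_sub_s_neq0 discr_cst_neq0 H).
rewrite cst_discrV; congr (_ + _).
rewrite /kernel0 rmorph_sum mulr_suml; apply: eq_bigr => b _ /=.
rewrite pev_comp pevZ !pev_chebU rmorphM /= cst_discrV mulrAC.
by [].
Qed.

Lemma approx_kernel1 : approx e ((cst t * s - 4) / (cst t - s) ^+ 2) kernel1.
Proof.
pose A := cst t * s - 4 + 2 * e%:R * s * (cst t - s).
exists (cst (discr t ^- e) * (A * (cst t - s)^-1 ^+ 2)); split.
  apply: regular2M (regular2_const _) _; apply: regular2M; last first.
    exact: regular2X regular2_tsV.
  have -> : A = sv (t%:P * 'X - 4 + 2 * e%:R * 'X * (t%:P - 'X)).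
    by rewrite rmorphD !(rmorphM, rmorphB, rmorph_nat) /= pevX pevC.
  exact: regular2_sv.
(* Here [s] stays an indeterminate ['X], since [kernel1_identity] differentiates with respect to it
   before specialising. *)
pose f : {rmorphism {poly F} -> {poly Kz}} := polyC \o pev (cst \o h) (cst t).
pose g : {rmorphism {poly F} -> {poly Kz}} := map_poly (cst \o h).
have H := @Psi_kernel F _ f g e.
have {}H := H (fun a => etrans (congr1 polyC (pevC _ _ _)) (esym (map_polyC _ _))).
have gX : g 'X = 'X by exact: map_polyX.
have fX : f 'X = (cst t)%:P by rewrite /f /= pevX.
rewrite !rmorphXn !rmorph_discr fX gX -rmorph_discr /= -rmorphXn /= in H.
have {}H : ((cst t)%:P - 'X) *
    (\sum_(b < e.*2) (cst (pev h t (Psi F e b)))%:P * chebU 'X b.+1)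
    = (discr (cst t) ^+ e)%:P - discr 'X ^+ e.
  have E : \sum_(b < e.*2) (cst (pev h t (Psi F e b)))%:P * chebU 'X b.+1
      = \sum_(b < e.*2) f (Psi F e b) * g (chebU 'X b.+1).
    by apply: eq_bigr => b _; rewrite rmorph_chebU gX /f /= pev_comp.
  by rewrite E; exact: H.
have H2 := @kernel1_identity _ _ s _ (fun b => cst (pev h t (Psi F e b))) _ _ H.
rewrite [LHS](kernel1_quot t_sub_s_neq0 discr_cst_neq0 H2).
rewrite cst_discrV; congr (_ + _).
rewrite /kernel1 rmorph_sum mulr_suml; apply: eq_bigr => b _ /=.
rewrite !pevZ pev_chebC rmorphM rmorph_nat /= cst_discrV.
by rewrite mulrAC.
Qed.
End Kernels.
End ResidueKernel.

(** * The recursion on expansion coefficients *)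

(* The subsets of [S] in the recursion are encoded as bit masks. *)
Fixpoint masks n : seq bitseq :=
  if n is n'.+1 then
    [seq true :: mk | mk <- masks n'] ++ [seq false :: mk | mk <- masks n']
  else [:: [::]].

Lemma mem_masks n mk : (mk \in masks n) = (size mk == n).
Proof.
elim: n mk => [|n IH] [|b mk] //=; rewrite mem_cat.
  apply/negbTE; rewrite negb_or.
  by apply/andP; split; apply/mapP => -[].
have inj c : injective (cons c : bitseq -> bitseq) by move=> x y [].
have nin c d : c != d -> (c :: mk \in [seq d :: mk' | mk' <- masks n]) = false.
  by move=> ncd; apply/mapP => -[x _ [E _]]; rewrite E eqxx in ncd.
by case: b; rewrite (mem_map (inj _)) nin // ?orbF IH eqSS.
Qed.

Lemma uniq_masks n : uniq (masks n).
Proof.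
elim: n => //= n IH; rewrite cat_uniq !map_inj_uniq ?IH ?andbT /=; try by move=> x y [].
by apply/hasP => -[x /mapP[y _ ->]] /mapP[].
Qed.

Definition set_mask n (I : {set 'I_n}) : bitseq := [seq i \in I | i <- enum 'I_n].

Lemma size_set_mask n (I : {set 'I_n}) : size (set_mask I) = n.
Proof. by rewrite size_map size_enum_ord. Qed.

Lemma set_maskC n (I : {set 'I_n}) : set_mask (~: I) = map negb (set_mask I).
Proof. by rewrite /set_mask -map_comp; apply: eq_map => i /=; rewrite inE. Qed.

Lemma set_mask_pts (T : Type) (x0 : T) (s : seq T) (I : {set 'I_(size s)}) :
  [seq nth x0 s (val i) | i <- enum I] = mask (set_mask I) s.
Proof.
have -> : enum I = mask (set_mask I) (enum 'I_(size s)).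
  by rewrite /set_mask -filter_mask enumT; apply: eq_filter.
rewrite map_mask; congr (mask _ _).
rewrite -[RHS](mkseq_nth x0) /mkseq -val_enum_ord -map_comp.
by apply: eq_map.
Qed.

Lemma card_set_mask n (I : {set 'I_n}) : #|I| = count id (set_mask I).
Proof.
by rewrite /set_mask count_map -sum1_count cardE -sum1_size big_enum big_enum_cond.
Qed.

Lemma set_mask_inj n : injective (@set_mask n).
Proof.
move=> I J /eq_in_map E; apply/setP => i.
by apply: E; rewrite mem_enum.
Qed.

Lemma sum_set_masks (V : nmodType) n (f : bitseq -> V) :
  \sum_(I : {set 'I_n}) f (set_mask I) = \sum_(mk <- masks n) f mk.
Proof.
rewrite -(big_map (@set_mask n) xpredT f); apply: perm_big.
apply: uniq_perm; rewrite ?uniq_masks ?(map_inj_uniq (@set_mask_inj n)) ?index_enum_uniq //.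
move=> mk; rewrite mem_masks; apply/mapP/eqP => [[I _ ->]|szmk].
  exact: size_set_mask.
exists [set i | nth false mk (val i)]; first exact: mem_index_enum.
rewrite /set_mask -[LHS](mkseq_nth false) szmk /mkseq -val_enum_ord -map_comp.
by apply: eq_map => i; rewrite /= inE.
Qed.

Lemma sum_masksN (V : nmodType) n (f : bitseq -> V) :
  \sum_(mk <- masks n) f (map negb mk) = \sum_(mk <- masks n) f mk.
Proof.
rewrite -(big_map (map negb) xpredT f); apply: perm_big.
have inj : injective (map negb) by apply/inj_map/inv_inj/negbK.
apply: uniq_perm; rewrite ?(map_inj_uniq inj) ?uniq_masks // => mk.
rewrite mem_masks; apply/mapP/eqP => [[m' + ->]|szmk].
  by rewrite mem_masks size_map => /eqP.
exists (map negb mk); first by rewrite mem_masks size_map szmk.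
by rewrite -map_comp map_id_in // => b _ /=; rewrite negbK.
Qed.

(* Every argument [z] comes with its own truncation level [e]. *)
Fixpoint ilists (T : Type) (lz : seq (nat * T)) : seq (seq nat) :=
  if lz is x :: lz' then [seq b :: bs | b <- iota 1 x.1.*2, bs <- ilists lz']
  else [:: [::]].

Lemma ilists_map (T U : Type) (f : T -> U) (lz : seq (nat * T)) :
  ilists [seq (x.1, f x.2) | x <- lz] = ilists lz.
Proof. by elim: lz => //= x lz ->. Qed.

Lemma mem_ilists (T : Type) (lz : seq (nat * T)) bs : bs \in ilists lz ->
  size bs = size lz /\ all (leq 1) bs.
Proof.
elim: lz bs => [|x lz IH] bs /=; first by rewrite inE => /eqP->.
move=> /allpairsP[[b bs'] /= [+ /IH[<- h] ->]] /=.
by rewrite mem_iota add1n h andbT => /andP[].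
Qed.

Lemma sum_iota1 (V : nmodType) n (f : nat -> V) :
  \sum_(b <- iota 1 n) f b = \sum_(b < n) f b.+1.
Proof.
have -> : iota 1 n = index_iota 1 n.+1 by rewrite /index_iota subn1.
by rewrite big_add1 big_mkord.
Qed.

Lemma sum_ilists_cons (T : Type) (V : nmodType) (x : nat * T) lz (f : seq nat -> V) :
  \sum_(bs <- ilists (x :: lz)) f bs
  = \sum_(b <- iota 1 x.1.*2) \sum_(bs <- ilists lz) f (b :: bs).
Proof. by rewrite /= big_allpairs_dep. Qed.

Section Weights.
Variables (F K : fieldType) (h : {rmorphism F -> K}).
Implicit Types (lz : seq (nat * K)).

(* [phi e x b = x ^ (b - 1) + O(x ^ (2 e))] at [0], and its only poles are at
   [1] and [-1]: the coefficients [c] of [ev c] are those of its expansion. *)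
Definition phi e (x : K) b := pev h (x + x^-1) (Psi F e b.-1) / discr (x + x^-1) ^+ e / x.

Fixpoint wt lz (bs : seq nat) : K :=
  match lz, bs with
  | x :: lz', b :: bs' => phi x.1 x.2 b * wt lz' bs'
  | _, _ => 1
  end.

Definition ev (c : seq nat -> F) lz : K := \sum_(bs <- ilists lz) wt lz bs * h (c bs).

(** Version of [ev] in which the recursion variable stays a formal [s] while the other arguments are
    evaluated. *)
Definition evP (c : seq nat -> {poly F}) lz : {poly K} :=
  \sum_(bs <- ilists lz) wt lz bs *: map_poly h (c bs).

Lemma wt_mask (V : lmodType K) mk lz (f : seq nat -> seq nat -> V) :
  size mk = size lz ->
  \sum_(bs1 <- ilists (mask mk lz)) \sum_(bs2 <- ilists (mask (map negb mk) lz))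
      (wt (mask mk lz) bs1 * wt (mask (map negb mk) lz) bs2) *: f bs1 bs2
  = \sum_(bs <- ilists lz) wt lz bs *: f (mask mk bs) (mask (map negb mk) bs).
Proof.
elim: lz mk f => [|z lz IH] [|b mk] f // => [_|[szmk]].
  by rewrite /= !big_seq1 mul1r.
rewrite sum_ilists_cons.
transitivity (\sum_(b0 <- iota 1 z.1.*2) phi z.1 z.2 b0 *:
  \sum_(bs <- ilists lz) wt lz bs *:
   (if b then f (b0 :: mask mk bs) (mask (map negb mk) bs)
    else f (mask mk bs) (b0 :: mask (map negb mk) bs))); last first.
  apply: eq_bigr => b0 _; rewrite scaler_sumr; apply: eq_bigr => bs _.
  by rewrite scalerA; case: b.
case: b.
  rewrite [mask _ _]/= [mask (map negb _) _]/= sum_ilists_cons; apply: eq_bigr => b0 _.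
  rewrite -(IH mk (fun x y => f (b0 :: x) y)) // scaler_sumr; apply: eq_bigr => bs1 _.
  by rewrite scaler_sumr; apply: eq_bigr => bs2 _; rewrite scalerA mulrA.
rewrite [mask _ _]/= [mask (map negb _) _]/=.
under eq_bigr do rewrite sum_ilists_cons.
rewrite exchange_big /=; apply: eq_bigr => b0 _.
rewrite -(IH mk (fun x y => f x (b0 :: y))) // scaler_sumr; apply: eq_bigr => bs1 _.
by rewrite scaler_sumr; apply: eq_bigr => bs2 _; rewrite scalerA mulrCA.
Qed.

Lemma eq_ev c c' lz :
  (forall bs, size bs = size lz -> all (leq 1) bs -> c bs = c' bs) ->
  ev c lz = ev c' lz.
Proof. by move=> E; apply: eq_big_seq => bs /mem_ilists[sz pos]; rewrite E. Qed.

Lemma eq_evP c c' lz :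
  (forall bs, size bs = size lz -> all (leq 1) bs -> c bs = c' bs) ->
  evP c lz = evP c' lz.
Proof. by move=> E; apply: eq_big_seq => bs /mem_ilists[sz pos]; rewrite E. Qed.

Lemma evPD c c' lz : evP (fun bs => c bs + c' bs) lz = evP c lz + evP c' lz.
Proof.
by rewrite -big_split; apply: eq_bigr => bs _; rewrite rmorphD scalerDr.
Qed.

Lemma evP_sum (I : Type) (r : seq I) (P : pred I) (c : I -> seq nat -> {poly F}) lz :
  evP (fun bs => \sum_(i <- r | P i) c i bs) lz = \sum_(i <- r | P i) evP (c i) lz.
Proof.
rewrite /evP exchange_big; apply: eq_bigr => bs _.
by rewrite rmorph_sum scaler_sumr.
Qed.

Lemma evP_mask c c' mk lz : size mk = size lz ->
  evP c (mask mk lz) * evP c' (mask (map negb mk) lz)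
  = evP (fun bs => c (mask mk bs) * c' (mask (map negb mk) bs)) lz.
Proof.
move=> szmk; rewrite /evP mulr_suml.
under [RHS]eq_bigr do rewrite rmorphM.
rewrite -(wt_mask (fun x y => map_poly h (c x) * map_poly h (c' y))) //.
apply: eq_bigr => bs1 _; rewrite mulr_sumr; apply: eq_bigr => bs2 _.
by rewrite -scalerAl -scalerAr scalerA.
Qed.

End Weights.

Section WeightMorph.
Variables (F K L : fieldType) (h : {rmorphism F -> K}) (f : {rmorphism K -> L}).

Lemma phi_morph e x b : phi (f \o h) e (f x) b = f (phi h e x b).
Proof.
rewrite /phi !(rmorphM, rmorphD) !fmorphV rmorphXn /= rmorph_discr rmorphD fmorphV.
by rewrite -pev_comp rmorphD fmorphV.
Qed.

Lemma wt_morph lz bs : wt (f \o h) [seq (x.1, f x.2) | x <- lz] bs = f (wt h lz bs).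
Proof.
elim: lz bs => [|z zs IH] [|b bs] /=; rewrite ?rmorph1 //.
by rewrite rmorphM IH /= phi_morph.
Qed.
End WeightMorph.

(** * The kernel and the [omega^0_2] factors as functions of [s] *)

Definition generic_point (K : fieldType) (x : K) := (x != 0) && (x ^+ 2 != 1).

Lemma generic_inv (K : fieldType) (x : K) : generic_point x -> generic_point x^-1.
Proof.
by move=> /andP[x0 x1]; rewrite /generic_point invr_eq0 x0 exprVn invr_eq1.
Qed.

Lemma generic_morph (K L : fieldType) (f : {rmorphism K -> L}) x :
  generic_point x -> generic_point (f x).
Proof.
move=> /andP[x0 x1]; rewrite /generic_point fmorph_eq0 x0 -rmorphXn /=.
by rewrite -(rmorph1 f) (inj_eq (fmorph_inj _)).
Qed.

(** From [t - s = (z0 - z)(z0 - 1/z) / z0], the difference of the two simple poles in [z0] becomes a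
    multiple of [1 / (t - s)], and [y(z) - y(1/z) = (z - 1/z) U_m / m]. *)
Lemma kernel_joukowski (L : fieldType) m (z0 z X : L) :
  z0 != 0 -> z != 0 -> z ^+ 2 - 1 != 0 -> z0 + z0^-1 - (z + z^-1) != 0 ->
  chebU (z + z^-1) m != 0 -> m%:R != 0 :> L -> 2 != 0 :> L ->
  recursion_kernel m z0 z * (X * - z ^- 2)
  = m%:R / (2 * z0) * ((z ^+ 2 - 1)^-1 *
      ((z0 + z0^-1 - (z + z^-1))^-1 * X / chebU (z + z^-1) m)).
Proof.
move=> z00 zn0 z1 T0 U0 m0 two0; rewrite /recursion_kernel /curve_y /curve_dx.
have E : z ^+ m / m%:R - z^-1 ^+ m / m%:R = (z - z^-1) * chebU (z + z^-1) m / m%:R.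
  by rewrite chebU_joukowski // exprVn mulrBl.
rewrite E; move: (chebU _ m) U0 (m%:R) m0 => U U0 M M0.
have T1 : z0 + z0^-1 - (z + z^-1) = (z0 - z) * (z0 - z^-1) / z0 by field; rewrite z00 zn0.
have [a0 b0] : z0 - z != 0 /\ z0 - z^-1 != 0.
  by move: T0; rewrite T1 mulf_eq0 invr_eq0 (negPf z00) orbF mulf_eq0 negb_or => /andP.
have b1 : z0 * z - 1 != 0.
  have -> : z0 * z - 1 = (z0 - z^-1) * z by rewrite mulrBl mulVf.
  exact: mulf_neq0.
rewrite T1; field.
by rewrite U0 z00 zn0 b1 a0 z1 two0 M0.
Qed.

(** A stable factor at [Z = z] or [Z = 1/z] has the form [G(s) / Z] with the same [G], so the terms
    with [omega^0_2] in first and in second position combine into a function of [s]. *)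
Lemma bergman_pair (L : fieldType) (z w t G : L) :
  z != 0 -> w != 0 -> t - (z + z^-1) != 0 -> t = w + w^-1 ->
  bergman z w * (G / z^-1) + (G / z) * bergman z^-1 w
  = (t * (z + z^-1) - 4) / (t - (z + z^-1)) ^+ 2 / w * G.
Proof.
move=> z0 w0 T0 tE; subst t; rewrite /bergman.
have T1 : w + w^-1 - (z + z^-1) = (w - z) * (w * z - 1) / (w * z) by field; rewrite z0 w0.
have [a0 b0] : w - z != 0 /\ w * z - 1 != 0.
  move: T0; rewrite T1 mulf_eq0 invr_eq0 negb_or mulf_eq0 negb_or => /andP[/andP[]//].
have a1 : z - w != 0 by rewrite -opprB oppr_eq0.
have b1 : 1 - w * z != 0 by rewrite -opprB oppr_eq0.
by rewrite T1; field; rewrite w0 z0 b0 a0 oner_neq0 a1 mulNr b1.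
Qed.

(* The last term has a double zero at [z = 1, -1] and does not contribute. *)
Lemma bergman_pair2 (L : fieldType) (z w1 w2 : L) :
  2 != 0 :> L -> z != 0 -> w1 != 0 -> w2 != 0 ->
  w1 + w1^-1 - (z + z^-1) != 0 -> w2 + w2^-1 - (z + z^-1) != 0 ->
  bergman z w1 * bergman z^-1 w2 + bergman z w2 * bergman z^-1 w1
  = (((w1 + w1^-1) * (z + z^-1) - 4) / (w1 + w1^-1 - (z + z^-1)) ^+ 2 / w1)
    * (((w2 + w2^-1) * (z + z^-1) - 4) / (w2 + w2^-1 - (z + z^-1)) ^+ 2 / w2) / 2
    - (z ^+ 2 - 1) * ((z ^+ 2 - 1) * z^-1 ^+ 2)
      * ((1 - w1 ^+ 2) / w1 ^+ 2 * ((1 - w2 ^+ 2) / w2 ^+ 2) / 2)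
      * ((w1 + w1^-1 - (z + z^-1))^-1 ^+ 2 * (w2 + w2^-1 - (z + z^-1))^-1 ^+ 2).
Proof.
move=> two0 z0 w10 w20; rewrite /bergman.
have T w : w != 0 -> w + w^-1 - (z + z^-1) = (w - z) * (w * z - 1) / (w * z).
  by move=> w0; field; rewrite z0 w0.
have nz w : w != 0 -> w + w^-1 - (z + z^-1) != 0 ->
    [/\ w - z != 0, w * z - 1 != 0, z - w != 0 & 1 + - w * z != 0].
  move=> w0; rewrite T // mulf_eq0 invr_eq0 negb_or mulf_eq0 negb_or.
  move=> /andP[/andP[a0 b0] _]; split=> //.
    by rewrite -opprB oppr_eq0.
  by rewrite mulNr -opprB oppr_eq0.
move=> /(nz _ w10)[a1 b1 c1 d1] /(nz _ w20)[a2 b2 c2 d2].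
rewrite !T //; field.
by rewrite z0 w10 w20 a1 b1 c1 d1 a2 b2 c2 d2 two0 ?oner_neq0.
Qed.

Lemma EO_rec_02 N m (K : fieldType) (a b : K) :
  (0 < N)%N -> EO_rec N m 0 [:: a; b] = bergman a b.
Proof. by case: N. Qed.

Lemma prod_quot (L : fieldType) (A B D z : L) k : z != 0 ->
  A / D ^+ k / z * (B / D ^+ k / z^-1) = A * B / D ^+ k.*2.
Proof.
move=> z0; rewrite -addnn exprD !invfM invrK.
transitivity (A * B * ((D ^+ k)^-1 * (D ^+ k)^-1) * (z * z^-1)); first by ring.
by rewrite mulfV ?mulr1.
Qed.

Lemma half_cancel (L : fieldType) (a w x y : L) : 2 != 0 :> L ->
  a / 2 * w * (2 * x + 2 * y) = a * (w * x + w * y).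
Proof. by move=> two0; field. Qed.

Lemma distribute (L : fieldType) (I : Type) (r : seq I) (P : pred I) (f g : I -> L)
    (a t A D1 D2 U : L) :
  a * (t * (A / D1 + \sum_(i <- r | P i) f i * g i / D2) / U)
  = a * (t * A / (D1 * U)) + \sum_(i <- r | P i) a * (t * (f i * g i) / (D2 * U)).
Proof.
rewrite !invfM mulrDr mulrDl mulrDr !mulrA; congr (_ + _).
by rewrite !mulr_sumr !mulr_suml; apply: eq_bigr => i _; rewrite !mulrA.
Qed.

Lemma discr_diff (L : fieldType) (z : L) : z != 0 ->
  bergman z z^-1 = (discr (z + z^-1))^-1.
Proof.
move=> z0; rewrite /bergman; congr (_^-1).
by rewrite discr_joukowski //; field.
Qed.

Lemma rest_split (L : fieldType) (q t A B C D U : L) : q != 0 ->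
  q^-1 * (t * (A / 2 - q * B * C * D) / U)
  = 2^-1 * (q^-1 * (t * A / U)) + - C * (t * B * D * U^-1).
Proof.
move=> q0; transitivity (2^-1 * (q^-1 * (t * A / U)) - (q^-1 * q) * (C * (t * B * D * U^-1))); first by ring.
by rewrite mulVf // mul1r mulNr.
Qed.

(** * One step of the recursion at generic points *)

Section Recursion.
Variables (F : fieldType) (m : nat) (c : nat -> seq nat -> F).

(** Numerator of an invariant in its first argument: at [Z = z] or [Z = 1/z] the invariant is this
    polynomial in [s] divided by [discr s ^ k * Z]. *)
Definition G1 k g bs : {poly F} := \sum_(b <- iota 1 k.*2) c g (b :: bs) *: Psi F k b.-1.

Definition G2 k g bs : {poly F} :=
  \sum_(b <- iota 1 k.*2) \sum_(b' <- iota 1 k.*2)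
    c g [:: b, b' & bs] *: (Psi F k b.-1 * Psi F k b'.-1).

(** The successors account for the point [z] or [1/z] of each factor. *)
Definition stable2 g1 g2 (mk : bitseq) :=
  (2 < g1.*2 + (count id mk).+1)%N && (2 < g2.*2 + (count negb mk).+1)%N.

Definition stable_part k g bs : {poly F} :=
  (if g is g'.+1 then G2 k g' bs else 0)
  + \sum_(g1 < g.+1) \sum_(mk <- masks (size bs) | stable2 g1 (g - g1) mk)
      G1 k g1 (mask mk bs) * G1 k (g - g1) (mask (map negb mk) bs).

(** Coefficients of the truncated pair of [omega^0_2] terms, see [kernel1_phi]. *)
Definition bergman_coef (bs : seq nat) : {poly F} :=
  if bs is [:: b] then b%:R *: chebC 'X b else 0.

Definition bergman_part k g bs : {poly F} :=
  \sum_(mk <- masks (size bs) | count id mk == 1%N)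
    bergman_coef (mask mk bs) * G1 k g (mask (map negb mk) bs).

(* The recursion in terms of coefficients; [sigma] stands for the inverse of
   [chebU m] modulo a power of [discr]. *)
Definition next k (sigma : {poly F}) g bs : F :=
  if bs is b0 :: bs' then
    m%:R * (res k.*2.+1 (chebU 'X b0 * (stable_part k g bs' * sigma))
            + res k.+1 (chebU 'X b0 * (bergman_part k g bs' * sigma)))
  else 0.

Definition represents Nf g n k := forall (K : fieldType) (h : {rmorphism F -> K})
  (lz : seq (nat * K)), size lz = n ->
  all (fun x => (k <= x.1)%N && generic_point x.2) lz ->
  EO_rec Nf m g (map snd lz) = ev h (c g) lz.

Variables (Nf B k : nat) (sigma : {poly F}).
Hypothesis le_B : (B <= Nf)%N.
Hypothesis rep : forall g n, (2 < g.*2 + n)%N -> (0 < n)%N -> (g.*2 + n <= B)%N ->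
  represents Nf g n k.

Section Step.
Variables (K : fieldType) (h : {rmorphism F -> K}).
Local Notation Kz := {fraction {poly K}}.
Local Notation cst := (@ratfun_const K).
Local Notation z := (ratfun_var K).
Local Notation s := (ratfun_var K + (ratfun_var K)^-1).
Local Notation sv := (pev cst s).
Implicit Types (lz ws : seq (nat * K)).

Lemma generic_var : generic_point z.
Proof.
rewrite /generic_point -(subr_eq0 (z ^+ 2)); apply/andP; split; [exact: z_neq0|exact: zz1_neq0].
Qed.

Lemma generic_varV : generic_point z^-1.
Proof. exact: generic_inv generic_var. Qed.

Lemma pev_cst p : pev (cst \o h) s p = sv (map_poly h p).
Proof. by rewrite /pev map_poly_comp. Qed.

Local Notation lcst ws := [seq (x.1, cst x.2) | x <- ws].

Lemma generic_lcst ws : all (fun x => (k <= x.1)%N && generic_point x.2) ws ->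
  all (fun x => (k <= x.1)%N && generic_point x.2) (lcst ws).
Proof.
rewrite all_map; apply: sub_all => x /andP[le gx] /=.
by rewrite le; apply: (generic_morph cst).
Qed.

Lemma phi_var (Z : Kz) b : Z + Z^-1 = s ->
  phi (cst \o h) k Z b = sv (map_poly h (Psi F k b.-1)) / discr s ^+ k / Z.
Proof. by move=> Zs; rewrite /phi Zs pev_cst. Qed.

Lemma s_inv : z^-1 + z^-1^-1 = s. Proof. by rewrite invrK addrC. Qed.

Lemma rep_one (Z : Kz) g ws : Z + Z^-1 = s -> generic_point Z ->
  (2 < g.*2 + (size ws).+1)%N -> (g.*2 + (size ws).+1 <= B)%N ->
  all (fun x => (k <= x.1)%N && generic_point x.2) ws ->
  EO_rec Nf m g (Z :: map cst (map snd ws))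
  = sv (evP h (G1 k g) ws) / discr s ^+ k / Z.
Proof.
move=> Zs gZ st le gws.
(* Level [k] is chosen for [Z], so the denominator is [discr s ^ k] whatever the levels of the other
   points. *)
have := @rep g (size ws).+1 st isT le _ (cst \o h) ((k, Z) :: lcst ws).
rewrite /= size_map leqnn gZ generic_lcst // -!map_comp => ->//.
rewrite /ev sum_ilists_cons ilists_map /evP rmorph_sum !mulr_suml exchange_big /=.
apply: eq_bigr => bs _.
rewrite pevZ /G1 !rmorph_sum mulr_sumr !mulr_suml; apply: eq_bigr => b _ /=.
rewrite wt_morph phi_var // map_polyZ pevZ.
rewrite -!mulrA; ring.
Qed.

Lemma rep_two g ws :
  (g.*2 + (size ws).+2 <= B)%N -> (2 < g.*2 + (size ws).+2)%N ->
  all (fun x => (k <= x.1)%N && generic_point x.2) ws ->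
  EO_rec Nf m g [:: z, z^-1 & map cst (map snd ws)]
  = sv (evP h (G2 k g) ws) / discr s ^+ k.*2.
Proof.
move=> le st gws.
have := @rep g (size ws).+2 st isT le _ (cst \o h) [:: (k, z), (k, z^-1) & lcst ws].
rewrite /= size_map leqnn generic_var generic_varV generic_lcst // -!map_comp => ->//.
rewrite /ev sum_ilists_cons.
under eq_bigr do rewrite sum_ilists_cons ilists_map exchange_big.
rewrite exchange_big /evP rmorph_sum mulr_suml /=.
apply: eq_bigr => bs _.
rewrite pevZ /G2 !rmorph_sum mulr_sumr !mulr_suml; apply: eq_bigr => b _ /=.
rewrite !rmorph_sum mulr_sumr !mulr_suml; apply: eq_bigr => b' _ /=.
rewrite wt_morph (phi_var _ erefl) (phi_var _ s_inv) map_polyZ pevZ !rmorphM /=.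
rewrite -addnn exprD !invfM invrK.
have zz : z * z^-1 = 1 by rewrite mulfV ?z_neq0.
transitivity (sv (map_poly h (Psi F k b.-1)) * sv (map_poly h (Psi F k b'.-1))
  * (discr s ^+ k)^-1 * (discr s ^+ k)^-1 * cst (wt h ws bs)
  * cst (h (c g [:: b, b' & bs])) * (z * z^-1)); first by ring.
by rewrite zz; ring.
Qed.

Definition unstable_factor ws : Kz :=
  let w := head 0 (map snd ws) in
  (cst (w + w^-1) * s - 4) / (cst (w + w^-1) - s) ^+ 2 / cst w.

Definition EO_bracket g (zS : seq K) : Kz :=
  (if g is g'.+1 then EO_rec Nf m g' [:: z, z^-1 & map cst zS] else 0)
  + \sum_(g1 < g.+1) \sum_(mk <- masks (size zS) |
        ((0 < g1) || (0 < count id mk))%N && ((0 < g - g1) || (0 < count negb mk))%N)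
      EO_rec Nf m g1 (z :: map cst (mask mk zS))
      * EO_rec Nf m (g - g1)%N (z^-1 :: map cst (mask (map negb mk) zS)).

Lemma EO_rec_bracket g z0 zS : (2 < g.*2 + (size zS).+1)%N ->
  EO_rec Nf.+1 m g (z0 :: zS)
  = \sum_(a <- [:: 1; -1])
      residue a (recursion_kernel m (cst z0) z * (EO_bracket g zS * (- z ^- 2))).
Proof.
move=> st; rewrite /EO_rec -/EO_rec.
case: ifP => [|_]; first by case: g zS st => [|g] [|? []].
case: ifP => [|_]; first by case: g zS st => [|g] [|? []].
apply: eq_bigr => a _; congr (residue a (_ * (_ * _))); congr (_ + _).
apply: eq_bigr => g1 _; rewrite big_mkcond -(big_mkcond _ _) /=.
rewrite [RHS]big_mkcond -sum_set_masks [LHS]big_mkcond; apply: eq_bigr => I _ /=.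
have cI : #|~: I| = count negb (set_mask I) by rewrite card_set_mask set_maskC count_map.
have pts (J : {set 'I_(size zS)}) :
    [seq cst zS`_(i : 'I_(size zS)) | i <- enum J] = map cst (mask (set_mask J) zS).
  by rewrite -(set_mask_pts 0) -map_comp.
by rewrite -card_set_mask -cI !pts set_maskC.
Qed.

Lemma size1_mask (T : Type) mk (ws : seq T) : size mk = size ws -> count id mk == 1%N ->
  exists w, mask mk ws = [:: w].
Proof.
move=> sz /eqP c1; have := size_mask sz; rewrite c1.
by case: (mask mk ws) => [|w []] // _; exists w.
Qed.

(** Each [omega^0_2] factor occurs once at [z] and once at [1/z]; complementing the mask pairs the
    two terms, and [bergman_pair] adds them. *)
Lemma bracketE g lz : (3 <= g.*2 + size lz)%N -> (g.*2 + size lz <= B)%N ->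
  all (fun x => (k <= x.1)%N && generic_point x.2) lz ->
  EO_bracket g (map snd lz)
  = sv (evP h (stable_part k g) lz) / discr s ^+ k.*2
  + \sum_(mk <- masks (size lz) | count id mk == 1%N)
      unstable_factor (mask mk lz)
      * sv (evP h (G1 k g) (mask (map negb mk) lz)) / discr s ^+ k.
Proof.
move=> st le glz; rewrite /EO_bracket.
have gm mk : all (fun x => (k <= x.1)%N && generic_point x.2) (mask mk lz).
  by apply/allP => x /mem_mask /(allP glz).
have W1 Z g' mk : Z + Z^-1 = s -> generic_point Z -> size mk = size lz ->
    (2 < g'.*2 + (count id mk).+1)%N -> (g'.*2 + (count id mk).+1 <= B)%N ->
    EO_rec Nf m g' (Z :: map cst (mask mk (map snd lz)))
    = sv (evP h (G1 k g') (mask mk lz)) / discr s ^+ k / Z.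
  move=> Zs gZ szmk st' le'; rewrite -map_mask.
  by rewrite rep_one ?size_mask.
rewrite size_map.
transitivity (sv (evP h (stable_part k g) lz) / discr s ^+ k.*2
  + (\sum_(mk <- masks (size lz) | count id mk == 1%N)
       EO_rec Nf m 0 (z :: map cst (mask mk (map snd lz)))
       * EO_rec Nf m g (z^-1 :: map cst (mask (map negb mk) (map snd lz)))
   + \sum_(mk <- masks (size lz) | count id mk == 1%N)
       EO_rec Nf m g (z :: map cst (mask (map negb mk) (map snd lz)))
       * EO_rec Nf m 0 (z^-1 :: map cst (mask mk (map snd lz))))); last first.
  congr (_ + _); rewrite -big_split /=; rewrite big_seq_cond [RHS]big_seq_cond.
  apply: eq_bigr => mk; rewrite mem_masks => /andP[/eqP szmk c1].
  have [w wE] := size1_mask szmk c1.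
  have /andP[_ gw] : (k <= w.1)%N && generic_point w.2.
    by apply: (allP (gm mk)); rewrite wE inE.
  have /andP[w0 _] := gw.
  have c2 : (count id (map negb mk)).+1 = size lz.
    by rewrite count_map -szmk -(count_predC id mk) (eqP c1).
  rewrite -map_mask wE /unstable_factor /= !EO_rec_02 ?(leq_trans _ (leq_trans (leq_trans st le) le_B)) //.
  rewrite !W1 ?size_map ?c2 ?generic_var ?generic_varV ?s_inv //.
  rewrite -[RHS]mulrA; apply: bergman_pair; rewrite ?fmorph_eq0 //; first exact: z_neq0.
    by have /andP[_ w1] := gw; exact: (t_sub_s_neq0 w0 w1).
  by rewrite rmorphD fmorphV.
have T1E : (if g is g'.+1 then EO_rec Nf m g' [:: z, z^-1 & map cst (map snd lz)] else 0)
   = sv (evP h (fun bs => if g is g'.+1 then G2 k g' bs else 0) lz) / discr s ^+ k.*2.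
  case: (g) st le => [|g'] st le.
    rewrite /evP big1; first by rewrite rmorph0 mul0r.
    by move=> bs _; rewrite rmorph0 scaler0.
  by rewrite rep_two //; lia.
(* The two unstable cases exclude each other: both at once would mean [g = 0] and two points,
   against [3 <= 2g + size lz]. *)
have cond_split g1 mk (X : Kz) : size mk = size lz -> (g1 <= g)%N ->
   (if ((0 < g1) || (0 < count id mk))%N && ((0 < g - g1) || (0 < count negb mk))%N
    then X else 0)
   = (if stable2 g1 (g - g1) mk then X else 0)
   + ((if (g1 == 0)%N && (count id mk == 1)%N then X else 0)
   + (if (g1 == g)%N && (count negb mk == 1)%N then X else 0)).
  move=> szmk leg; have := count_predC id mk; rewrite szmk -/(count negb mk) /stable2.
  move: (count id mk) (count negb mk) => i j ij.
  by do 4 case: ifP => ?; rewrite ?addr0 ?add0r //; exfalso; lia.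
rewrite /stable_part evPD rmorphD mulrDl -addrA; congr (_ + _); first exact: T1E.
transitivity (\sum_(g1 < g.+1) \sum_(mk <- masks (size lz))
   ((if stable2 g1 (g - g1) mk then 
      EO_rec Nf m g1 (z :: map cst (mask mk (map snd lz))) *
      EO_rec Nf m (g - g1) (z^-1 :: map cst (mask (map negb mk) (map snd lz))) else 0)
   + ((if ((g1 : nat) == 0)%N && (count id mk == 1)%N then 
      EO_rec Nf m g1 (z :: map cst (mask mk (map snd lz))) *
      EO_rec Nf m (g - g1) (z^-1 :: map cst (mask (map negb mk) (map snd lz))) else 0)
    + (if ((g1 : nat) == g)%N && (count negb mk == 1)%N then 
      EO_rec Nf m g1 (z :: map cst (mask mk (map snd lz))) *
      EO_rec Nf m (g - g1) (z^-1 :: map cst (mask (map negb mk) (map snd lz))) else 0)))).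
  apply: eq_bigr => g1 _; rewrite big_mkcond big_seq_cond [RHS]big_seq_cond.
  apply: eq_bigr => mk; rewrite mem_masks andbT => /eqP szmk.
  by rewrite cond_split // -ltnS.
under eq_bigr do rewrite !big_split /=.
rewrite !big_split /=; congr (_ + (_ + _)).
- transitivity (sv (\sum_(g1 < g.+1) \sum_(mk <- masks (size lz) | stable2 g1 (g - g1) mk)
      (evP h (G1 k g1) (mask mk lz) * evP h (G1 k (g - g1)) (mask (map negb mk) lz)))
     / discr s ^+ k.*2); last first.
    congr (sv _ / _).
    transitivity (evP h (fun bs => \sum_(g1 < g.+1)
        \sum_(mk <- masks (size lz) | stable2 g1 (g - g1) mk)
         G1 k g1 (mask mk bs) * G1 k (g - g1) (mask (map negb mk) bs)) lz); last first.
      by apply: eq_evP => bs -> _.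
    rewrite evP_sum; apply: eq_bigr => g1 _; rewrite evP_sum.
    rewrite big_seq_cond [RHS]big_seq_cond; apply: eq_bigr => mk.
    by rewrite mem_masks => /andP[/eqP szmk _]; rewrite evP_mask.
  rewrite rmorph_sum mulr_suml; apply: eq_bigr => g1 _.
  rewrite rmorph_sum mulr_suml -big_mkcond big_seq_cond [RHS]big_seq_cond.
  apply: eq_bigr => mk; rewrite mem_masks => /andP[/eqP szmk] /andP[s1 s2].
  have cc : (count id mk + count negb mk = size lz)%N by rewrite -szmk -(count_predC id mk).
  have cN : count id (map negb mk) = count negb mk by rewrite count_map.
  have leg : (g1 <= g)%N by rewrite -ltnS.
  rewrite W1 ?generic_var //; last by lia.
  rewrite W1 ?s_inv ?generic_varV ?size_map ?cN //; last by lia.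
  by rewrite [in RHS]rmorphM; apply: prod_quot; exact: z_neq0.
- rewrite big_ord_recl [X in _ + X]big1 ?addr0 => [|g1 _]; last by rewrite big1.
  by rewrite -big_mkcond /= subn0.
rewrite big_ord_recr /= [X in X + _]big1 ?add0r /= => [|g1 _]; last first.
  by rewrite big1 // => mk _; rewrite (ltn_eqF (ltn_ord g1)).
rewrite eqxx /= subnn [RHS]big_mkcond -[RHS]sum_masksN; apply: eq_bigr => mk _.
have -> : map negb (map negb mk) = mk by rewrite -map_comp map_id_in // => b _ /=; rewrite negbK.
by rewrite count_map.
Qed.

Hypothesis char0 : forall n, n.+1%:R != 0 :> F.
Hypothesis m_gt0 : (0 < m)%N.
Hypothesis sigmaP : discr 'X ^+ k.*2.+1 %| chebU 'X m * sigma - 1.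

Lemma natrK_neq0 n : (0 < n)%N -> n%:R != 0 :> K.
Proof. by case: n => // n _; rewrite -(rmorph_nat h) fmorph_eq0. Qed.

Lemma natrKz_neq0 n : (0 < n)%N -> n%:R != 0 :> Kz.
Proof. by move=> n0; rewrite -(rmorph_nat cst) fmorph_eq0 natrK_neq0. Qed.

Lemma chebU_at2 : (chebU 'X m : {poly K}).[2] != 0.
Proof.
have -> : (chebU 'X m : {poly K}).[2] = pev idfun 2 (chebU 'X m) by rewrite /pev map_poly_id.
by rewrite pev_chebU chebU2 natrK_neq0.
Qed.

Lemma chebU_atN2 : (chebU 'X m : {poly K}).[-2] != 0.
Proof.
have -> : (chebU 'X m : {poly K}).[-2] = pev idfun (-2) (chebU 'X m) by rewrite /pev map_poly_id.
by rewrite pev_chebU chebUN chebU2 mulf_neq0 ?natrK_neq0 // signr_eq0.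
Qed.

Lemma map_chebU n : map_poly h (chebU 'X n) = chebU 'X n.
Proof. by rewrite rmorph_chebU /= map_polyX. Qed.

Lemma map_discr : map_poly h (discr 'X) = discr 'X.
Proof. by rewrite rmorph_discr /= map_polyX. Qed.

Lemma map_sigmaP i : (i <= k.*2)%N ->
  discr 'X ^+ i.+1 %| chebU 'X m * map_poly h sigma - 1.
Proof.
move=> le; rewrite -map_chebU -rmorphM -(rmorph1 (map_poly h)) -rmorphB -map_discr -rmorphXn.
by rewrite dvdp_map (dvdp_trans _ sigmaP) // dvdp_exp2l.
Qed.

Lemma res_map i p : res i (map_poly h p) = h (res i p).
Proof. by rewrite /res -map_discr -rmorphXn -map_modp coef_map. Qed.

Lemma approx_le e e' (u : Kz) p : (e' <= e)%N -> approx e u p -> approx e' u p.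
Proof.
move=> le [rho [rr ->]]; exists (discr s ^+ (e - e') * rho); split.
  by apply: regular2M => //; apply: regular2X; rewrite discr_s; apply: regular2_sv.
by rewrite -{1}(subnK le) exprD; ring.
Qed.

Lemma kernel0_phi e z0 :
  z0^-1 *: kernel0 h e z0 = \sum_(b <- iota 1 e.*2) phi h e z0 b *: chebU 'X b.
Proof.
rewrite sum_iota1 scaler_sumr; apply: eq_bigr => b _.
by rewrite scalerA mulrC.
Qed.

Lemma kernel1_phi e w :
  w^-1 *: kernel1 h e w = evP h bergman_coef [:: (e, w)].
Proof.
rewrite /evP sum_ilists_cons sum_iota1 scaler_sumr; apply: eq_bigr => b _.
rewrite big_seq1 /= mulr1 scalerA mulrC map_polyZ /= rmorph_nat.
by rewrite (rmorph_chebC _ (map_poly h)) /= map_polyX.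
Qed.

Lemma evP_res i e z0 (C : seq nat -> {poly F}) lz :
  z0^-1 * res i (kernel0 h e z0 * evP h C lz * map_poly h sigma)
  = \sum_(b <- iota 1 e.*2) \sum_(bs <- ilists lz) (phi h e z0 b * wt h lz bs)
     * h (res i (chebU 'X b * (C bs * sigma))).
Proof.
rewrite -linearZ /= !scalerAl kernel0_phi !mulr_suml linear_sum.
apply: eq_bigr => b _; rewrite /evP mulr_sumr mulr_suml linear_sum.
apply: eq_bigr => bs _.
rewrite -res_map -!scalerAl -scalerAr -!scalerAl !linearZ /= mulrA; congr (_ * res _ _).
by rewrite !rmorphM /= map_chebU mulrA.
Qed.

Lemma approx_unstable mk lz : size mk = size lz -> count id mk == 1%N ->
  all (fun x => (k.*2.+1 <= x.1)%N && generic_point x.2) lz ->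
  approx k.+1 (unstable_factor (mask mk lz)) (evP h bergman_coef (mask mk lz)).
Proof.
move=> szmk c1 glz; have [[e w] wE] := size1_mask szmk c1.
have /andP[/= le /andP[w0 w1]] : (k.*2.+1 <= (e, w).1)%N && generic_point (e, w).2.
  by apply: (allP glz); apply: (@mem_mask _ _ mk); rewrite wE inE.
rewrite wE /unstable_factor /= -kernel1_phi -fmorphV mulrC.
apply: approxZ; apply: (@approx_le e); first by rewrite (leq_trans _ le) // ltnS -addnn leq_addr.
exact: approx_kernel1.
Qed.

(** The denominators are [discr s ^ k.*2] for the stable part and [discr s ^ k] for the other; the
    factor [(z^2 - 1)^-1] raises these levels by one, whence the level [k.*2.+1] asked of the outer
    points. *)
Lemma EO_step g e0 z0 lz : (3 <= g.*2 + size lz)%N -> (g.*2 + size lz <= B)%N ->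
  all (fun x => (k.*2.+1 <= x.1)%N && generic_point x.2) ((e0, z0) :: lz) ->
  EO_rec Nf.+1 m g (z0 :: map snd lz) = ev h (next k sigma g) ((e0, z0) :: lz).
Proof.
move=> st le gall.
have [le0 gz0 glz] : [/\ (k.*2.+1 <= e0)%N, generic_point z0 &
    all (fun x => (k.*2.+1 <= x.1)%N && generic_point x.2) lz].
  by case/andP: gall => /andP[].
have /andP[z00 z01] := gz0.
have two0 : (2 : K) != 0 by apply: natrK_neq0.
have gk : all (fun x => (k <= x.1)%N && generic_point x.2) lz.
  apply: sub_all glz => x /andP[lek ->]; rewrite andbT (leq_trans _ lek) //.
  by rewrite -addnn ltnW // ltnS leq_addr.
rewrite EO_rec_bracket ?size_map; last by lia.
rewrite bracketE // !big_cons big_nil addr0; apply: is_residue2E.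
rewrite kernel_joukowski; last first.
- exact: natrKz_neq0.
- exact: natrKz_neq0.
- by rewrite -(pev_chebU cst); apply: sv_neq0 chebU_at2.
- by rewrite -fmorphV -rmorphD; exact: (t_sub_s_neq0 z00 z01).
- exact: zz1_neq0.
- exact: z_neq0.
- by rewrite fmorph_eq0.
have -> : m%:R / (2 * cst z0) = cst (m%:R / 2 * z0^-1).
  by rewrite !rmorphM !fmorphV !rmorph_nat invfM mulrA.
have -> : cst z0 + (cst z0)^-1 = cst (z0 + z0^-1) by rewrite rmorphD fmorphV.
set t := cst (z0 + z0^-1) - s.
(* Every residue carries the factor [2] of the double cover [s], which cancels the [2] of
   [m / (2 z0)]. *)
have -> : ev h (next k sigma g) ((e0, z0) :: lz)
  = m%:R / 2 * z0^-1 * (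
    2 * res k.*2.+1 (kernel0 h e0 z0 * evP h (stable_part k g) lz * map_poly h sigma)
    + \sum_(mk <- masks (size lz) | count id mk == 1%N)
       2 * res k.+1 (kernel0 h e0 z0 *
          (evP h bergman_coef (mask mk lz) * evP h (G1 k g) (mask (map negb mk) lz))
          * map_poly h sigma)).
  have -> : \sum_(mk <- masks (size lz) | count id mk == 1%N)
      2 * res k.+1 (kernel0 h e0 z0 *
          (evP h bergman_coef (mask mk lz) * evP h (G1 k g) (mask (map negb mk) lz))
          * map_poly h sigma)
     = 2 * res k.+1 (kernel0 h e0 z0 * evP h (bergman_part k g) lz * map_poly h sigma).
    rewrite (_ : evP h (bergman_part k g) lz = evP h (fun bs =>
        \sum_(mk <- masks (size lz) | count id mk == 1%N)
        bergman_coef (mask mk bs) * G1 k g (mask (map negb mk) bs)) lz); last first.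
      by apply: eq_evP => bs szbs _; rewrite /bergman_part szbs.
    rewrite evP_sum mulr_sumr mulr_suml linear_sum mulr_sumr.
    rewrite big_seq_cond [RHS]big_seq_cond; apply: eq_bigr => mk.
    by rewrite mem_masks => /andP[/eqP szmk _]; rewrite evP_mask.
  rewrite half_cancel // !evP_res -big_split mulr_sumr /ev sum_ilists_cons; apply: eq_bigr => b _.
  rewrite -big_split mulr_sumr; apply: eq_bigr => bs _ /=.
  by rewrite -mulrDr rmorphM rmorph_nat rmorphD mulrCA.
apply: is_residue2Z.
have -> : (z ^+ 2 - 1)^-1 * (t^-1 *
   (sv (evP h (stable_part k g) lz) / discr s ^+ k.*2
    + \sum_(mk <- masks (size lz) | count id mk == 1%N)
       unstable_factor (mask mk lz)
       * sv (evP h (G1 k g) (mask (map negb mk) lz)) / discr s ^+ k) / chebU s m)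
  = (z ^+ 2 - 1)^-1 * (t^-1 * sv (evP h (stable_part k g) lz) / (discr s ^+ k.*2 * sv (chebU 'X m)))
   + \sum_(mk <- masks (size lz) | count id mk == 1%N)
     (z ^+ 2 - 1)^-1 * (t^-1 * (unstable_factor (mask mk lz)
       * sv (evP h (G1 k g) (mask (map negb mk) lz))) / (discr s ^+ k * sv (chebU 'X m))).
  rewrite pev_chebU; exact: distribute.
apply: is_residue2D.
  apply: (@approx_residue _ two0 k.*2.+1) => //.
  - exact: chebU_at2.
  - exact: chebU_atN2.
  - exact: map_sigmaP.
  apply: approxM; last exact: approx_sv.
  by apply: (approx_le le0); apply: approx_kernel0.
rewrite big_seq_cond [X in is_residue2 _ X]big_seq_cond.
apply: is_residue2_sum => mk; rewrite mem_masks => /andP[/eqP szmk c1].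
apply: (@approx_residue _ two0 k.+1) => //.
- exact: chebU_at2.
- exact: chebU_atN2.
- by apply: map_sigmaP; rewrite -addnn leq_addr.
apply: approxM.
  apply: (@approx_le e0); last exact: approx_kernel0.
  by rewrite (leq_trans _ le0) // ltnS -addnn leq_addr.
by apply: approxM; [exact: approx_unstable|exact: approx_sv].
Qed.

(** For [g = 1] and one point the bracket is [omega^0_2(z, 1/z)], that is [1 / discr s]; hence
    [res 2]. *)
Definition next11 (bs : seq nat) : F :=
  if bs is [:: b0] then m%:R * res 2 (chebU 'X b0 * sigma) else 0.

Definition bergman_coef2 (bs : seq nat) : {poly F} :=
  bergman_coef (mask [:: true; false] bs) * bergman_coef (mask [:: false; true] bs).

(** For [g = 0] and three points both factors are [omega^0_2]. The [1/2] comes from [bergman_pair2],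
    and without any power of [discr] below, the level is [1]. *)
Definition next03 (bs : seq nat) : F :=
  if bs is b0 :: bs' then m%:R / 2 * res 1 (chebU 'X b0 * (bergman_coef2 bs' * sigma)) else 0.

Lemma kernel_at_const z0 (X : Kz) : generic_point z0 ->
  recursion_kernel m (cst z0) z * (X * - z ^- 2)
  = cst (m%:R / 2 * z0^-1)
    * ((z ^+ 2 - 1)^-1 * ((cst (z0 + z0^-1) - s)^-1 * X / chebU s m)).
Proof.
move=> /andP[z00 z01]; have E : cst (z0 + z0^-1) = cst z0 + (cst z0)^-1.
  by rewrite rmorphD fmorphV.
have -> : cst (m%:R / 2 * z0^-1) = m%:R / (2 * cst z0).
  by rewrite !rmorphM !fmorphV !rmorph_nat invfM mulrA.
rewrite E; apply: kernel_joukowski.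
- by rewrite fmorph_eq0.
- exact: z_neq0.
- exact: zz1_neq0.
- by rewrite -E; exact: (t_sub_s_neq0 z00 z01).
- by rewrite -(pev_chebU cst); apply: sv_neq0 chebU_at2.
- exact: natrKz_neq0.
- exact: natrKz_neq0.
Qed.

Lemma EO_base11 e0 z0 : (0 < Nf)%N -> (0 < k)%N -> (2 <= e0)%N -> generic_point z0 ->
  EO_rec Nf.+1 m 1 [:: z0] = ev h next11 [:: (e0, z0)].
Proof.
move=> Nf0 k0 le0 gz0; have /andP[z00 z01] := gz0.
have two0 : (2 : K) != 0 by apply: natrK_neq0.
rewrite (@EO_rec_bracket 1 z0 [::]) // !big_cons big_nil addr0; apply: is_residue2E.
have -> : EO_bracket 1 [::] = (discr s)^-1.
  rewrite /EO_bracket EO_rec_02 // big1 ?addr0 => [|g1 _]; last first.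
    by rewrite /= big_cons big_nil /= !orbF; case: ifP => //; case: g1 => [[|[|]]].
  by rewrite discr_diff ?z_neq0.
rewrite kernel_at_const //.
have -> : ev h next11 [:: (e0, z0)] = m%:R / 2 * z0^-1 *
   (2 * res 2 (kernel0 h e0 z0 * evP h (fun=> 1) [::] * map_poly h sigma)).
  rewrite -[2 * res _ _]addr0 -[0](mulr0 2) half_cancel // mulr0 addr0 evP_res mulr_sumr.
  rewrite /ev sum_ilists_cons; apply: eq_bigr => b _.
  by rewrite !big_seq1 /= mul1r rmorphM rmorph_nat mulrCA.
apply: is_residue2Z.
have -> : (cst (z0 + z0^-1) - s)^-1 / discr s / chebU s m
   = (cst (z0 + z0^-1) - s)^-1 * sv (evP h (fun=> 1) [::]) / (discr s ^+ 1 * sv (chebU 'X m)).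
  by rewrite /evP big_seq1 scale1r !rmorph1 mulr1 expr1 pev_chebU invfM mulrA.
apply: (@approx_residue _ two0 2) => //.
- exact: chebU_at2.
- exact: chebU_atN2.
- by apply: map_sigmaP; rewrite -addnn ltn_addl.
by apply: approxM; [apply: (approx_le le0); apply: approx_kernel0|exact: approx_sv].
Qed.

Lemma EO_base03 e0 e1 e2 z0 w1 w2 : (0 < Nf)%N ->
  all (fun x => (0 < x.1)%N && generic_point x.2) [:: (e0, z0); (e1, w1); (e2, w2)] ->
  EO_rec Nf.+1 m 0 [:: z0; w1; w2] = ev h next03 [:: (e0, z0); (e1, w1); (e2, w2)].
Proof.
move=> Nf0 gall.
have [[le0 gz0] [le1 gw1] [le2 gw2]] : [/\ (0 < e0)%N /\ generic_point z0,
    (0 < e1)%N /\ generic_point w1 & (0 < e2)%N /\ generic_point w2].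
  by case/and4P: gall => /andP[? ?] /andP[? ?] /andP[? ?] _.
have /andP[z00 z01] := gz0; have /andP[w10 w11] := gw1; have /andP[w20 w21] := gw2.
have two0 : (2 : K) != 0 by apply: natrK_neq0.
have two0z : (2 : Kz) != 0 by apply: natrKz_neq0.
rewrite (@EO_rec_bracket 0 z0 [:: w1; w2]) // !big_cons big_nil addr0; apply: is_residue2E.
have -> : EO_bracket 0 [:: w1; w2]
    = bergman z (cst w1) * bergman z^-1 (cst w2) + bergman z (cst w2) * bergman z^-1 (cst w1).
  rewrite /EO_bracket add0r big_ord1 /= !big_cons big_nil /= !EO_rec_02 //.
  by rewrite addr0.
have c1 : cst w1 != 0 by rewrite fmorph_eq0.
have c2 : cst w2 != 0 by rewrite fmorph_eq0.
have E1 : cst (w1 + w1^-1) = cst w1 + (cst w1)^-1 by rewrite rmorphD fmorphV.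
have E2 : cst (w2 + w2^-1) = cst w2 + (cst w2)^-1 by rewrite rmorphD fmorphV.
rewrite (bergman_pair2 two0z (z_neq0 K) c1 c2); last first.
- by rewrite -E2; exact: (t_sub_s_neq0 w20 w21).
- by rewrite -E1; exact: (t_sub_s_neq0 w10 w11).
rewrite -E1 -E2 kernel_at_const //.
set lz := [:: (e1, w1); (e2, w2)].
have -> : ev h next03 [:: (e0, z0), (e1, w1) & [:: (e2, w2)]] = m%:R / 2 * z0^-1 *
   (2^-1 * (2 * res 1 (kernel0 h e0 z0 * evP h bergman_coef2 lz * map_poly h sigma)) + 0).
  rewrite addr0 mulKf // -mulrA evP_res mulr_sumr.
  rewrite /ev sum_ilists_cons; apply: eq_bigr => b _.
  rewrite mulr_sumr; apply: eq_bigr => bs _.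
  by rewrite /next03 [h (_ * res _ _)]rmorphM rmorphM fmorphV !rmorph_nat /= mulrCA.
apply: is_residue2Z.
set f1 := (_ / cst w1); set f2 := (_ / cst w2).
have -> : (1 - cst w1 ^+ 2) / cst w1 ^+ 2 * ((1 - cst w2 ^+ 2) / cst w2 ^+ 2) / 2
    = cst ((1 - w1 ^+ 2) / w1 ^+ 2 * ((1 - w2 ^+ 2) / w2 ^+ 2) / 2).
  by rewrite !(rmorphM, fmorphV) !rmorphB !rmorphXn rmorph1 rmorph_nat.
rewrite (rest_split _ _ _ _ _ _ (zz1_neq0 K)); apply: is_residue2D; last first.
  apply: regular2_residue; apply: regular2M; first exact: regular2N (regular2_const _).
  apply: regular2M; last first.
    rewrite -(pev_chebU cst); apply: regular2_svV; [exact: chebU_at2|exact: chebU_atN2].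
  apply: regular2M; last first.
    by apply: regular2M; apply: regular2X; apply: regular2_tsV.
  by apply: regular2M; [apply: regular2_tsV|exact: regular2_zz1].
have -> : 2^-1 = cst 2^-1 by rewrite fmorphV rmorph_nat.
apply: is_residue2Z.
have -> : (cst (z0 + z0^-1) - s)^-1 * (f1 * f2) / chebU s m
   = (cst (z0 + z0^-1) - s)^-1 * (f1 * f2) / (discr s ^+ 0 * sv (chebU 'X m)).
  by rewrite expr0 mul1r pev_chebU.
apply: (@approx_residue _ two0 1) => //.
- exact: chebU_at2.
- exact: chebU_atN2.
- exact: map_sigmaP.
apply: approxM; first by apply: (approx_le le0); apply: approx_kernel0.
have -> : evP h bergman_coef2 lz = evP h bergman_coef [:: (e1, w1)] * evP h bergman_coef [:: (e2, w2)].
  by rewrite -[lz]/(lz) -(@evP_mask _ _ h bergman_coef bergman_coef [:: true; false] lz).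
apply: approxM.
  rewrite -kernel1_phi /f1 -fmorphV mulrC.
  by apply: approxZ; apply: (approx_le le1); apply: approx_kernel1.
rewrite -kernel1_phi /f2 -fmorphV mulrC.
by apply: approxZ; apply: (approx_le le2); apply: approx_kernel1.
Qed.

End Step.
End Recursion.

Lemma chebU_expand (L : fieldType) (x : L) k : x != 0 ->
  x ^+ k * chebU (x + x^-1) k.+1 = \sum_(i < k.+1) x ^+ i.*2.
Proof.
move=> x0; elim/nat_ind2: k => [||k IH1 IH2].
- by rewrite big_ord1 mul1r.
- by rewrite !big_ord_recr big_ord0 /= expr0; field.
have E1 : \sum_(i < k.+2) x ^+ i.*2 = \sum_(i < k.+1) x ^+ i.*2 + x ^+ k.+1.*2.
  by rewrite big_ord_recr.
rewrite [RHS]big_ord_recr [RHS]/= E1 chebUSS.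
have -> : x ^+ k.+2 * ((x + x^-1) * chebU (x + x^-1) k.+2 - chebU (x + x^-1) k.+1)
  = (x ^+ 2 + 1) * (x ^+ k.+1 * chebU (x + x^-1) k.+2)
    - x ^+ 2 * (x ^+ k * chebU (x + x^-1) k.+1).
  by rewrite ![x ^+ k.+2]exprS ![x ^+ k.+1]exprS; field.
by rewrite IH1 IH2 E1 !doubleS !exprS; ring.
Qed.

Lemma joukowski_clear (L : fieldType) (z : L) e : z != 0 ->
  (z ^+ 2 - 1) ^+ e.*2 = z ^+ e.*2 * ((z ^+ 2 - 1) ^+ 2 / z ^+ 2) ^+ e.
Proof.
move=> z0; rewrite expr_div_n -!exprM mul2n mulrC mulfVK //.
exact: expf_neq0.
Qed.

Lemma dvdp_scaler_imp (F : fieldType) (d p : {poly F}) c : d %| p -> d %| c *: p.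
Proof. by move=> dp; rewrite -mul_polyC dvdp_mull. Qed.

Section PhiExpansion.
Variable F : fieldType.

(** * Expansion at the origin *)

Definition evens k : {poly F} := \sum_(i < k.+1) 'X^(i.*2).

(** Numerator of [phi] over [(x^2 - 1)^(2e)]: each [U_(k - b)] of [Psi e b] is cleared of negative
    powers of [x] by means of [evens]. *)
Definition phi_num e b : {poly F} :=
  \sum_(k < e.*2.+1)
    (if (b < k)%N then (qcoef F e)`_k *: ('X^(e.*2 - k + b) * evens (k - b.+1)) else 0).

Lemma pev_evens (L : fieldType) (h : {rmorphism F -> L}) x k : x != 0 ->
  pev h x (evens k) = x ^+ k * chebU (x + x^-1) k.+1.
Proof.
move=> x0; rewrite chebU_expand // rmorph_sum; apply: eq_bigr => i _ /=.
by rewrite rmorphXn /= pevX.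
Qed.

Lemma phi_numE (L : fieldType) (h : {rmorphism F -> L}) e b x :
  x != 0 -> x ^+ 2 != 1 ->
  phi h e x b.+1 = pev h x (phi_num e b) / (x ^+ 2 - 1) ^+ e.*2.
Proof.
move=> x0 x1; rewrite /phi /=.
have x2 : x ^+ 2 - 1 != 0 by rewrite subr_eq0.
have E : x * pev h x (phi_num e b) = x ^+ e.*2 * pev h (x + x^-1) (Psi F e b).
  rewrite /phi_num /Psi !rmorph_sum !mulr_sumr; apply: eq_bigr => k _ /=.
  case: ifP => ltbk; last by rewrite !rmorph0 !mulr0.
  rewrite !pevZ mulrCA [RHS]mulrCA; congr (_ * _).
  rewrite rmorphM rmorphXn /= pevX pev_evens // pev_chebU.
  have -> : (k - b = (k - b.+1).+1)%N by lia.
  rewrite !mulrA -exprS -exprD; congr (_ ^+ _ * _); have := ltn_ord k; lia.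
have -> : pev h x (phi_num e b) = x ^+ e.*2 * pev h (x + x^-1) (Psi F e b) / x.
  by rewrite -E mulrC mulKf.
rewrite discr_joukowski // expr_div_n -!exprM mul2n.
have := expf_neq0 e.*2 x0; have := expf_neq0 e.*2 x2.
by move: (_ ^+ _) (_ ^+ _) => y z y0 z0; field; rewrite y0 z0 x0.
Qed.

(** The expansion [qcoefE] at [s = z + 1/z], multiplied by [z^(2e)]. *)
Lemma discr_evens e :
  ('X^2 - 1) ^+ e.*2
  = \sum_(k < e.*2.+1) (qcoef F e)`_k *: ('X^(e.*2 - k) * evens k) :> {poly F}.
Proof.
apply/eqP; rewrite -tofrac_eq; apply/eqP.
have z0 := z_neq0 F; set z := ratfun_var F in z0 *.
have pevz (q : {poly F}) : tofrac q = pev (@ratfun_const F) z q.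
  elim/poly_ind: q => [|q c IH]; first by rewrite !rmorph0.
  by rewrite !(rmorphD, rmorphM) /= IH pevX pevC.
rewrite !pevz rmorph_sum rmorphXn rmorphB rmorphXn rmorph1 /= pevX.
have := congr1 (fun p => z ^+ e.*2 * pev (@ratfun_const F) (z + z^-1) p) (qcoefE F e).
rewrite rmorphXn /= pev_discr discr_joukowski // => E.
transitivity (z ^+ e.*2 * ((z ^+ 2 - 1) ^+ 2 / z ^+ 2) ^+ e).
  exact: joukowski_clear.
rewrite E rmorph_sum mulr_sumr; apply: eq_bigr => k _ /=.
rewrite !pevZ rmorphM rmorphXn /= pevX pev_evens // pev_chebU mulrCA; congr (_ * _).
by rewrite mulrA -exprD subnK // -ltnS.
Qed.

(** Comparison with ['X^b] times [discr_evens], term by term: for [b < k] the discrepancy starts at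
    exponent [2e + k - b], otherwise at [2e + b - k]. *)
Lemma phi_num_mod e b : 'X^(e.*2) %| phi_num e b - 'X^b * ('X^2 - 1) ^+ e.*2.
Proof.
rewrite discr_evens /phi_num mulr_sumr -sumrB; elim/big_ind: _ => [|p q|k _].
- exact: dvdp0.
- exact: dvdp_add.
have dvX i j : (i <= j)%N -> ('X^i : {poly F}) %| 'X^j by apply: dvdp_exp2l.
rewrite -scalerAr mulrA -exprD; case: ifP => ltbk; last first.
  rewrite sub0r dvdpNr; apply: dvdp_scaler_imp; apply: dvdp_mulr; apply: dvX; lia.
rewrite -scalerBr; apply: dvdp_scaler_imp; rewrite addnC -mulrBr.
have -> : evens (k - b.+1) - evens k = - \sum_(k - b <= i < k.+1) 'X^(i.*2) :> {poly F}.
  rewrite /evens -!(big_mkord xpredT (fun i => 'X^(i.*2) : {poly F})).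
  have le1 : (k - b <= k.+1)%N by lia.
  have -> : ((k - b.+1).+1 = k - b)%N by lia.
  by rewrite (big_cat_nat _ le1) //= opprD addrA subrr sub0r.
rewrite mulrN dvdpNr mulr_sumr big_nat; elim/big_ind: _ => [|p q|i /andP[lei _]].
- exact: dvdp0.
- exact: dvdp_add.
by rewrite -exprD dvX //; have := ltn_ord k; lia.
Qed.
End PhiExpansion.

Lemma cross_mul (L : fieldType) (a b c d : L) :
  b != 0 -> d != 0 -> a / b = c / d -> c * b = a * d.
Proof. by move=> b0 d0 /eqP; rewrite eqr_div // => /eqP->. Qed.

(** * Reading off the coefficients of a multivariate expansion *)

Section Expansion.
Variables (F : fieldType) (n : nat).
Local Notation R := {mpoly F[n]}.
Local Notation frac := (@FracField.tofrac {mpoly F[n]}).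
Local Notation mC := (@mpolyC n F).
Implicit Types (p q : {mpoly F[n]}) (k : 'X_{1..n}).

(** Membership in the ideal generated by the [M]-th powers of the variables. *)
Definition small M p := forall k, (forall i, k i < M)%N -> p@_k = 0.

Lemma mnm_lel k (u v : 'X_{1..n}) i : k = (u + v)%MM -> (u i <= k i)%N.
Proof. by move=> ->; rewrite mnmDE leq_addr. Qed.

Lemma mnm_ler k (u v : 'X_{1..n}) i : k = (u + v)%MM -> (v i <= k i)%N.
Proof. by move=> ->; rewrite mnmDE leq_addl. Qed.

Lemma mdeg_ler k (u v : 'X_{1..n}) : k = (u + v)%MM -> (mdeg v <= mdeg k)%N.
Proof. by move=> ->; rewrite mdegD leq_addl. Qed.

Lemma mdeg_ltr k (u v : 'X_{1..n}) : k = (u + v)%MM -> u != 0%MM -> (mdeg v < mdeg k)%N.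
Proof. by move=> -> u0; rewrite mdegD -[X in (X < _)%N]add0n ltn_add2r lt0n mdeg_eq0. Qed.

Lemma small0 M : small M 0.
Proof. by move=> k _; rewrite mcoeff0. Qed.

Lemma smallD M p q : small M p -> small M q -> small M (p + q).
Proof. by move=> sp sq k lek; rewrite mcoeffD sp // sq // addr0. Qed.

Lemma smallM M p q : small M p -> small M (p * q).
Proof.
move=> sp k lek; rewrite mcoeffM big1 // => -[u v] /= /eqP E.
rewrite sp ?mul0r // => i; apply: leq_ltn_trans (lek i).
exact: mnm_lel E.
Qed.

Lemma smallXn M i : small M ('X_i ^+ M).
Proof.
move=> k lek; rewrite mcoeffXn; case: eqP => // E.
by have := lek i; rewrite -E mulmnE mnm1E eqxx mul1n ltnn.
Qed.

(** A polynomial with nonzero constant term is a unit among power series; the induction on degree is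
    the usual computation of the quotient. *)
Lemma small_cancel M p q : p@_0%MM != 0 -> small M (p * q) -> small M q.
Proof.
move=> p0 spq k; have [d] := ubnP (mdeg k); elim: d k => // d IH k; rewrite ltnS => dk lek.
have := spq k lek.
have -> : p * q = (p@_0)%:MP * q + (p - (p@_0)%:MP) * q by rewrite -mulrDl addrC subrK.
rewrite mcoeffD mcoeffCM mcoeffM big1 ?addr0 => [/eqP|[u v] /= /eqP E].
  by rewrite mulf_eq0 (negPf p0) => /eqP.
have [u0|u0] := eqVneq (u : 'X_{1..n}) 0%MM.
  by rewrite u0 mcoeffB mcoeffC eqxx mulr1 subrr mul0r.
rewrite [q@_v]IH ?mulr0 // => [|i].
  exact: leq_trans (mdeg_ltr E u0) dk.
apply: leq_ltn_trans (lek i).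
exact: mnm_ler E.
Qed.

Fixpoint numer e (f : seq nat -> F) (s : seq 'I_n) : R :=
  if s is i :: s' then
    \sum_(b < e.*2) pev mC 'X_i (phi_num F e b) * numer e (fun bs => f (b.+1 :: bs)) s'
  else (f [::])%:MP.

Fixpoint monos e (f : seq nat -> F) (s : seq 'I_n) : R :=
  if s is i :: s' then
    \sum_(b < e.*2) 'X_i ^+ b * monos e (fun bs => f (b.+1 :: bs)) s'
  else (f [::])%:MP.

Definition denom e (s : seq 'I_n) : R := \prod_(i <- s) ('X_i ^+ 2 - 1) ^+ e.*2.

Lemma mX_neq0 i : ('X_i : R) != 0.
Proof. by apply/eqP => /(congr1 (mcoeff U_(i))); rewrite mcoeffXU eqxx mcoeff0 => /eqP; rewrite oner_eq0. Qed.

Lemma mX2_neq1 i : ('X_i ^+ 2 : R) != 1.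
Proof.
apply/eqP => /(congr1 (mcoeff 0%MM)); rewrite mcoeffXn mcoeff1 eqxx.
case: eqP => [/(congr1 mdeg)|_ /eqP]; first by rewrite mdegMn mdeg1 mdeg0.
by rewrite eq_sym oner_eq0.
Qed.

Lemma generic_X i : generic_point (frac 'X_i).
Proof.
by rewrite /generic_point tofrac_eq0 -tofracXn -tofrac1 tofrac_eq mX_neq0 mX2_neq1.
Qed.

Lemma denom0 e s : (denom e s)@_0%MM != 0.
Proof.
rewrite /denom; elim: s => [|i s IH]; first by rewrite big_nil mcoeff1 eqxx oner_neq0.
rewrite big_cons rmorphM mulf_neq0 // rmorphXn rmorphB rmorph1 rmorphXn /= mcoeffX.
have -> : (U_(i) == 0 :> 'X_{1..n})%MM = false by rewrite mnm1_eq0.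
by rewrite expr0n sub0r signr_eq0.
Qed.

Lemma ev_numer e f s :
  ev (frac \o mC) f [seq (e, frac 'X_i) | i <- s]
  = frac (numer e f s) / frac (denom e s).
Proof.
elim: s f => [|i s IH] f.
  by rewrite /ev big_seq1 /= mul1r /denom big_nil tofrac1 divr1.
have /andP[x0 x1] := generic_X i.
rewrite /ev sum_ilists_cons sum_iota1 /= rmorph_sum mulr_suml; apply: eq_bigr => b _.
rewrite /denom big_cons -/(denom e s) !tofracM invfM.
have E : phi (frac \o mC) e (frac ('X_i)) b.+1 = _ := phi_numE (frac \o mC) e b x0 x1.
rewrite pev_comp in E.
rewrite tofracXn tofracB tofrac1 tofracXn; under eq_bigr do rewrite E.
transitivity (frac (pev mC 'X_i (phi_num F e b)) / (frac 'X_i ^+ 2 - 1) ^+ e.*2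
  * ev (frac \o mC) (fun bs => f (b.+1 :: bs)) [seq (e, frac 'X_i) | i <- s]).
  rewrite /ev mulr_sumr; apply: eq_bigr => bs _; by rewrite mulrA.
rewrite IH mulrACA; congr (_ * _); exact: esym (tofracM _ _).
Qed.

(** The one-variable congruence [phi_num_mod], argument by argument. *)
Lemma numer_mod e f s : small e.*2 (numer e f s - denom e s * monos e f s).
Proof.
elim: s f => [|i s IH] f; first by rewrite /denom big_nil /= mul1r subrr; apply: small0.
rewrite /denom big_cons -/(denom e s) /= mulr_sumr -sumrB.
elim/big_ind: _ => [|p q|b _]; [exact: small0|exact: smallD|].
set A := pev _ _ _; set N := numer _ _ _; set M := monos _ _ _; set D := denom e s.
have -> : A * N - ('X_i ^+ 2 - 1) ^+ e.*2 * D * ('X_i ^+ b * M)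
  = (A - 'X_i ^+ b * ('X_i ^+ 2 - 1) ^+ e.*2) * N
    + (N - D * M) * ('X_i ^+ b * ('X_i ^+ 2 - 1) ^+ e.*2) by ring.
apply: smallD; last exact/smallM/IH.
have [w E] := dvdpP _ _ (phi_num_mod F e b).
have := congr1 (pev mC 'X_i) E.
rewrite rmorphB !rmorphM !rmorphXn rmorphB rmorph1 rmorphXn /= !pevX -/A => ->.
rewrite [_ * 'X_i ^+ _]mulrC; do 2 apply: smallM; exact: smallXn.
Qed.

Lemma mcoeffXM i b p k :
  ('X_i ^+ b * p)@_k = if (b <= k i)%N then p@_(k - U_(i) *+ b)%MM else 0.
Proof.
rewrite mpolyXn; case: leqP => [le|lt].
  have {1}-> : k = (U_(i) *+ b + (k - U_(i) *+ b))%MM.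
    apply/mnmP => j; rewrite mnmDE mnmBE mulmnE mnm1E; case: eqP => [<-|_]; last by rewrite mul0n subn0.
    by rewrite mul1n subnKC.
  by rewrite mulrC mcoeffMX.
rewrite mcoeffM big1 // => -[u v] /= /eqP E; rewrite mcoeffX; case: eqP => [eu|_]; last by rewrite mul0r.
have := mnm_lel i E.
by rewrite -eu mulmnE mnm1E eqxx mul1n leqNgt lt.
Qed.

Lemma monos_notin e f s k j : j \notin s -> (0 < k j)%N -> (monos e f s)@_k = 0.
Proof.
elim: s f k => [|i s IH] f k /=.
  move=> _ kj; rewrite mcoeffC; case: eqP => [E|]; last by rewrite mulr0.
  by rewrite E mnm0E in kj.
rewrite inE negb_or => /andP[ji js] kj; rewrite raddf_sum big1 // => b _ /=.
rewrite mcoeffXM; case: ifP => // _; apply: IH => //.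
by rewrite mnmBE mulmnE mnm1E eq_sym (negPf ji) mul0n subn0.
Qed.

Lemma monos_coef e f s k : uniq s -> (forall j, j \notin s -> k j = 0%N) ->
  (forall j, j \in s -> (k j < e.*2)%N) ->
  (monos e f s)@_k = f [seq (k i).+1 | i <- s].
Proof.
elim: s f k => [|i s IH] f k /=.
  move=> _ k0 _; have -> : k = 0%MM by apply/mnmP => j; rewrite mnm0E k0.
  by rewrite mcoeffC eqxx mulr1.
move=> /andP[nis us] k0 lek; rewrite raddf_sum /=.
have ki : (k i < e.*2)%N by apply: lek; rewrite inE eqxx.
rewrite (bigD1 (Ordinal ki)) //= big1 ?addr0 => [|b nb].
  rewrite mcoeffXM leqnn IH //.
  - congr f; congr cons; apply/eq_in_map => j js.
    rewrite mnmBE mulmnE mnm1E; case: eqP => [E|_]; last by rewrite mul0n subn0.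
    by rewrite E js in nis.
  - move=> j js; rewrite mnmBE mulmnE mnm1E; case: eqP => [->|/eqP ij]; first by rewrite mul1n subnn.
    by rewrite mul0n subn0 k0 // inE negb_or eq_sym ij.
  - by move=> j js; rewrite mnmBE (leq_ltn_trans (leq_subr _ _)) // lek // inE js orbT.
rewrite mcoeffXM; case: leqP => // leb; apply: (@monos_notin _ _ _ _ i) => //.
rewrite mnmBE mulmnE mnm1E eqxx mul1n subn_gt0 ltn_neqAle leb andbT.
by apply: contraNneq nb => E; apply/eqP/val_inj.
Qed.

(** The expansion is given only through [Q * d = P], so [d] and [monos] are compared after
    multiplication by [Q] and [denom], both invertible at the origin. *)
Lemma expansion_coef e f (d : 'X_{1..n} -> F) :
  expansion_at0 (ev (frac \o mC) f [seq (e, frac 'X_i) | i <- enum 'I_n]) d ->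
  forall k, (forall i, k i < e.*2)%N -> d k = f [seq (k i).+1 | i <- enum 'I_n].
Proof.
move=> [P [Q [Q0 PQ dE]]] k lek.
(* A monomial with all exponents below [2e] has degree less than this bound, so the truncation [S]
   contains every coefficient to be compared. *)
pose B := (n * e.*2).+1.
pose S : R := \sum_(u : 'X_{1..n < B}) d u *: 'X_[u].
have Sc u : (mdeg u < B)%N -> S@_u = d u by move=> lt; rewrite /S mcoeff_mpoly.
have lt_small (u : 'X_{1..n}) : (forall i, u i < e.*2)%N -> (mdeg u < B)%N.
  move=> leu; rewrite ltnS mdegE; apply: (@leq_trans (\sum_(i < n) e.*2)).
    by apply: leq_sum => i _; apply: ltnW.
  by rewrite sum_nat_const card_ord.
have sQS : small e.*2 (Q * S - P).
  move=> u leu; rewrite mcoeffB -dE mcoeffM -sumrB big1 // => -[v w] /= /eqP E.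
  rewrite Sc ?subrr //; apply: leq_ltn_trans (lt_small _ leu).
  exact: mdeg_ler E.
set s := enum 'I_n in PQ *.
have E : P * denom e s = numer e f s * Q.
  have QF : frac Q != 0.
    by rewrite tofrac_eq0; apply: contraNneq Q0 => ->; rewrite mcoeff0.
  have DF : frac (denom e s) != 0.
    by rewrite tofrac_eq0; apply: contraNneq (denom0 e s) => ->; rewrite mcoeff0.
  apply/eqP; rewrite -tofrac_eq !tofracM; apply/eqP.
  by rewrite ev_numer in PQ; exact: (cross_mul DF QF PQ).
have sm : small e.*2 (Q * denom e s * (S - monos e f s)).
  have -> : Q * denom e s * (S - monos e f s)
    = (Q * S - P) * denom e s + (numer e f s - denom e s * monos e f s) * Q
      + (P * denom e s - numer e f s * Q) by ring.
  rewrite E subrr addr0.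
  apply: smallD; first exact: smallM.
  exact/smallM/numer_mod.
have := small_cancel _ sm lek; rewrite mcoeffB Sc ?lt_small // => H.
have {H} : d k - (monos e f s)@_k = 0.
  by apply: H; rewrite rmorphM mulf_neq0 ?denom0.
move=> /eqP; rewrite subr_eq0 => /eqP->; apply: monos_coef.
- exact: enum_uniq.
- by move=> j; rewrite mem_enum.
- by move=> j _.
Qed.
End Expansion.

(** * Induction along the recursion, with a bound on the poles *)

Section Coefficients.
Variables (F : fieldType) (m : nat) (N : forall g n : nat, n.-tuple int -> F).
Hypothesis char0 : forall n, n.+1%:R != 0 :> F.
Hypothesis m_gt0 : (0 < m)%N.
Hypothesis hN : EO_quasi_polynomials m N.

Definition coefN g (bs : seq nat) : F :=
  (\prod_(b <- bs) b%:R) * N g (map_tuple Posz (in_tuple bs)).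

Lemma coefN_tuple g n (b : n.-tuple int) bs : tval b = map Posz bs ->
  coefN g bs = (\prod_(b <- bs) b%:R) * N g b.
Proof.
move=> E; have En : n = size bs by rewrite -(size_tuple b) E size_map.
subst n; congr (_ * N g _); apply: val_inj.
by rewrite /= E.
Qed.

Lemma natF_neq0 n : (0 < n)%N -> n%:R != 0 :> F.
Proof. by case: n => // n _; apply: char0. Qed.

Lemma prod_neq0 bs : all (leq 1) bs -> \prod_(b <- bs) b%:R != 0 :> F.
Proof.
elim: bs => [|b bs IH]; first by rewrite big_nil oner_neq0.
by rewrite /= big_cons => /andP[b0 /IH h]; rewrite mulf_neq0 ?natF_neq0.
Qed.

Lemma coefN_perm g bs bs' : (0 < size bs)%N -> (2 < g.*2 + size bs)%N ->
  perm_eq bs bs' -> coefN g bs = coefN g bs'.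
Proof.
move=> n0 st pe; have sz := perm_size pe.
have szP : size (map Posz bs') == size bs by rewrite size_map sz.
have [_ _ sym] := hN n0 (etrans (congr1 (fun x => 2 < x + _)%N (mul2n g)) st).
rewrite (@coefN_tuple g _ (Tuple szP) bs') // /coefN (perm_big _ pe) /=.
by congr (_ * _); apply: sym; rewrite /= perm_map.
Qed.

(** Independent indeterminates are generic points, so the hypothesis applies to the very element
    whose expansion defines [N]. *)
Lemma identify g n e0 (f : seq nat -> F) :
  (2 < g.*2 + n.+1)%N ->
  (forall (K : fieldType) (h : {rmorphism F -> K}) x (lz : seq (nat * K)),
    size lz = n -> all (fun x => (e0 <= x.1)%N && generic_point x.2) (x :: lz) ->
    EO_rec (g.*2 + n).+1 m g (x.2 :: map snd lz) = ev h f (x :: lz)) ->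
  forall bs, size bs = n.+1 -> all (leq 1) bs -> coefN g bs = f bs.
Proof.
move=> st repf bs szbs pos.
(* Adding the largest index places all the exponents [b - 1] below the truncation at [2e]. *)
pose e := (e0 + \max_(b <- bs) b)%N.
have [expn _ _] := hN (ltn0Sn n) (etrans (congr1 (fun x => 2 < x + _)%N (mul2n g)) st).
move: expn.
pose lz : seq (nat * {fraction {mpoly F[n.+1]}}) :=
  [seq (e, tofrac 'X_i) | i <- enum 'I_n.+1].
have -> : EO_invariant m g [seq tofrac ('X_i : {mpoly F[n.+1]}) | i <- enum 'I_n.+1]
   = ev (@FracField.tofrac {mpoly F[n.+1]} \o @mpolyC n.+1 F) f lz.
  have -> : [seq tofrac ('X_i : {mpoly F[n.+1]}) | i <- enum 'I_n.+1] = map snd lz.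
    by rewrite /lz -[RHS]map_comp; apply: eq_map.
  have szlz : size lz = n.+1 by rewrite size_map size_enum_ord.
  have glz : all (fun x => (e0 <= x.1)%N && generic_point x.2) lz.
    by apply/allP => x /mapP[i _ ->]; rewrite /= leq_addr generic_X.
  rewrite /EO_invariant size_map szlz mul2n addnS.
  move: lz szlz glz => [|x lz] // [szlz] glz.
  exact: repf.
move=> /expansion_coef H.
pose k : 'X_{1..n.+1} := [multinom (nth 0%N bs i).-1 | i < n.+1].
have kE : [seq (k i).+1 | i <- enum 'I_n.+1] = bs.
  rewrite -[RHS](mkseq_nth 0%N) szbs /mkseq -val_enum_ord -map_comp.
  apply: eq_map => i; rewrite /= mnmE prednK //.
  by apply: (allP pos); rewrite mem_nth // szbs.
have {}H := H k _; rewrite kE in H; rewrite -H => [|i]; last first.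
  rewrite mnmE /e.
  have le : (nth 0%N bs i <= \max_(b <- bs) b)%N.
    by apply: (leq_bigmax_seq (F := id)) => //; rewrite mem_nth // szbs.
  have p0 : (0 < nth 0%N bs i)%N by apply: (allP pos); rewrite mem_nth // szbs.
  by rewrite prednK // (leq_trans le) // -addnn (leq_trans (leq_addl e0 _)) ?leq_addr.
rewrite (@coefN_tuple _ _ [tuple (k i).+1%:Z | i < n.+1]); last first.
  by rewrite -kE -map_comp.
congr (_ * _); rewrite -[in LHS]kE big_map.
by rewrite big_enum.
Qed.

(** The values of [U_m] at [2] and [-2] are [m] and [m] up to sign, nonzero in [F]; hence [U_m] is
    prime to [discr]. *)
Lemma sigma_ex k : exists sigma : {poly F}, discr 'X ^+ k %| chebU 'X m * sigma - 1.
Proof.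
have cop : coprimep (discr 'X ^+ k) (chebU 'X m : {poly F}).
  rewrite coprimep_expl // (_ : discr 'X = ('X - 2%:P) * ('X - (-2)%:P)); last first.
    by rewrite discrE polyCN opprK -[4]/(2 * 2)%:R natrM !polyCM; ring.
  have hE x : (chebU 'X m : {poly F}).[x] = pev idfun x (chebU 'X m) by rewrite /pev map_poly_id.
  rewrite coprimepMl ![coprimep ('X - _) _]coprimep_sym !coprimep_XsubC !rootE !hE !pev_chebU.
  by rewrite chebUN chebU2 mulf_neq0 ?natF_neq0 ?signr_eq0.
have [[u v] /= uv] := Bezout_eq1_coprimepP _ _ cop.
exists v; rewrite -uv opprD [chebU _ _ * v]mulrC addrCA subrr addr0 dvdpNr.
exact: dvdp_mulIr.
Qed.

Definition rep_upto B k := forall Nf g n, (2 < g.*2 + n)%N -> (0 < n)%N ->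
  (g.*2 + n <= B)%N -> (g.*2 + n <= Nf)%N -> represents m coefN Nf g n k.

(** In its first argument the invariant has a numerator [Y] over [discr ^ k], so that finitely many
    indices [b] determine all the others. *)
Definition polar_upto B k := forall g bs, (2 < g.*2 + (size bs).+1)%N ->
  (g.*2 + (size bs).+1 <= B)%N -> all (leq 1) bs ->
  exists Y, forall b, (0 < b)%N -> coefN g (b :: bs) = res k (chebU 'X b * Y).

Lemma rep_mono B k k' : (k <= k')%N -> rep_upto B k -> rep_upto B k'.
Proof.
move=> le rep Nf g n st n0 leB leN K h lz sz glz; apply: rep leN _ _ _ sz _ => //.
by apply: sub_all glz => x /andP[lek ->]; rewrite andbT (leq_trans le).
Qed.

Lemma res_lift k K (p : {poly F}) : (k <= K)%N -> res k p = res K (p * discr 'X ^+ (K - k)).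
Proof. by move=> le; rewrite -[X in _ = res X _](subnKC le) res_discrX. Qed.

Lemma polar_mono B k k' : (k <= k')%N -> polar_upto B k -> polar_upto B k'.
Proof.
move=> le pol g bs st leB pos; have [Y YE] := pol g bs st leB pos.
exists (Y * discr 'X ^+ (k' - k)) => b b0.
by rewrite YE // (res_lift _ le) mulrA.
Qed.

Lemma EO_next B k sigma g n Nf : rep_upto B k ->
  discr 'X ^+ k.*2.+1 %| chebU 'X m * sigma - 1 ->
  (3 <= g.*2 + n)%N -> (g.*2 + n <= B)%N -> (g.*2 + n <= Nf)%N ->
  forall (K : fieldType) (h : {rmorphism F -> K}) x (lz : seq (nat * K)),
    size lz = n -> all (fun x => (k.*2.+1 <= x.1)%N && generic_point x.2) (x :: lz) ->
    EO_rec Nf.+1 m g (x.2 :: map snd lz) = ev h (next m coefN k sigma g) (x :: lz).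
Proof.
move=> rep sgm st leB leN K h [e0 z0] lz sz gall.
apply: (@EO_step F m coefN Nf (g.*2 + n) k sigma) => //; rewrite ?sz //.
move=> g' n' st' n0 le'; apply: rep => //; first exact: leq_trans leB.
exact: leq_trans leN.
Qed.

Lemma coefN_next B k sigma g bs : rep_upto B k ->
  discr 'X ^+ k.*2.+1 %| chebU 'X m * sigma - 1 ->
  (3 < g.*2 + size bs)%N -> (g.*2 + size bs <= B.+1)%N -> all (leq 1) bs -> (0 < size bs)%N ->
  coefN g bs = next m coefN k sigma g bs.
Proof.
case: bs => // b0 bs rep sgm st leB pos _.
apply: (@identify g (size bs) k.*2.+1) => //; first by move: st => /=; lia.
by apply: EO_next rep sgm _ _ _ => //; move: st leB => /=; lia.
Qed.

Lemma EO_next03 sigma Nf : discr 'X %| chebU 'X m * sigma - 1 -> (0 < Nf)%N ->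
  forall (K : fieldType) (h : {rmorphism F -> K}) x (lz : seq (nat * K)),
    size lz = 2%N -> all (fun x => (1 <= x.1)%N && generic_point x.2) (x :: lz) ->
    EO_rec Nf.+1 m 0 (x.2 :: map snd lz) = ev h (next03 m sigma) (x :: lz).
Proof.
move=> sgm Nf0 K h [e0 z0] [|[e1 z1] [|[e2 z2] []]] // _ gall.
by apply: (@EO_base03 F m Nf 0) => //; rewrite expr1.
Qed.

Lemma EO_next11 sigma Nf : discr 'X ^+ 3 %| chebU 'X m * sigma - 1 -> (0 < Nf)%N ->
  forall (K : fieldType) (h : {rmorphism F -> K}) x (lz : seq (nat * K)),
    size lz = 0%N -> all (fun x => (2 <= x.1)%N && generic_point x.2) (x :: lz) ->
    EO_rec Nf.+1 m 1 (x.2 :: map snd lz) = ev h (next11 m sigma) (x :: lz).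
Proof.
move=> sgm Nf0 K h [e0 z0] [|] // _ /andP[/andP[le gz] _].
by apply: (@EO_base11 F m Nf 1).
Qed.

Lemma coefN_next03 sigma bs : discr 'X %| chebU 'X m * sigma - 1 ->
  size bs = 3 -> all (leq 1) bs -> coefN 0 bs = next03 m sigma bs.
Proof.
move=> sgm sz pos; apply: (@identify 0 2 1) => //.
exact: EO_next03.
Qed.

(** The stable part requires level [k.*2.+1]; [k.*2.+2] also covers the [res 2] of the case
    [g = n = 1] when [k = 0]. For the same case [sigma] is taken modulo [discr ^ k.*2.+3], since
    [EO_next11] asks for the cube of [discr]. *)
Lemma rep_step B k : rep_upto B k -> polar_upto B k ->
  rep_upto B.+1 k.*2.+2 /\ polar_upto B.+1 k.*2.+2.
Proof.
move=> rep pol.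
have lek : (k <= k.*2.+2)%N by lia.
have [sigma sgm] := sigma_ex k.*2.+3.
have sgmD j : (j <= k.*2.+3)%N -> discr 'X ^+ j %| chebU 'X m * sigma - 1.
  by move=> le; apply: dvdp_trans sgm; apply: dvdp_exp2l.
have key g n : (2 < g.*2 + n.+1)%N -> (g.*2 + n.+1 = B.+1)%N ->
  exists f : seq nat -> F,
  [/\ forall Nf, (g.*2 + n <= Nf)%N ->
    forall (K : fieldType) (h : {rmorphism F -> K}) x (lz : seq (nat * K)),
    size lz = n -> all (fun x => (k.*2.+2 <= x.1)%N && generic_point x.2) (x :: lz) ->
    EO_rec Nf.+1 m g (x.2 :: map snd lz) = ev h f (x :: lz)
   & forall bs, size bs = n -> exists Y, forall b, f (b :: bs) = res k.*2.+2 (chebU 'X b * Y)].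
  move=> st eqB.
  have weak (K : fieldType) j (lz : seq (nat * K)) : (j <= k.*2.+2)%N ->
      all (fun x => (k.*2.+2 <= x.1)%N && generic_point x.2) lz ->
      all (fun x => (j <= x.1)%N && generic_point x.2) lz.
    by move=> le; apply: sub_all => x /andP[le' ->]; rewrite andbT (leq_trans le).
  have [big|small] := leqP 3 (g.*2 + n).
    exists (next m coefN k sigma g); split.
      move=> Nf leN K h x lz sz /(@weak _ k.*2.+1 _ (leqnSn _)) glz.
      by apply: EO_next rep (sgmD _ _) big _ leN _ _ _ _ sz glz; lia.
    move=> bs _.
    (* The powers of [discr] bring residues of different levels to the common level [k.*2.+2], as in
       [res_lift]. *)
    exists (m%:R *: (stable_part coefN k g bs * sigma * discr 'X ^+ (k.*2.+2 - k.*2.+1)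
             + bergman_part coefN k g bs * sigma * discr 'X ^+ (k.*2.+2 - k.+1))) => b.
    rewrite -scalerAr linearZ mulrDr linearD /= !mulrA.
    by rewrite -!res_lift -?mulrA //; lia.
  have [[-> ->]|[-> ->]] : (g = 0 /\ n = 2)%N \/ (g = 1 /\ n = 0)%N by lia.
    exists (next03 m sigma); split.
      move=> Nf leN K h x lz sz /(@weak _ 1%N _ isT) glz.
      by apply: EO_next03 => //; [apply: (sgmD 1%N)|lia].
    move=> bs _; exists (m%:R / 2 *: (bergman_coef2 F bs * sigma * discr 'X ^+ (k.*2.+2 - 1))) => b.
    by rewrite -scalerAr linearZ /= !mulrA -res_lift // -mulrA.
  exists (next11 m sigma); split.
    move=> Nf leN K h x lz sz /(@weak _ 2%N _ isT) glz.
    by apply: EO_next11 => //; [apply: sgmD|lia].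
  move=> [|//] _; exists (m%:R *: (sigma * discr 'X ^+ (k.*2.+2 - 2))) => b.
  by rewrite -scalerAr linearZ /= mulrA -res_lift.
have keyN g n : (2 < g.*2 + n.+1)%N -> (g.*2 + n.+1 = B.+1)%N -> 
    forall f, (forall Nf, (g.*2 + n <= Nf)%N ->
    forall (K : fieldType) (h : {rmorphism F -> K}) x (lz : seq (nat * K)),
    size lz = n -> all (fun x => (k.*2.+2 <= x.1)%N && generic_point x.2) (x :: lz) ->
    EO_rec Nf.+1 m g (x.2 :: map snd lz) = ev h f (x :: lz)) ->
    forall bs, size bs = n.+1 -> all (leq 1) bs -> coefN g bs = f bs.
  by move=> st eqB f repf; apply: (@identify g n k.*2.+2) => //; apply: repf.
split.
  move=> Nf g [//|n] st _; rewrite leq_eqVlt => /orP[/eqP eqB|]; last first.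
    rewrite ltnS => leB leN; exact: (rep_mono lek rep).
  case: Nf => [|Nf] leN; first by lia.
  have [f [repf _]] := key g n st eqB.
  move=> K h [//|x lz] [sz] glz; rewrite [map snd _]/= (repf Nf _ K h) //; last by lia.
  apply: eq_ev => bs szbs pos; apply/esym/(keyN g n) => //.
  by rewrite szbs /= sz.
move=> g bs st; rewrite leq_eqVlt => /orP[/eqP eqB|]; last first.
  by rewrite ltnS => leB; apply: (polar_mono lek pol).
move=> pos; have [f [repf polf]] := key g _ st eqB.
have [Y YE] := polf bs erefl; exists Y => b b0; rewrite -YE.
by apply: (keyN g (size bs)) => //=; rewrite b0.
Qed.

Lemma rep_exists B : exists k, rep_upto B k /\ polar_upto B k.
Proof.
elim: B => [|B [k [rep pol]]]; last by exists k.*2.+2; apply: rep_step.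
by exists 0%N; split=> [Nf g n st n0|g bs st] le; exfalso; lia.
Qed.

(** [G1] involves only the indices up to [2k], but by [Psi_repro] it is the remainder of [Y] modulo
    [discr ^ k], and [Y] gives the coefficients of all indices. *)
Lemma polar_repro B k g bs b : polar_upto B k ->
  (2 < g.*2 + (size bs).+1)%N -> (g.*2 + (size bs).+1 <= B)%N -> all (leq 1) bs ->
  (0 < b)%N -> res k (chebU 'X b * G1 coefN k g bs) = coefN g (b :: bs).
Proof.
move=> pol st le pos b0; have [Y YE] := pol g bs st le pos.
have szY : (size (Y %% discr 'X ^+ k)%R <= k.*2)%N.
  by rewrite -ltnS -(size_discrX F k) ltn_modpN0 // monic_neq0 ?discrX_monic.
have modY b' : res k (chebU 'X b' * Y) = res k (chebU 'X b' * (Y %% discr 'X ^+ k)).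
  apply: res_mod; rewrite -mulrBr dvdp_mull // {1}(divp_eq Y (discr 'X ^+ k)) addrK.
  exact: dvdp_mulIr.
have -> : G1 coefN k g bs = Y %% discr 'X ^+ k.
  rewrite -[RHS](Psi_repro szY) /G1 sum_iota1; apply: eq_bigr => i _.
  by rewrite YE // modY.
by rewrite YE // modY.
Qed.

End Coefficients.

(** * String and dilaton equations *)

Lemma sum_masks0 (V : nmodType) (bs : seq nat) (f : seq nat -> seq nat -> V) :
  \sum_(mk <- masks (size bs) | count id mk == 0%N) f (mask mk bs) (mask (map negb mk) bs)
  = f [::] bs.
Proof.
elim: bs f => [|b bs IH] f; first by rewrite big_cons big_nil addr0.
rewrite /= big_cat !big_map /= [X in X + _]big_pred0 // add0r.
exact: (IH (fun x y => f x (b :: y))).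
Qed.

Lemma sum_masks1 (V : nmodType) (bs : seq nat) (f : seq nat -> seq nat -> V) :
  \sum_(mk <- masks (size bs) | count id mk == 1%N) f (mask mk bs) (mask (map negb mk) bs)
  = \sum_(j < size bs) f [:: nth 0%N bs j] (take j bs ++ drop j.+1 bs).
Proof.
elim: bs f => [|b bs IH] f; first by rewrite big_cons big_nil big_ord0.
rewrite /= big_cat !big_map /= big_ord_recl /= drop0; congr (_ + _).
  by rewrite -(sum_masks0 bs (fun x y => f (b :: x) y)).
rewrite (IH (fun x y => f x (b :: y))); apply: eq_bigr => j _.
by [].
Qed.

Section Relations.
Variables (F : fieldType) (m : nat) (N : forall g n : nat, n.-tuple int -> F).
Hypothesis char0 : forall n, n.+1%:R != 0 :> F.
Hypothesis m_gt0 : (0 < m)%N.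
Hypothesis hN : EO_quasi_polynomials m N.
Local Notation c := (coefN N).

(** Agrees with [chebU x 0 = 0], so index [0] may appear in the combinations below, for instance as
    [m - 1]. *)
Lemma coefN0 g bs : c g (0%N :: bs) = 0.
Proof. by rewrite /coefN big_cons !mul0r. Qed.

Lemma size_G1 k g bs : (size (G1 c k g bs) <= k.*2)%N.
Proof.
apply: (leq_trans (size_sum _ _ _)); apply/bigmax_leqP_seq => b _ _.
exact: leq_trans (size_scale_leq _ _) (size_Psi _ _ _).
Qed.

Lemma size_mul_low k (p q : {poly F}) : (size p <= k.*2)%N -> (size q <= k.*2)%N ->
  (size (p * q)%R <= k.*2.*2.-1)%N.
Proof. by move=> sp sq; apply: leq_trans (size_polyMleq _ _) _; lia. Qed.

Lemma size_stable_part k g bs : (size (stable_part c k g bs) <= k.*2.*2.-1)%N.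
Proof.
apply: leq_trans (size_polyD _ _) _; rewrite geq_max; apply/andP; split.
  case: g => [|g]; first by rewrite size_poly0.
  apply: leq_trans (size_sum _ _ _) _; apply/bigmax_leqP_seq => b _ _.
  apply: leq_trans (size_sum _ _ _) _; apply/bigmax_leqP_seq => b' _ _.
  apply: leq_trans (size_scale_leq _ _) _.
  exact: size_mul_low (size_Psi _ _ _) (size_Psi _ _ _).
apply: leq_trans (size_sum _ _ _) _; apply/bigmax_leqP => g1 _.
apply: leq_trans (size_sum _ _ _) _; apply/bigmax_leqP_seq => mk _ _.
exact: size_mul_low (size_G1 _ _ _) (size_G1 _ _ _).
Qed.

(* The string equations all come from combinations of [chebU b] that are
   multiples of [chebU m]: this cancels the denominator of the recursion
   kernel, and the stable part then has no residue at infinity. *)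
Lemma string_key B k (sigma w : {poly F}) g bs (lam : seq (F * nat)) :
  rep_upto m N B k -> discr 'X ^+ k.*2.+1 %| chebU 'X m * sigma - 1 ->
  (3 <= g.*2 + size bs)%N -> (g.*2 + size bs <= B)%N -> all (leq 1) bs ->
  (size w <= 3)%N -> \sum_(x <- lam) x.1 *: chebU 'X x.2 = w * chebU 'X m ->
  \sum_(x <- lam) x.1 * c g (x.2 :: bs) = m%:R * res k.+1 (w * bergman_part c k g bs).
Proof.
move=> rep sgm st le pos szw lamE.
have sgm1 : discr 'X ^+ k.+1 %| chebU 'X m * sigma - 1.
  by apply: dvdp_trans sgm; apply: dvdp_exp2l; lia.
transitivity (m%:R * (res k.*2.+1 ((w * chebU 'X m) * (stable_part c k g bs * sigma))
   + res k.+1 ((w * chebU 'X m) * (bergman_part c k g bs * sigma)))).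
  rewrite -lamE [X in res k.*2.+1 X]mulr_suml [X in res k.+1 X]mulr_suml.
  rewrite !linear_sum -big_split mulr_sumr /=.
  apply: eq_bigr => x _.
  have [x0|x0] := posnP x.2.
    by rewrite x0 coefN0 scaler0 !mul0r !linear0 addr0 !mulr0.
  rewrite (coefN_next char0 m_gt0 hN rep sgm) //=; last by rewrite x0.
  - by rewrite -!scalerAl !linearZ /=; ring.
  - by lia.
  - by lia.
have canc j p : discr 'X ^+ j %| chebU 'X m * sigma - 1 ->
    res j ((w * chebU 'X m) * (p * sigma)) = res j (w * p).
  move=> dv; apply: res_mod.
  have -> : w * chebU 'X m * (p * sigma) - w * p = w * p * (chebU 'X m * sigma - 1) by ring.
  exact: dvdp_mull.
rewrite !canc //; have [->|s0] := eqVneq (stable_part c k g bs) 0.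
  by rewrite mulr0 linear0 add0r.
(* The size is at most [3 + (4k - 1) - 1], below the threshold [2 (2k + 1)]: this is why [w] may
   have degree two but not more. *)
rewrite res_small ?add0r //; apply: leq_ltn_trans (size_polyMleq _ _) _.
have := size_stable_part k g bs; move: szw s0; rewrite -size_poly_gt0.
by move: (size w) (size _) => a b; lia.
Qed.

Section Tail.
Variables (B k g : nat) (bs : seq nat).
Hypothesis pol : polar_upto N B k.
Hypothesis st : (2 < g.*2 + (size bs).+1)%N.
Hypothesis le : (g.*2 + (size bs).+1 <= B)%N.
Hypothesis pos : all (leq 1) bs.
Local Notation G := (G1 c k g bs).

Lemma res_chebU b : res k (chebU 'X b * G) = c g (b :: bs).
Proof.
have [->|b0] := posnP b; first by rewrite mul0r linear0 coefN0.
exact: polar_repro pol st le pos b0.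
Qed.

(** [C_(b+2) - C_b = discr * U_(b+1)] contributes one new term; [C_0] and [C_1] have too small a
    degree to contribute. *)
Lemma res_chebC b :
  res k.+1 (chebC 'X b * G)
  = \sum_(1 <= i < b.+1 | odd i != odd b) c g (i :: bs).
Proof.
have szG := size_G1 k g bs.
elim/nat_ind2: b => [||b IH1 IH2].
- have -> : chebC 'X 0 * G = 2 *: G by rewrite -mul_polyC polyC_natr.
  rewrite big_geq // res_small //; apply: leq_ltn_trans (size_scale_leq _ _) _; lia.
- rewrite big_mkcond big_nat1 /= res_small // mulrC.
  by have [->|G0] := eqVneq G 0; rewrite ?mul0r ?size_poly0 // size_mulX // doubleS !ltnS.
have -> : chebC 'X b.+2 = chebC 'X b + chebU 'X b.+1 * discr 'X :> {poly F}.
  by rewrite mulrC -chebC_sub addrC subrK.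
rewrite mulrDl linearD /= IH1 mulrAC res_discr res_chebU //.
rewrite [RHS]big_mkcond big_nat_recr //= big_nat_recr //= -big_mkcond /= negbK.
by case: (odd b); rewrite /= addr0.
Qed.

(** [s C_b = C_(b+1) + C_(b-1)], and by [res_chebC] the two sums over indices of the parity of [b]
    differ by the term of index [b]. *)
Lemma res_XchebC b : (0 < b)%N ->
  res k.+1 ('X * (chebC 'X b * G))
  = 2 * (\sum_(1 <= i < b.+1 | odd i == odd b) c g (i :: bs)) - c g (b :: bs).
Proof.
case: b => // b _.
have E : res k.+1 (chebC 'X b.+2 * G)
    = res k.+1 (chebC 'X b * G) + c g (b.+1 :: bs).
  rewrite -res_chebU -[X in _ + X]res_discr.
  have -> : chebC 'X b.+2 * G = chebC 'X b * G + chebU 'X b.+1 * G * discr 'X.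
    by rewrite mulrAC -mulrDl [_ * discr _]mulrC -chebC_sub addrC subrK.
  by rewrite linearD.
have -> : 'X * (chebC 'X b.+1 * G) = chebC 'X b.+2 * G + chebC 'X b * G.
  by rewrite chebCSS; ring.
rewrite linearD /= E.
have -> : \sum_(1 <= i < b.+2 | odd i == odd b.+1) c g (i :: bs)
   = res k.+1 (chebC 'X b.+2 * G).
  rewrite res_chebC [RHS]big_mkcond big_nat_recr //= negbK.
  case: (odd b); rewrite /= addr0 -big_mkcond; apply: eq_bigl => i; by case: (odd i).
by rewrite E; ring.
Qed.

Lemma res_discr_chebC b : (0 < b)%N ->
  res k.+1 (discr 'X * (chebC 'X b * G)) = c g (b.+1 :: bs) - c g (b.-1 :: bs).
Proof.
case: b => // b _.
rewrite mulrC res_discr chebC_U mulrBl -(res_chebU b.+2) -(res_chebU b).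
exact: linearB.
Qed.

End Tail.

Lemma bergman_partE k g bs : bergman_part c k g bs
  = \sum_(j < size bs) (nth 0%N bs j)%:R *:
      (chebC 'X (nth 0%N bs j) * G1 c k g (take j bs ++ drop j.+1 bs)).
Proof.
rewrite /bergman_part (sum_masks1 bs (fun x y => bergman_coef F x * G1 c k g y)).
by apply: eq_bigr => j _; rewrite /= scalerAl.
Qed.

Section String.
Variables (g : nat) (bs : seq nat).
Hypothesis st : (2 < g.*2 + size bs)%N.
Hypothesis pos : all (leq 1) bs.
Local Notation rest j := (take j bs ++ drop j.+1 bs).

Lemma size_rest j : (j < size bs)%N -> (size (rest j)).+1 = size bs.
Proof. by move=> lt; rewrite size_cat size_take size_drop lt; lia. Qed.

Lemma pos_rest j : all (leq 1) (rest j).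
Proof.
rewrite all_cat; apply/andP; split; apply/allP => x.
  by move=> /mem_take; apply/allP.
by move=> /mem_drop; apply/allP.
Qed.

(** Reduces a string equation to the residue of [w * C_b] against one stable factor, whose value
    [rhs] must not depend on the level [k]. *)
Lemma string_equation (lam : seq (F * nat)) (w : {poly F}) (rhs : nat -> nat -> seq nat -> F) :
  (size w <= 3)%N -> \sum_(x <- lam) x.1 *: chebU 'X x.2 = w * chebU 'X m ->
  (forall B k b bs', polar_upto N B k -> (2 < g.*2 + (size bs').+1)%N ->
    (g.*2 + (size bs').+1 <= B)%N -> all (leq 1) bs' -> (0 < b)%N ->
    res k.+1 (w * (chebC 'X b * G1 c k g bs')) = rhs g b bs') ->
  \sum_(x <- lam) x.1 * c g (x.2 :: bs)
  = m%:R * \sum_(j < size bs) (nth 0%N bs j)%:R * rhs g (nth 0%N bs j) (rest j).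
Proof.
move=> szw lamE rhsE.
have [k [rep pol]] := rep_exists char0 m_gt0 hN (g.*2 + size bs).
have [sigma sgm] := sigma_ex char0 m_gt0 k.*2.+1.
rewrite (string_key rep sgm st (leqnn _) pos szw lamE) bergman_partE; congr (_ * _).
rewrite mulr_sumr linear_sum; apply: eq_bigr => j _ /=.
rewrite -scalerAr linearZ /=; congr (_ * _).
have sz := size_rest (ltn_ord j).
apply: (rhsE (g.*2 + size bs)%N) => //; rewrite ?sz ?pos_rest //.
by apply: (allP pos); rewrite mem_nth.
Qed.

Lemma string0 : c g (m :: bs) = m%:R * \sum_(j < size bs) (nth 0%N bs j)%:R *
  \sum_(1 <= i < (nth 0%N bs j).+1 | odd i != odd (nth 0%N bs j)) c g (i :: rest j).
Proof.
have := @string_equation [:: (1, m)] 1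
  (fun g b bs' => \sum_(1 <= i < b.+1 | odd i != odd b) c g (i :: bs')).
rewrite !big_seq1 /= mul1r scale1r mul1r size_poly1; apply => //.
by move=> B k b bs' pol st' le' pos' _; rewrite mul1r; apply: res_chebC pol st' le' pos' _.
Qed.

Lemma string1 : c g (m.+1 :: bs) + c g (m.-1 :: bs)
  = m%:R * \sum_(j < size bs) (nth 0%N bs j)%:R *
  (2 * (\sum_(1 <= i < (nth 0%N bs j).+1 | odd i == odd (nth 0%N bs j)) c g (i :: rest j))
   - c g (nth 0%N bs j :: rest j)).
Proof.
have := @string_equation [:: (1, m.+1); (1, m.-1)] 'X
  (fun g b bs' => 2 * (\sum_(1 <= i < b.+1 | odd i == odd b) c g (i :: bs')) - c g (b :: bs')).
rewrite !big_cons !big_nil /= !mul1r !scale1r !addr0 size_polyX; apply => //.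
  by case: (m) m_gt0 => // m' _; rewrite chebUSS subrK.
by move=> B k b bs' pol st' le' pos' b0; apply: (res_XchebC pol st' le' pos').
Qed.

Lemma string2 (lam : seq (F * nat)) :
  \sum_(x <- lam) x.1 *: chebU 'X x.2 = discr 'X * chebU 'X m :> {poly F} ->
  \sum_(x <- lam) x.1 * c g (x.2 :: bs)
  = m%:R * \sum_(j < size bs) (nth 0%N bs j)%:R *
  (c g ((nth 0%N bs j).+1 :: rest j) - c g ((nth 0%N bs j).-1 :: rest j)).
Proof.
move=> lamE.
apply: (@string_equation lam (discr 'X)
  (fun g b bs' => c g (b.+1 :: bs') - c g (b.-1 :: bs'))) => //.
  by rewrite size_discr.
by move=> B k b bs' pol st' le' pos' b0; apply: (res_discr_chebC pol st' le' pos').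
Qed.

End String.

(** A congruence instead of an equality makes room for [m = 1], where [C_2 - C_0] would need the
    index [0], and [insert_at] divides by the indices. *)
Definition dilaton_weights L (lam : seq (F * nat)) :=
  all (fun x => leq 1 x.2) lam /\
  discr 'X ^+ L %| \sum_(x <- lam) x.1 *: chebC 'X x.2 - discr 'X * chebU 'X m.

(** Dividing by the index removes the factor [b] of [coefN], so the weights act on [N] itself.
    Values in a module allow the insertion into the polynomials [G1] and [G2] as well. *)
Definition insert_at (lam : seq (F * nat)) (V : lmodType F) (f : nat -> V) : V :=
  \sum_(x <- lam) (x.1 / x.2%:R) *: f x.2.

(** The range includes [g = 0] with two points, where the right side is zero; the induction meets
    this case inside the stable part. *)
Definition dilaton_upto B (lam : seq (F * nat)) := forall g bs,
  (0 < size bs)%N -> (2 <= g.*2 + size bs)%N -> (g.*2 + size bs <= B)%N ->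
  all (leq 1) bs ->
  insert_at lam (fun b => c g (b :: bs) : F^o) = m%:R * (g.*2 + size bs - 2)%:R * c g bs.

Lemma coefN_swap g b b0 bs : (2 < g.*2 + (size bs).+2)%N ->
  c g [:: b, b0 & bs] = c g [:: b0, b & bs].
Proof.
move=> st; apply: (coefN_perm hN) => //.
by rewrite (perm_catCA [:: b] [:: b0] bs).
Qed.

Lemma coefN_swap3 g b b' b0 bs : (2 < g.*2 + (size bs).+3)%N ->
  c g [:: b, b', b0 & bs] = c g [:: b0, b, b' & bs].
Proof.
move=> st; apply: (coefN_perm hN) => //.
by rewrite (perm_catCA [:: b; b'] [:: b0] bs).
Qed.

Section DilatonStep.
Variables (B k : nat) (lam : seq (F * nat)).
Hypothesis dil : dilaton_upto B lam.

Lemma insert_G1 g bs : (2 <= g.*2 + (size bs).+1)%N -> (g.*2 + (size bs).+1 <= B)%N ->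
  all (leq 1) bs ->
  insert_at lam (fun b => G1 c k g (b :: bs))
  = (m%:R * (g.*2 + (size bs).+1 - 2)%:R) *: G1 c k g bs.
Proof.
move=> st le pos; rewrite /insert_at /G1.
under eq_bigr do rewrite scaler_sumr.
rewrite exchange_big scaler_sumr big_seq [RHS]big_seq; apply: eq_bigr => b /=.
rewrite mem_iota => /andP[b0 _].
have := @dil g (b :: bs) isT st le; rewrite /= b0 => /(_ pos).
rewrite /insert_at => E; rewrite scalerA -E scaler_suml; apply: eq_bigr => x _.
by rewrite scalerA coefN_swap //; lia.
Qed.

Lemma insert_G2 g bs : (2 <= g.*2 + (size bs).+2)%N -> (g.*2 + (size bs).+2 <= B)%N ->
  all (leq 1) bs ->
  insert_at lam (fun b => G2 c k g (b :: bs))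
  = (m%:R * (g.*2 + (size bs).+2 - 2)%:R) *: G2 c k g bs.
Proof.
move=> st le pos; rewrite /insert_at /G2.
under eq_bigr do rewrite scaler_sumr.
rewrite exchange_big scaler_sumr big_seq [RHS]big_seq; apply: eq_bigr => b /=.
rewrite mem_iota => /andP[b0 _].
under eq_bigr do rewrite scaler_sumr.
rewrite exchange_big scaler_sumr big_seq [RHS]big_seq; apply: eq_bigr => b' /=.
rewrite mem_iota => /andP[b'0 _].
have := @dil g [:: b, b' & bs] isT st le; rewrite /= b0 b'0 => /(_ pos).
rewrite /insert_at => E; rewrite scalerA -E scaler_suml; apply: eq_bigr => x _.
by rewrite scalerA coefN_swap3 //; lia.
Qed.

(** Leibniz rule: with [i + j = size bs] the factors of the two parts add up, [(2 g1 + i + 1 - 2) +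
    (2 g2 + j + 1 - 2) = 2g + size bs - 2], the same for every splitting. *)
Lemma insert_stable g bs : (2 <= g.*2 + size bs)%N -> (g.*2 + size bs <= B)%N ->
  all (leq 1) bs ->
  insert_at lam (fun b => stable_part c k g (b :: bs))
  = (m%:R * (g.*2 + size bs - 2)%:R) *: stable_part c k g bs.
Proof.
move=> st le pos; rewrite /stable_part scalerDr.
have pm mk : all (leq 1) (mask mk bs) by apply/allP => x /mem_mask; apply/allP.
transitivity (insert_at lam (fun b => if g is g'.+1 then G2 c k g' (b :: bs) else 0)
  + insert_at lam (fun b => \sum_(g1 < g.+1) \sum_(mk <- masks (size (b :: bs)) | stable2 g1 (g - g1) mk)
      G1 c k g1 (mask mk (b :: bs)) * G1 c k (g - g1) (mask (map negb mk) (b :: bs)))).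
  by rewrite /insert_at -big_split; apply: eq_bigr => x _; rewrite scalerDr.
congr (_ + _).
  case: g st le => [|g'] st le.
    by rewrite scaler0 /insert_at big1 // => x _; rewrite scaler0.
  by rewrite insert_G2 //; [congr (_ * _%:R *: _)| |]; lia.
rewrite /insert_at; under eq_bigr do rewrite scaler_sumr.
rewrite exchange_big scaler_sumr; apply: eq_bigr => g1 _.
transitivity (\sum_(mk <- masks (size bs))
   ((if stable2 g1 (g - g1) (true :: mk) then
      insert_at lam (fun b => G1 c k g1 (b :: mask mk bs)) * G1 c k (g - g1) (mask (map negb mk) bs)
    else 0) + (if stable2 g1 (g - g1) (false :: mk) then
      G1 c k g1 (mask mk bs) * insert_at lam (fun b => G1 c k (g - g1) (b :: mask (map negb mk) bs))
    else 0))).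
  rewrite big_split /= -!big_mkcond /=.
  under eq_bigr do rewrite big_cat !big_map /= scalerDr.
  rewrite big_split /=; congr (_ + _).
    under eq_bigr do rewrite scaler_sumr.
    rewrite exchange_big /=; apply: eq_bigr => mk _.
    by rewrite /insert_at mulr_suml; apply: eq_bigr => x _; rewrite scalerAl.
  under eq_bigr do rewrite scaler_sumr.
  rewrite exchange_big /=; apply: eq_bigr => mk _.
  by rewrite /insert_at mulr_sumr; apply: eq_bigr => x _; rewrite scalerAr.
rewrite scaler_sumr [RHS]big_mkcond big_seq_cond [RHS]big_seq_cond.
apply: eq_bigr => mk; rewrite mem_masks andbT => /eqP szmk.
have cc : (count id mk + count negb mk = size bs)%N by rewrite -szmk -(count_predC id mk).
have s1 : size (mask mk bs) = count id mk by rewrite size_mask.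
have s2 : size (mask (map negb mk) bs) = count negb mk by rewrite size_mask ?size_map // count_map.
have leg : (g1 <= g)%N by rewrite -ltnS.
have I1 : stable2 g1 (g - g1) (true :: mk) ->
   insert_at lam (fun b => G1 c k g1 (b :: mask mk bs))
   = (m%:R * (g1.*2 + (count id mk).+1 - 2)%:R) *: G1 c k g1 (mask mk bs).
  by rewrite /stable2 /= => /andP[h1 h2]; rewrite insert_G1 ?s1 //; lia.
have I2 : stable2 g1 (g - g1) (false :: mk) ->
   insert_at lam (fun b => G1 c k (g - g1) (b :: mask (map negb mk) bs))
   = (m%:R * ((g - g1).*2 + (count negb mk).+1 - 2)%:R) *: G1 c k (g - g1) (mask (map negb mk) bs).
  by rewrite /stable2 /= => /andP[h1 h2]; rewrite insert_G1 ?s2 //; lia.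
move: I1 I2; rewrite /stable2 /= add1n add0n.
move: (G1 c k g1 (mask mk bs)) (G1 c k (g - g1) (mask (map negb mk) bs)) => X Y.
(* A factor that becomes stable only through the insertion has genus [0] and two points before it,
   and its coefficient is [0]. *)
case: ifP => h1; case: ifP => h2 I1 I2.
- rewrite I1 // I2 // -scalerAl -scalerAr -scalerDl -mulrDr -natrD.
  case: ifP => h3; first by congr (_ * _%:R *: _); lia.
  exfalso; lia.
- rewrite I1 // addr0 -scalerAl; case: ifP => h3; first by exfalso; lia.
  by rewrite (_ : _ - 2 = 0)%N ?mulr0 ?scale0r //; lia.
- rewrite I2 // add0r -scalerAr; case: ifP => h3; first by exfalso; lia.
  by rewrite (_ : _ - 2 = 0)%N ?mulr0 ?scale0r //; lia.
case: ifP => h3; first by exfalso; lia.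
by rewrite addr0.
Qed.

(** The inserted point is either the argument of [omega^0_2], which gives the first term, or an
    argument of the stable factor. *)
Lemma insert_bergman g bs : (2 <= g.*2 + size bs)%N -> (g.*2 + size bs <= B)%N ->
  all (leq 1) bs -> all (fun x => leq 1 x.2) lam ->
  insert_at lam (fun b => bergman_part c k g (b :: bs))
  = (\sum_(x <- lam) x.1 *: chebC 'X x.2) * G1 c k g bs
    + (m%:R * (g.*2 + size bs - 2)%:R) *: bergman_part c k g bs.
Proof.
move=> st le pos lpos.
have pm mk : all (leq 1) (mask mk bs) by apply/allP => x /mem_mask; apply/allP.
rewrite /insert_at /bergman_part.
under eq_bigr do rewrite /= big_cat !big_map /= scalerDr.
rewrite big_split /=; congr (_ + _).
  rewrite mulr_suml big_seq [RHS]big_seq; apply: eq_bigr => x xin.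
  rewrite (sum_masks0 bs (fun y y' => bergman_coef F (x.2 :: y) * G1 c k g y')) /=.
  rewrite -!scalerAl scalerA mulfVK // natF_neq0 //.
  exact: (allP lpos).
under eq_bigr do rewrite scaler_sumr.
rewrite exchange_big scaler_sumr big_seq_cond [RHS]big_seq_cond; apply: eq_bigr => mk.
rewrite mem_masks => /andP[/eqP szmk c1] /=.
have cc : (count id mk + count negb mk = size bs)%N by rewrite -szmk -(count_predC id mk).
have s2 : size (mask (map negb mk) bs) = count negb mk by rewrite size_mask ?size_map // count_map.
transitivity (bergman_coef F (mask mk bs) * insert_at lam (fun b => G1 c k g (b :: mask (map negb mk) bs))).
  by rewrite /insert_at mulr_sumr; apply: eq_bigr => x _; rewrite scalerAr.
rewrite insert_G1 ?s2 //; [|lia..].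
by rewrite -scalerAr; congr (_ * _%:R *: _); lia.
Qed.
End DilatonStep.

Lemma weights_le L L' lam : (L <= L')%N -> dilaton_weights L' lam -> dilaton_weights L lam.
Proof. by move=> le [pos dv]; split=> //; apply: dvdp_trans dv; apply: dvdp_exp2l. Qed.

(** With the recursion run on [b1], the weighted sum of [chebC] is a factor divisible by [discr],
    which [res 1] annihilates. *)
Lemma dilaton_base lam b1 b2 : dilaton_weights 1 lam -> (0 < b1)%N -> (0 < b2)%N ->
  insert_at lam (fun b => c 0 [:: b; b1; b2] : F^o) = 0.
Proof.
move=> [lpos dv] b10 b20.
have [sigma sgm] := sigma_ex char0 m_gt0 1; rewrite expr1 in sgm.
transitivity (m%:R / 2 * res 1 (chebU 'X b1 * ((\sum_(x <- lam) x.1 *: chebC 'X x.2)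
    * bergman_coef F [:: b2] * sigma))).
  rewrite mulr_suml mulr_suml mulr_sumr linear_sum mulr_sumr /insert_at.
  rewrite big_seq [RHS]big_seq; apply: eq_bigr => x xin.
  have x0 : (0 < x.2)%N by apply: (allP lpos).
  rewrite coefN_swap // (coefN_next03 char0 m_gt0 hN sgm) //=; last by rewrite x0 b10 b20.
  rewrite /bergman_coef2 /= -!scalerAl -!scalerAr -!scalerAl -!scalerAr !linearZ /=.
  rewrite /GRing.scale /=; congr (_ * _).
  have := natF_neq0 char0 x0; move: (x.2%:R) (b2%:R) (res _ _) => u v w u0.
  by field.
rewrite res_dvd ?mulr0 // expr1 dvdp_mull // -mulrA dvdp_mulr //.
set A := \sum_(x <- lam) _ in dv *; rewrite expr1 in dv.
by rewrite -(subrK (discr 'X * chebU 'X m) A) dvdp_add // dvdp_mulr.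
Qed.

(** For the list [b1 :: bs], with the recursion run on [b1], insertions into stable factors give
    [m (2g + size bs - 2)], and the [omega^0_2] factor supplies the one missing [m]. *)
Lemma dilaton_exists B : exists L, forall lam, dilaton_weights L lam -> dilaton_upto B lam.
Proof.
elim: B => [|B [L IH]]; first by exists 0%N => lam _ g bs n0 h1 h2; exfalso; lia.
have [k [rep pol]] := rep_exists char0 m_gt0 hN B.+1.
have [sigma sgm] := sigma_ex char0 m_gt0 k.*2.+1.
exists (maxn L k.+1) => lam wlam g bs n0 st; rewrite leq_eqVlt => /orP[/eqP eqB|]; last first.
  by rewrite ltnS => le pos; apply: IH => //; apply: weights_le wlam; apply: leq_maxl.
have dil := IH lam (weights_le (leq_maxl _ _) wlam).
have [lpos dv] := weights_le (leq_maxr _ _) wlam.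
case: bs n0 st eqB => // b1 bs _ /= st eqB /andP[b10 pos].
have [small|big] := leqP (g.*2 + size bs) 1.
  have [g0 sz] : g = 0%N /\ size bs = 1%N by lia.
  subst g; case: bs sz pos {eqB st small} => [|b2 []] //= _ /andP[b20 _].
  rewrite mulr0 mul0r dilaton_base //.
  by apply: weights_le wlam; rewrite leq_max orbT.
set D := ((g.*2 + size bs - 2)%:R : F).
have sgm1 : discr 'X ^+ k.+1 %| chebU 'X m * sigma - 1.
  by apply: dvdp_trans sgm; apply: dvdp_exp2l; lia.
pose R0 (St Be : {poly F}) := m%:R * (res k.*2.+1 (chebU 'X b1 * (St * sigma))
   + res k.+1 (chebU 'X b1 * (Be * sigma))).
transitivity (R0 (insert_at lam (fun b => stable_part c k g (b :: bs)))
                 (insert_at lam (fun b => bergman_part c k g (b :: bs)))).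
  rewrite /R0 /insert_at !(mulr_suml, mulr_sumr) !linear_sum -big_split mulr_sumr /=.
  rewrite big_seq [RHS]big_seq; apply: eq_bigr => x xin.
  have x0 : (0 < x.2)%N by apply: (allP lpos).
  rewrite coefN_swap; last by lia.
  rewrite (coefN_next char0 m_gt0 hN rep sgm) //=; [|lia|lia|by rewrite b10 x0].
  rewrite -!scalerAl -!scalerAr !linearZ /= /GRing.scale /=; ring.
rewrite (insert_stable k dil) //; last by lia.
rewrite (insert_bergman k dil) //; last by lia.
have -> : R0 ((m%:R * D) *: stable_part c k g bs)
     ((\sum_(x <- lam) x.1 *: chebC 'X x.2) * G1 c k g bs + (m%:R * D) *: bergman_part c k g bs)
  = m%:R * D * R0 (stable_part c k g bs) (bergman_part c k g bs)
    + m%:R * res k.+1 (chebU 'X b1 * ((\sum_(x <- lam) x.1 *: chebC 'X x.2) * G1 c k g bs * sigma)).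
  rewrite /R0; move: (stable_part c k g bs) (bergman_part c k g bs) (G1 c k g bs) => St Be G.
  move: (\sum_(x <- lam) _) => A; rewrite mulrDl [chebU _ _ * (_ + _)]mulrDr.
  rewrite linearD /= -!scalerAl -!scalerAr !linearZ /=; ring.
(* [sigma] cancels [chebU 'X m]; the remaining [discr] lowers the level from [k.+1] to [k], where
   [polar_repro] applies. *)
have -> : res k.+1 (chebU 'X b1 * ((\sum_(x <- lam) x.1 *: chebC 'X x.2) * G1 c k g bs * sigma))
   = c g (b1 :: bs).
  have <- : res k (chebU 'X b1 * G1 c k g bs) = c g (b1 :: bs).
    by apply: (polar_repro pol _ _ pos b10); lia.
  rewrite -[RHS]res_discr.
  apply: res_mod; set A := \sum_(x <- lam) _ in dv *.
  have -> : chebU 'X b1 * (A * G1 c k g bs * sigma) - chebU 'X b1 * G1 c k g bs * discr 'X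
    = chebU 'X b1 * G1 c k g bs * sigma * (A - discr 'X * chebU 'X m)
      + chebU 'X b1 * G1 c k g bs * discr 'X * (chebU 'X m * sigma - 1) by ring.
  by rewrite dvdp_add // dvdp_mull.
(* [R0] is the recursion only from [2g + size bs >= 3] on; for the two initial invariants [D] is
   zero. *)
have E : D * R0 (stable_part c k g bs) (bergman_part c k g bs) = D * c g (b1 :: bs).
  have [big3|small] := leqP 3 (g.*2 + size bs).
    by rewrite [in RHS](coefN_next char0 m_gt0 hN rep sgm) //=; [lia|lia|rewrite b10].
  by rewrite /D (_ : _ - 2 = 0)%N ?mul0r //; lia.
rewrite -mulrA E (_ : g.*2 + (size bs).+1 - 2 = (g.*2 + size bs - 2).+1)%N; last by lia.
by rewrite -[_.+1]addn1 natrD -/D; ring.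
Qed.
End Relations.

(** * Finite differences of step two *)

Import Order.TTheory Num.Theory.

(** Step two keeps the argument in one parity class, on which [N] is a polynomial. *)
Definition diff2 (V : zmodType) (f : nat -> V) : nat -> V := fun i => f i - f i.+2.

(** All terms but the first have a positive shift, so a vanishing difference at [0] expresses the
    value at [0] by values at positive arguments. *)
Lemma diff2_weights (F : fieldType) M : exists lam : seq (F * nat),
  all (fun x => leq 1 x.2) lam /\
  forall (V : lmodType F) (f : nat -> V) i,
    iter M (@diff2 V) f i = f i + \sum_(x <- lam) x.1 *: f (i + x.2)%N.
Proof.
elim: M => [|M [lam [pos E]]].
  by exists [::]; split=> // V f i; rewrite big_nil addr0.
exists (lam ++ (-1, 2%N) :: [seq (- x.1, x.2.+2) | x <- lam]); split.
  by rewrite all_cat pos /= all_map; apply: sub_all pos => x.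
move=> V f i; rewrite iterS /diff2 !E big_cat big_cons big_map /= opprD addrACA addrA.
rewrite scaleN1r addn2 -!addrA; congr (_ + _); rewrite addrCA; congr (_ + (_ + _)).
by rewrite -sumrN; apply: eq_bigr => x _; rewrite scaleNr !addnS !addSn.
Qed.

(** Two differences multiply by [z^-2 - 2 + z^2 = (z - 1/z)^2] and shift the index by two. *)
Lemma diff2_chebC (F : fieldType) L i :
  iter L.*2 (@diff2 {poly F}) (chebC 'X) i
  = discr 'X ^+ L * chebC 'X (i + L.*2)%N.
Proof.
elim: L i => [|L IH] i; first by rewrite mul1r addn0.
rewrite doubleS !iterS /diff2 !IH !addSn !addnS exprS /discr !chebCSS; ring.
Qed.

(** The leading terms of a polynomial and of its translate by [2] cancel, so each difference lowers
    the degree. *)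
Lemma diff2_poly (F : fieldType) (p : {poly F}) (f : nat -> F) M :
  (forall i, ~~ odd i -> f i = p.[i%:R]) -> (size p <= M)%N ->
  forall i, ~~ odd i -> iter M (@diff2 F) f i = 0.
Proof.
move=> fE szp.
suff H : forall M, exists q : {poly F}, (size q <= size p - M)%N /\
    forall i, ~~ odd i -> iter M (@diff2 F) f i = q.[i%:R].
  have [q [szq qE]] := H M; move=> i ei; rewrite qE //.
  by move: szq; rewrite (eqP (szp : (_ - _ == 0)%N)) leqn0 size_poly_eq0 => /eqP->; rewrite horner0.
elim=> [|M' [q [szq qE]]]; first by exists p; rewrite subn0.
exists (q - (q \Po ('X + 2%:P))); split; last first.
  move=> i ei; rewrite iterS /diff2 !qE ?negbK // hornerD hornerN horner_comp.
  by rewrite hornerD hornerX hornerC -natrD addn2.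
rewrite subnS; apply: leq_trans (_ : ((size q).-1 <= _)%N); last first.
  by rewrite -!subn1 leq_sub2r.
have [->|q0] := eqVneq q 0; first by rewrite comp_poly0 subr0 size_poly0.
have szc : size (q \Po ('X + 2%:P)) = size q by rewrite size_comp_poly2 // size_XaddC.
have lc : lead_coef (q \Po ('X + 2%:P)) = lead_coef q.
  by rewrite lead_coef_comp ?size_XaddC // lead_coefXaddC expr1n mulr1.
apply/leq_sizeP => j; rewrite -ltnS prednK ?size_poly_gt0 // => lej.
rewrite coefB; move: lej; rewrite leq_eqVlt => /orP[/eqP ej|ltj].
  move: lc; rewrite !lead_coefE szc ej /= => ->; exact: subrr.
by rewrite !nth_default ?subrr ?szc.
Qed.

(** * From coefficients back to the quasi-polynomials *)

Section Translation.
Variables (F : fieldType) (m : nat) (N : forall g n : nat, n.-tuple int -> F).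
Hypothesis char0 : forall n, n.+1%:R != 0 :> F.
Hypothesis m_gt0 : (0 < m)%N.
Hypothesis hN : EO_quasi_polynomials m N.
Variables (g n : nat) (b : n.-tuple int).
Hypothesis n_gt0 : (0 < n)%N.
Hypothesis st : (2 < g.*2 + n)%N.
Hypothesis b_gt0 : forall j, (0 < tnth b j)%R.
Local Notation bs := (map absz b).
Local Notation P := (\prod_(i <- map absz b) i%:R : F).
Local Notation c := (coefN N).
Local Notation Nc x := (N g (cons_tuple x b)).

Lemma Posz_bs : tval b = map Posz bs.
Proof.
rewrite -map_comp -[LHS]map_id; apply/eq_in_map => x /tnthP[j ->] /=.
by rewrite gtz0_abs.
Qed.

Lemma bs_gt0 : all (leq 1) bs.
Proof.
apply/allP => y /mapP[x /tnthP[j ->] ->].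
by rewrite absz_gt0; rewrite gt_eqF.
Qed.

Lemma size_bs : size bs = n. Proof. by rewrite size_map size_tuple. Qed.

Lemma P_neq0 : P != 0. Proof. exact: (prod_neq0 char0 bs_gt0). Qed.

(** The parity class and the squares depend only on absolute values. *)
Lemma N_abs g' n' (x y : n'.-tuple int) : (0 < n')%N -> (2 < g'.*2 + n')%N ->
  (forall i, `|tnth x i| = `|tnth y i|)%N -> N g' x = N g' y.
Proof.
move=> n'0 st' E.
have [_ quasi _] := hN n'0 (etrans (congr1 (fun z => 2 < z + _)%N (mul2n g')) st').
have [p pE] := quasi [tuple odd `|tnth x i|%N | i < n'].
rewrite !pE => [|i|i]; try by rewrite tnth_mktuple ?E.
apply: meval_eq => i.
have : tnth x i ^+ 2 = tnth y i ^+ 2.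
  by rewrite -[LHS]real_normK ?num_real // -[RHS]real_normK ?num_real // -!abszE E.
by rewrite -!rmorphXn => /= ->.
Qed.

Lemma coef_cons k : c g (k :: bs) = P * (k%:R * Nc k%:Z).
Proof.
rewrite (@coefN_tuple _ _ _ _ (cons_tuple k%:Z b)) ?big_cons; last by rewrite /= -Posz_bs.
by rewrite -mulrA mulrCA.
Qed.

Lemma coef_bs : c g bs = P * N g b.
Proof. by rewrite (@coefN_tuple _ _ _ _ b) // -Posz_bs. Qed.

Lemma nth_bs (j : 'I_n) : nth 0%N bs j = `|tnth b j|%N.
Proof. by rewrite (nth_map 0) ?size_tuple // -tnth_nth. Qed.

(** By symmetry [k] moves to slot [j]; the factor [b_j] completes the product of the remaining
    arguments to the common [P]. For [k = 0] both sides vanish. *)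
Lemma coef_rest (j : 'I_n) k :
  (nth 0%N bs j)%:R * c g (k :: take j bs ++ drop j.+1 bs)
  = P * (k%:R * N g (replace_arg b j k%:Z)).
Proof.
have [->|k0] := posnP k; first by rewrite coefN0 mul0r !mulr0.
have ltj : (j < size bs)%N by rewrite size_bs.
have szr : size (take j bs ++ k :: drop j.+1 bs) = n.
  by rewrite size_cat /= size_take size_drop ltj size_bs; have := ltn_ord j; lia.
have -> : c g (k :: take j bs ++ drop j.+1 bs) = c g (take j bs ++ k :: drop j.+1 bs).
  apply: (coefN_perm hN); rewrite /= ?size_cat ?size_take ?size_drop ?ltj ?size_bs //.
    by have := ltn_ord j; lia.
  by rewrite -cat1s -[k :: drop _ _]cat1s perm_catCA.
rewrite (@coefN_tuple _ _ _ _ (replace_arg b j k%:Z)); last first.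
  apply: (@eq_from_nth _ 0); first by rewrite size_tuple size_map szr.
  move=> i; rewrite size_tuple => lti.
  rewrite (nth_map 0%N) ?szr // nth_cat size_take ltj.
  rewrite -(tnth_nth 0 _ (Ordinal lti)) tnth_mktuple -val_eqE /=.
  case: ltngtP => [ltij|gtij|eqij].
  - by rewrite nth_take // (nth_map 0) ?size_tuple // gtz0_abs ?(tnth_nth 0) // -(tnth_nth 0 b (Ordinal lti)).
  - have -> : (i - j = (i - j.+1).+1)%N by lia.
    rewrite /= nth_drop (_ : j.+1 + (i - j.+1) = i)%N; last by lia.
    by rewrite (nth_map 0) ?size_tuple // gtz0_abs ?(tnth_nth 0) // -(tnth_nth 0 b (Ordinal lti)).
  - by rewrite eqij subnn.
rewrite big_cat big_cons /=.
have -> : P = (nth 0%N bs j)%:R * (\prod_(i <- take j bs) i%:R * \prod_(i <- drop j.+1 bs) i%:R).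
  rewrite -{1}(cat_take_drop j bs) (drop_nth 0%N ltj) big_cat big_cons /=; ring.
ring.
Qed.

Lemma sum_bs (f : 'I_(size bs) -> F) (h : 'I_n -> F) :
  (forall (i : 'I_(size bs)) (j : 'I_n), i = j :> nat -> f i = h j) ->
  \sum_(i < size bs) f i = \sum_(j < n) h j.
Proof.
move: f; rewrite size_bs => f fh.
by apply: eq_bigr => j _; apply: fh.
Qed.

Lemma replace_arg_id (j : 'I_n) : replace_arg b j (tnth b j) = b.
Proof. by apply: eq_from_tnth => i; rewrite tnth_mktuple; case: eqP => // ->. Qed.

Lemma Posz_tnth (j : 'I_n) : `|tnth b j|%N%:Z = tnth b j.
Proof. by rewrite gtz0_abs. Qed.

Lemma natm_neq0 : m%:R != 0 :> F. Proof. exact: (natF_neq0 char0 m_gt0). Qed.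

Lemma stb : (2 < g.*2 + size bs)%N. Proof. by rewrite size_bs. Qed.

Lemma sum_rest (j : 'I_n) (Q : pred nat) k :
  (nth 0%N bs j)%:R * (\sum_(1 <= i < k | Q i) c g (i :: take j bs ++ drop j.+1 bs))
  = P * \sum_(1 <= i < k | Q i) i%:R * N g (replace_arg b j i%:Z).
Proof. by rewrite !mulr_sumr; apply: eq_bigr => i _; rewrite coef_rest. Qed.

Lemma N_string0 : Nc m%:Z
  = \sum_(j < n) \sum_(1 <= k < (absz (tnth b j)).+1 | odd k != odd (absz (tnth b j)))
      k%:R * N g (replace_arg b j k%:Z).
Proof.
apply: (mulfI natm_neq0); apply: (mulfI P_neq0).
rewrite -coef_cons (string0 char0 m_gt0 hN stb bs_gt0) [RHS]mulrCA; congr (_ * _).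
by rewrite mulr_sumr; apply: sum_bs => i j ->; rewrite sum_rest nth_bs.
Qed.

Lemma N_string1 :
  (m%:R + 1) * Nc (m%:Z + 1) + (m%:R - 1) * Nc (m%:Z - 1)
  = 2 * m%:R * (\sum_(j < n) \sum_(1 <= k < (absz (tnth b j)).+1
                   | odd k == odd (absz (tnth b j)))
               k%:R * N g (replace_arg b j k%:Z))
        - m%:R * (\sum_(j < n) (tnth b j)%:~R * N g b).
Proof.
have -> : m%:Z + 1 = m.+1%:Z by rewrite -addn1 PoszD.
have -> : m%:Z - 1 = m.-1%:Z by move: m_gt0; lia.
have -> : m%:R + 1 = m.+1%:R :> F by rewrite -addn1 natrD.
have -> : m%:R - 1 = m.-1%:R :> F by rewrite -[in LHS](prednK m_gt0) -addn1 natrD addrK.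
apply: (mulfI P_neq0).
rewrite mulrDr -!coef_cons (string1 char0 m_gt0 hN stb bs_gt0).
rewrite -[2 * _]mulrC -mulrA -mulrBr [RHS]mulrCA; congr (_ * _).
rewrite mulr_sumr -sumrB mulr_sumr; apply: sum_bs => i j ->.
rewrite mulrBr mulrCA sum_rest coef_rest nth_bs Posz_tnth replace_arg_id mulrBr mulrCA.
by congr (_ - _ * (_ * _)); rewrite -[in RHS]Posz_tnth.
Qed.

Lemma N_neg n' (x : n'.-tuple int) k : (2 < g.*2 + n'.+1)%N ->
  N g (cons_tuple k x) = N g (cons_tuple (- k) x).
Proof.
move=> st'; apply: N_abs => // i.
by rewrite !(tnth_nth 0) /=; case: (nat_of_ord i) => //= ; rewrite abszN.
Qed.

(* For [m = 1] the argument [m - 2] is negative, but [N] is even. *)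
Lemma N_string2 :
  (m%:R - 2) * Nc (m%:Z - 2) - 2 * m%:R * Nc m%:Z + (m%:R + 2) * Nc (m%:Z + 2)
  = m%:R * (\sum_(j < n) \sum_(k <- [:: 1 + tnth b j; 1 - tnth b j])
               k%:~R * N g (replace_arg b j k)).
Proof.
apply: (mulfI P_neq0); rewrite [RHS]mulrCA.
have key (lam : seq (F * nat)) :
    \sum_(x <- lam) x.1 *: chebU 'X x.2 = discr 'X * chebU 'X m :> {poly F} ->
    \sum_(x <- lam) x.1 * c g (x.2 :: bs)
    = m%:R * (P * \sum_(j < n) \sum_(k <- [:: 1 + tnth b j; 1 - tnth b j])
               k%:~R * N g (replace_arg b j k)).
  move=> lamE; rewrite (string2 char0 m_gt0 hN stb bs_gt0 lamE); congr (_ * _).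
  rewrite mulr_sumr; apply: sum_bs => i0 j ->.
  rewrite mulrBr !coef_rest -mulrBr !big_cons big_nil addr0; congr (_ * _).
  have bj0 : (0 < `|tnth b j|)%N by rewrite absz_gt0 gt_eqF.
  rewrite nth_bs; congr (_ + _).
    have -> : 1 + tnth b j = `|tnth b j|%N.+1%:Z by rewrite -Posz_tnth; lia.
    by [].
  have -> : 1 - tnth b j = - `|tnth b j|%N.-1%:Z by rewrite -Posz_tnth; lia.
  rewrite rmorphN mulNr /=; congr (- (_ * _)).
  apply: N_abs => // i; rewrite !tnth_mktuple; case: eqP => // _.
  by rewrite abszN.
have [m2|m1] := leqP 2 m.
  have := key [:: (1, m.+2); (-2, m); (1, (m - 2)%N)].
  have Em : m = (m - 2).+2 by lia.
  rewrite !big_cons !big_nil /= !addr0 => <-.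
    rewrite !coef_cons.
    have -> : m%:Z - 2 = (m - 2)%N%:Z by lia.
    have -> : m%:Z + 2 = m.+2%:Z by lia.
    rewrite natrB // -[m.+2]addn2 natrD; ring.
  have := chebU_sub ('X : {poly F}) (m - 2); rewrite -!Em => <-.
  by rewrite !scale1r scaleNr scaler_nat mulr_natl addrA.
have m1' : m = 1%N by move: m_gt0; lia.
(* For [m = 1], [s^2 - 4 = U_3 - 3 U_1]; the term of argument [-1] equals minus that of argument [1]
   and merges with [-2 m N(m)]. *)
have := key [:: (1, 3%N); (-3, 1%N)].
rewrite m1' !big_cons !big_nil /= !addr0 => <-.
  rewrite !coef_cons (N_neg b (1 - 2)); last by move: st; lia.
  rewrite (_ : 1%:Z + 2 = 3%:Z) //; ring.
rewrite /discr scale1r scaleNr scaler_nat /=; ring.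
Qed.

Lemma N_slot0_poly :
  exists p : {poly F}, forall i : nat, ~~ odd i -> Nc i%:Z = p.[i%:R].
Proof.
have st' : (2 < 2 * g + n.+1)%N by move: st; lia.
have [_ quasi _] := hN (ltn0Sn n) st'.
have [p pE] := quasi (cons_tuple false [tuple odd `|tnth b i|%N | i < n]).
exists (mmap polyC (fun i : 'I_n.+1 =>
  if unlift ord0 i is Some j then ((tnth b j)%:~R ^+ 2)%:P else 'X^2) p).
move=> i ei; rewrite pE => [|j]; last first.
  case: (unliftP ord0 j) => [j'|] ->; last by rewrite !tnth0 /= (negbTE ei).
  by rewrite !tnthS tnth_mktuple.
rewrite mevalE /mmap horner_sum; apply: eq_bigr => u _.
rewrite hornerM hornerC; congr (_ * _); rewrite horner_prod; apply: eq_bigr => j _.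
rewrite horner_exp; congr (_ ^+ _); case: (unliftP ord0 j) => [j'|] ->.
  by rewrite tnthS hornerC.
by rewrite tnth0 hornerXn.
Qed.

Lemma N_dilaton_weights : exists L, forall lam, dilaton_weights m L lam ->
  \sum_(x <- lam) x.1 * Nc x.2%:Z = m%:R * (g.*2 + n - 2)%:R * N g b.
Proof.
have [L dil] := dilaton_exists char0 m_gt0 hN (g.*2 + n).
exists L => lam wlam; apply: (mulfI P_neq0).
have := dil lam wlam g bs; rewrite size_bs bs_gt0 coef_bs => h.
rewrite [RHS]mulrCA -{}h //; last by move: st; lia.
rewrite mulr_sumr /insert_at big_seq [RHS]big_seq; apply: eq_bigr => x xin.
have x0 := natF_neq0 char0 (allP wlam.1 _ xin).
by rewrite coef_cons /GRing.scale /=; field.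
Qed.

(* For [m = 1] the argument [m - 1 = 0] is not an expansion index: [N] at [0] is
   recovered from positive even arguments by finite differences, and the same
   differences of [chebC] vanish modulo a power of [discr]. *)
Lemma N_dilaton : Nc (m%:Z + 1) - Nc (m%:Z - 1)
  = m%:R * (2 * g%:Z - 2 + n%:Z)%:~R * N g b.
Proof.
have -> : 2 * g%:Z - 2 + n%:Z = (g.*2 + n - 2)%N%:Z by move: st; lia.
have [L dil] := N_dilaton_weights.
have -> : m%:Z + 1 = m.+1%:Z by lia.
have -> : m%:Z - 1 = m.-1%:Z by move: m_gt0; lia.
have [m2|m1] := leqP 2 m.
  have := dil [:: (1, m.+1); (-1, m.-1)].
  rewrite !big_cons big_nil /= mul1r addr0 mulN1r; apply; split.
    by rewrite /= andbT; lia.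
  rewrite !big_cons big_nil addr0 /= scale1r scaleN1r.
  have -> : m = m.-1.+1 by lia.
  by rewrite chebC_sub subrr dvdp0.
have m1' : m = 1%N by move: m_gt0; lia.
have [p pE] := N_slot0_poly.
(* Taking [2L'] differences kills the polynomial [p] and turns [C_0] into a multiple of
   [discr ^ L'], so both requirements are met by the same weights. *)
pose L' := maxn L (size p).
have [lam [lpos lamE]] := diff2_weights F L'.*2.
have E0 : Nc 0 + \sum_(x <- lam) x.1 * Nc x.2%:Z = 0.
  have := lamE F^o (fun i => Nc i%:Z) 0%N.
  rewrite (diff2_poly pE) //; last by rewrite /L'; lia.
have := dil ((1, 2%N) :: lam); rewrite big_cons mul1r => h.
rewrite -{}h; first by rewrite m1' (eqP (_ : \sum_(x <- lam) _ == - Nc 0)) // -addr_eq0 addrC E0.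
split; first by rewrite /= lpos.
have := lamE _ (chebC 'X) 0%N; rewrite diff2_chebC => /eqP; rewrite addrC -subr_eq => /eqP E.
rewrite big_cons /= m1'.
have <- : \sum_(x <- lam) x.1 *: chebC 'X (0 + x.2) = \sum_(x <- lam) x.1 *: chebC 'X x.2 :> {poly F}.
  by apply: eq_bigr.
rewrite -E (_ : _ - _ = discr 'X ^+ L' * chebC 'X (0 + L'.*2)).
  by rewrite dvdp_mulr // dvdp_exp2l // leq_maxl.
by rewrite /discr scale1r /=; ring.
Qed.
End Translation.

Theorem theorem3 (R : realType) (m : nat) (hm : (1 <= m)%N)
    (N : forall g n : nat, n.-tuple int -> complex R)
    (hN : EO_quasi_polynomials m N)
    (g n : nat) (hn : (1 <= n)%N) (hgn : (0 < 2 * g%:Z - 2 + n%:Z)%R)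
    (b : n.-tuple int) (hb : forall j : 'I_n, 0 < tnth b j) :
  [/\ N g n.+1 (cons_tuple m%:Z b)
      = \sum_(j < n)
          \sum_(1 <= k < (absz (tnth b j)).+1 | odd k != odd (absz (tnth b j)))
            k%:R * N g n (replace_arg b j k%:Z),
      (m%:R + 1) * N g n.+1 (cons_tuple (m%:Z + 1) b)
      + (m%:R - 1) * N g n.+1 (cons_tuple (m%:Z - 1) b)
      = 2 * m%:R
        * (\sum_(j < n)
             \sum_(1 <= k < (absz (tnth b j)).+1
                   | odd k == odd (absz (tnth b j)))
               k%:R * N g n (replace_arg b j k%:Z))
        - m%:R * (\sum_(j < n) (tnth b j)%:~R * N g n b),
      (m%:R - 2) * N g n.+1 (cons_tuple (m%:Z - 2) b)
      - 2 * m%:R * N g n.+1 (cons_tuple m%:Z b)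
      + (m%:R + 2) * N g n.+1 (cons_tuple (m%:Z + 2) b)
      = m%:R
        * (\sum_(j < n)
             \sum_(k <- [:: 1 + tnth b j; 1 - tnth b j])
               k%:~R * N g n (replace_arg b j k))
    & N g n.+1 (cons_tuple (m%:Z + 1) b) - N g n.+1 (cons_tuple (m%:Z - 1) b)
      = m%:R * (2 * g%:Z - 2 + n%:Z)%:~R * N g n b].
Proof.
have char0 k : k.+1%:R != 0 :> complex R by rewrite pnatr_eq0.
have st : (2 < g.*2 + n)%N by move: hgn; lia.
split.
- exact: (N_string0 char0 hm hN hn st hb).
- exact: (N_string1 char0 hm hN hn st hb).
- exact: (N_string2 char0 hm hN hn st hb).
- exact: (N_dilaton char0 hm hN hn st hb).
Qed.
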